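(* Let $T\subset\mathbb R^3$ be a tetrahedron with Alfeld split $T^{\rm R}$ and let $k\ge1$. Then $$\operatorname{div}\mathbb B_k^{\rm div}(T^{\rm R};\mathbb S)=\mathbb P_{k-1}^{-1}(T^{\rm R};\mathbb R^3)/{\rm RM},$$ and $$\dim\mathbb B_k^{\rm div}(T^{\rm R};\mathbb S)=\dim\mathbb B_k^{\rm div}(T^{\rm R};\mathbb M)-\dim\mathbb P_k^{-1}(T^{\rm R};\mathbb R^3)+3=(k+1)(k+2)(4k-3).$$
   Context: The Alfeld split $T^{\rm R}=\{T_0,\dots,T_3\}$ of a tetrahedron $T$ is the subdivision obtained by joining the barycenter of $T$ to its four vertices. $\mathbb M$ and $\mathbb S$ are the spaces of all and of symmetric real $3\times3$ matrices. For $\mathbb X\in\{\mathbb R^3,\mathbb M,\mathbb S\}$, $\mathbb P_r^{-1}(T^{\rm R};\mathbb X)$ is the space of $\mathbb X$-valued $L^2$ functions on $T$ whose restriction to each $T_i$ is polynomial of total degree at most $r$. ${\rm RM}=\{\boldsymbol a+\boldsymbol b\times\boldsymbol x:\boldsymbol a,\boldsymbol b\in\mathbb R^3\}$. For subspaces $U,V$ of $L^2(D)$ (vector-valued if necessary), $U/V:=\{u\in U:(u,v)_D=0\text{ for all }v\in V\}$ (an $L^2$-orthogonal complement, not an abstract quotient). $\operatorname{div}$ acts row-wise on matrix fields. For $\mathbb X\in\{\mathbb M,\mathbb S\}$, $H({\rm div},T;\mathbb X)=\{\boldsymbol\tau\in L^2(T;\mathbb X):\operatorname{div}\boldsymbol\tau\in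 L^2(T;\mathbb R^3)\}$, and $H_0({\rm div},T;\mathbb X)$ is its subspace with $\boldsymbol\tau\boldsymbol n=\boldsymbol 0$ on $\partial T$. The map $\operatorname{vskw}:\mathbb M\to\mathbb R^3$ sends $\boldsymbol B$ to the vector $\boldsymbol\omega$ with $\boldsymbol\omega\times\boldsymbol y=\frac12(\boldsymbol B-\boldsymbol B^{\intercal})\boldsymbol y$ for all $\boldsymbol y$. The bubble spaces are $$\mathbb B_k^{\rm div}(T^{\rm R};\mathbb S)=\mathbb P_k^{-1}(T^{\rm R};\mathbb S)\cap H_0({\rm div},T;\mathbb S),$$ $$\mathbb B_k^{\rm div}(T^{\rm R};\mathbb M)=\Big\{\boldsymbol\tau\in\mathbb P_k^{-1}(T^{\rm R};\mathbb M)\cap H_0({\rm div},T;\mathbb M):\int_T\operatorname{vskw}\boldsymbol\tau\,{\rm d}x=0\Big\}.$$ *)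

(* Defs.v *)
From HB Require Import structures.
From mathcomp Require Import all_boot all_order all_algebra.
From mathcomp Require Import all_classical all_reals all_analysis.
From mathcomp Require Import ring.
(* Without its notations, which clash with those of the analysis library:
   [mpoly.mpoly n R] is the type {mpoly R[n]}. *)
From mathcomp Require Import -(notations) mpoly.

Set Implicit Arguments.
Unset Strict Implicit.
Unset Printing Implicit Defensive.
Import Order.TTheory GRing.Theory Num.Theory.
Import numFieldNormedType.Exports.

Local Open Scope classical_set_scope.
Local Open Scope ring_scope.

Section Integration.
Context {R : realType}.
Notation point3 := 'cV[R]_3.

(* The library has no Lebesgue measure on column vectors; the product measure
   on R * R * R is used instead, read through the coordinate bijection pt3. *)
Definition pt3 (z : R * R * R) : point3 :=
  \col_i [:: z.1.1; z.1.2; z.2]`_i.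

Definition leb3 :
    {measure set (measurableTypeR R * measurableTypeR R * measurableTypeR R)
       -> \bar R} :=
  ((@lebesgue_measure R \x @lebesgue_measure R) \x @lebesgue_measure R)%E.

Definition integral3 (D : set point3) (f : point3 -> R) : R :=
  Rintegral leb3 (pt3 @^-1` D) (f \o pt3).

Definition ae_on (D : set point3) (P : point3 -> Prop) : Prop :=
  {ae leb3, forall z, D (pt3 z) -> P (pt3 z)}.

(* L^2(D; X).  Elements of L^2 are represented by functions, whose values
   outside D are irrelevant; classes are dealt with through [ae_on]. *)
Definition L2 m n (D : set point3) (X : set 'M[R]_(m, n)) :
    set (point3 -> 'M[R]_(m, n)) :=
  [set u | (forall x, D x -> X (u x)) /\
           forall i j, (fun z => u (pt3 z) i j) \_ (pt3 @^-1` D)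
                         \in Lfun leb3 2%:E].

Definition L2inner m n (D : set point3) (u v : point3 -> 'M[R]_(m, n)) : R :=
  integral3 D (fun x => \sum_i \sum_j u x i j * v x i j).

(* U / V *)
Definition L2orth m n (D : set point3)
    (U V : set (point3 -> 'M[R]_(m, n))) : set (point3 -> 'M[R]_(m, n)) :=
  [set u | U u /\ forall v, V v -> L2inner D u v = 0].

(* The classes modulo equality a.e. on D of the elements of U form a vector
   space of dimension d: b represents a basis of it. *)
Definition L2dim m n (D : set point3)
    (U : set (point3 -> 'M[R]_(m, n))) (d : nat) : Prop :=
  exists b : 'I_d -> point3 -> 'M[R]_(m, n),
    [/\ forall c : 'I_d -> R, U (fun x => \sum_i c i *: b i x),
        forall u, U u -> exists c : 'I_d -> R,
          ae_on D (fun x => u x = \sum_i c i *: b i x)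
      & forall c : 'I_d -> R,
          ae_on D (fun x => \sum_i c i *: b i x = 0) -> forall i, c i = 0].

End Integration.

Section WeakDivergence.
Context {R : realType}.
Notation point3 := 'cV[R]_3.

Definition partial (j : 'I_3) (f : point3 -> R) : point3 -> R :=
  fun x => 'D_(delta_mx j 0) f x.

Fixpoint Cn (n : nat) (f : point3 -> R) : Prop :=
  if n is n'.+1 then
    [/\ continuous f,
        forall x j, derivable f x (delta_mx j 0)
      & forall j, Cn n' (partial j f)]
  else continuous f.

Definition smooth (f : point3 -> R) : Prop := forall n, Cn n f.

Definition test_function (D : set point3) (phi : point3 -> R) : Prop :=
  let supp := closure [set x | phi x != 0] in
  [/\ smooth phi, compact supp & supp `<=` interior D].

Definition L2_vec (D : set point3) : set (point3 -> 'cV[R]_3) := L2 D setT.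

(* g is (a representative of) the row-wise distributional divergence of tau on
   the interior of D, and belongs to L^2(D). *)
Definition is_div (D : set point3) (tau : point3 -> 'M[R]_3)
    (g : point3 -> 'cV[R]_3) : Prop :=
  L2_vec D g /\
  forall phi, test_function D phi -> forall i,
    integral3 D (fun x => \sum_j tau x i j * partial j phi x)
    = - integral3 D (fun x => g x i 0 * phi x).

Definition Hdiv (D : set point3) (X : set 'M[R]_3) :
    set (point3 -> 'M[R]_3) :=
  [set tau | L2 D X tau /\ exists g, is_div D tau g].

(* The i-th component of the normal trace of tau on the boundary of D,
   applied to phi; by Green's formula it is the surface integral of
   (tau n)_i * phi over the boundary when tau is regular enough. *)
Definition normal_trace (D : set point3) (tau : point3 -> 'M[R]_3)
    (g : point3 -> 'cV[R]_3) (i : 'I_3) (phi : point3 -> R) : R :=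
  integral3 D (fun x => \sum_j tau x i j * partial j phi x)
  + integral3 D (fun x => g x i 0 * phi x).

(* tau n = 0 on the boundary, as for every field in H(div): the normal trace
   vanishes on all functions that are smooth up to the boundary. *)
Definition Hdiv0 (D : set point3) (X : set 'M[R]_3) :
    set (point3 -> 'M[R]_3) :=
  [set tau | Hdiv D X tau /\
     forall g, is_div D tau g ->
     forall i phi, smooth phi -> normal_trace D tau g i phi = 0].

Definition div_image (D : set point3) (U : set (point3 -> 'M[R]_3)) :
    set (point3 -> 'cV[R]_3) :=
  [set g | exists2 tau, U tau & is_div D tau g].

End WeakDivergence.

Section Alfeld.
Context {R : realType}.
Notation point3 := 'cV[R]_3.
Implicit Type v : 'I_4 -> point3.

Definition affinely_independent v : Prop :=
  forall c : 'I_4 -> R,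
    \sum_i c i = 0 -> \sum_i c i *: v i = 0 -> forall i, c i = 0.

Definition tetra v : set point3 :=
  [set x | exists c : 'I_4 -> R,
     [/\ forall i, 0 <= c i, \sum_i c i = 1 & x = \sum_i c i *: v i]].

Definition barycenter v : point3 := 4^-1 *: \sum_i v i.

(* T_i: the i-th vertex is replaced by the barycenter. *)
Definition alfeld v (i : 'I_4) : set point3 :=
  tetra (fun j => if j == i then barycenter v else v j).

Definition poly_deg_le (r : nat) (p : mpoly.mpoly 3 R) : Prop :=
  (mpoly.msize p <= r.+1)%N.

(* P_r^{-1}(T^R; X) *)
Definition Pdisc m n v (r : nat) (X : set 'M[R]_(m, n)) :
    set (point3 -> 'M[R]_(m, n)) :=
  [set u | L2 (tetra v) X u /\
     forall l : 'I_4, exists p : 'I_m -> 'I_n -> mpoly.mpoly 3 R,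
       (forall i j, poly_deg_le r (p i j)) /\
       ae_on (alfeld v l)
         (fun x => u x = \matrix_(i, j) mpoly.meval (fun s => x s 0) (p i j))].

(* Indices of 'I_3 are added modulo 3. *)
Definition cross (a b : point3) : point3 :=
  \col_(i < 3) (a (i + 1) 0 * b (i + 2) 0 - a (i + 2) 0 * b (i + 1) 0).

Definition RM : set (point3 -> point3) :=
  [set u | exists a b : point3, u = fun x => a + cross b x].

Definition sym_mx : set 'M[R]_3 := [set A | A^T = A].

Definition vskw (B : 'M[R]_3) : point3 :=
  \col_(i < 3) (2^-1 * (B (i + 2) (i + 1) - B (i + 1) (i + 2))).

Lemma vskwP (B : 'M[R]_3) (w : point3) :
  (forall y : point3, cross w y = 2^-1 *: ((B - B^T) *m y)) <-> w = vskw B.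
Proof.
have ind3 (P : 'I_3 -> Prop) : P 0 -> P 1 -> P 2 -> forall i, P i.
  move=> P0 P1 P2; case=> [[|[|[|//]]] lti].
  - by rewrite (_ : Ordinal lti = 0)//; exact/val_inj.
  - by rewrite (_ : Ordinal lti = 1)//; exact/val_inj.
  - by rewrite (_ : Ordinal lti = 2)//; exact/val_inj.
have e01 : 0 + 1 = 1 :> 'I_3 by exact/val_inj.
have e02 : 0 + 2 = 2 :> 'I_3 by exact/val_inj.
have e11 : 1 + 1 = 2 :> 'I_3 by exact/val_inj.
have e12 : 1 + 2 = 0 :> 'I_3 by exact/val_inj.
have e21 : 2 + 1 = 0 :> 'I_3 by exact/val_inj.
have e22 : 2 + 2 = 1 :> 'I_3 by exact/val_inj.
have E := (e01, e02, e11, e12, e21, e22).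
have big3 (F : 'I_3 -> R) : \sum_j F j = F 0 + F 1 + F 2.
  rewrite !big_ord_recl big_ord0 addr0 addrA.
  by congr (F _ + F _ + F _); exact/val_inj.
split=> [wB|-> y].
- apply/matrixP=> i j; rewrite (ord1 j) {j} !mxE.
  have := congr1 (fun u : point3 => u (i + 2) 0) (wB (delta_mx (i + 1) 0)).
  rewrite !mxE big3 !mxE.
  by elim/ind3: i; rewrite ?E !eqxx/= !(mulr1, mulr0, addr0, add0r, subr0).
- apply/matrixP=> i j; rewrite (ord1 j) {j} !mxE big3 !mxE.
  by elim/ind3: i; rewrite ?E; field.
Qed.

Definition Bdiv_S v (k : nat) : set (point3 -> 'M[R]_3) :=
  Pdisc v k sym_mx `&` Hdiv0 (tetra v) sym_mx.

Definition Bdiv_M v (k : nat) : set (point3 -> 'M[R]_3) :=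
  [set tau | (Pdisc v k setT `&` Hdiv0 (tetra v) setT) tau /\
             forall i, integral3 (tetra v) (fun x => vskw (tau x) i 0) = 0].

End Alfeld.

(* Main.v *)
Require Import Defs.
From HB Require Import structures.
From mathcomp Require Import all_boot all_order all_algebra all_fingroup.
From mathcomp Require Import all_classical all_reals all_analysis.
From mathcomp Require Import measurable_realfun ring lra.
From mathcomp Require Import -(notations) mpoly.

Set Implicit Arguments.
Unset Strict Implicit.
Unset Printing Implicit Defensive.
Import Order.TTheory GRing.Theory Num.Theory.
Import numFieldNormedType.Exports.

Local Open Scope classical_set_scope.
Local Open Scope ring_scope.

(* A piecewise polynomial of degree k on the Alfeld split is determined by its
   coefficients in scaled Bernstein bases of the four tetrahedra.  By Green's
   formula it is a bubble iff its normal components are continuous across the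
   interior faces and vanish on the boundary; in terms of the coefficients, these
   conditions decouple into small systems, one for each exponent b, and each
   system has full rank, already on symmetric matrices.  Counting the equations,
   with three more for the mean of vskw, gives the dimensions.

   The divergence of a symmetric bubble is orthogonal to RM by Green's formula.
   Conversely let z be a piecewise polynomial of degree k - 1 orthogonal to RM
   and to the divergences of all symmetric bubbles.  If k >= 2, testing with
   bubbles (lambda_a lambda_b q) t t^T supported in one tetrahedron, where t is
   the edge ab and q the derivative along t of z.t, shows that the strain of z
   vanishes on each piece, so z is piecewise rigid; quadratic bubbles then glue
   the four rigid motions into one, so z is in RM and z = 0.  If k = 1, z is
   piecewise constant and linear bubbles suffice. *)

(** * Change of variables for the Lebesgue measure on R^3 *)

(** Full rank is a symmetry argument: for one exponent, the Lagrange multipliers tested on symmetric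
    matrices give numbers a(l,p,q) symmetric in (l,p) and antisymmetric in (p,q), and such an array
    is zero. The boundary multipliers must not disturb this, and here k >= 1 enters: the exponent 0
    carries no boundary condition, while an exponent with b_p > 0 has no coefficient in the
    tetrahedron p, so that the vectors v_q - v_p can serve as tests, on which the boundary terms
    vanish.

    The field z of the overview is a remainder: a given field orthogonal to RM, minus its L^2
    projection on the finite-dimensional space of divergences of bubbles.

    An obstacle is that the divergence and the zero trace are weak notions, quantified over all
    representatives and all smooth functions. Pointwise face conditions are recovered with smooth
    cutoffs that live on one tetrahedron or are nonzero on one face only.

    In the gluing, the bubbles that vanish on the boundary leave a one-parameter family of spins s
    (v_l - c), with c the barycenter; one more bubble, not zero on the boundary, excludes it. *)

Section AffineChange1.
Context {R : realType}.
Notation mu := (@lebesgue_measure R).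
Local Open Scope ereal_scope.

Lemma measurable_affine1 (a b : R) :
  measurable_fun [set: R] (fun x => a * x + b)%R.
Proof.
apply: measurable_funD => //.
Qed.

(** Half-open intervals determine the Lebesgue measure, so the identity is checked on them. The sign
    of [a] only decides which end of the preimage interval is closed. *)
Lemma lebesgue_measure_affine (a b : R) (A : set R) :
  a != 0%R -> measurable A ->
  mu ((fun x => a * x + b)%R @^-1` A) = `|a|^-1%:E * mu A.
Proof.
move=> a0 mA; have na0 : (0 < `|a|)%R by rewrite normr_gt0.
pose phi := (fun x => a * x + b)%R.
have mphi : measurable_fun [set: R] phi by exact: measurable_affine1.
pose nu0 : {measure set (measurableTypeR R) -> \bar R} :=
  ltac:(refine (pushforward mu (phi : R -> measurableTypeR R)); exact: mphi).
pose nu : {measure set (measurableTypeR R) -> \bar R} :=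
  mscale (NngNum (ltW na0)) nu0.
suff -> : mu A = nu A.
  by rewrite /nu/= /mscale/= /pushforward muleA -EFinM mulVf ?mul1e// gt_eqF.
apply: lebesgue_measure_unique => // _ [[x y]] _ <-.
rewrite /nu/= /mscale/= /pushforward /= lebesgue_measure_itv/= lte_fin.
have [ap|an|a00] := ltgtP 0%R a; last by rewrite -a00 eqxx in a0.
- rewrite (_ : phi @^-1` _ = `]((x - b) / a)%R, ((y - b) / a)%R]%classic); last first.
    apply/seteqP; split => z /=; rewrite !in_itv/= /phi ltr_pdivrMr// ler_pdivlMr//;
      rewrite ltrBlDr lerBrDr ![(z * a)%R]mulrC//.
  rewrite lebesgue_measure_itv/= lte_fin ltr_pM2r ?invr_gt0// ltrD2r.
  case: ifPn => // _; last by rewrite mule0.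
  rewrite gtr0_norm// -!EFinB -EFinM; congr (_%:E); field; exact: a0.
- rewrite (_ : phi @^-1` _ = `[((y - b) / a)%R, ((x - b) / a)%R[%classic); last first.
    apply/seteqP; split => z /=; rewrite !in_itv/= /phi ler_ndivrMr// ltr_ndivlMr//;
      rewrite ltrBlDr lerBrDr ![(z * a)%R]mulrC//; by rewrite andbC.
  rewrite lebesgue_measure_itv/= lte_fin ltr_nM2r ?invr_lt0// ltrD2r.
  case: ifPn => // _; last by rewrite mule0.
  rewrite ltr0_norm// -!EFinB -EFinM; congr (_%:E); field; exact: a0.
Qed.

Lemma integral_affine1 (a b : R) (f : R -> \bar R) : a != 0%R ->
  measurable_fun [set: R] f -> (forall x, 0 <= f x) ->
  \int[mu]_x f (a * x + b)%R = `|a|^-1%:E * \int[mu]_x f x.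
Proof.
move=> a0 mf f0.
have na0 : (0 <= `|a|^-1)%R by rewrite invr_ge0.
have mphi := measurable_affine1 a b.
have := @ge0_integral_pushforward _ _ (measurableTypeR R) (measurableTypeR R) R
  _ mphi mu setT f measurableT mf (fun x _ => f0 x).
rewrite preimage_setT => <-.
have := @ge0_integral_mscale _ (measurableTypeR R) R mu setT measurableT
  (NngNum na0) f mf (fun x _ => f0 x).
move=> /= <-.
apply: eq_measure_integral => A mA _.
exact: lebesgue_measure_affine.
Qed.
End AffineChange1.

Section Coordinates.
Context {R : realType}.

Lemma ord3P (P : 'I_3 -> Prop) : P 0 -> P 1 -> P 2 -> forall i, P i.
Proof.
move=> P0 P1 P2; case=> [[|[|[|//]]] lti].
- by rewrite (_ : Ordinal lti = 0)//; exact/val_inj.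
- by rewrite (_ : Ordinal lti = 1)//; exact/val_inj.
- by rewrite (_ : Ordinal lti = 2)//; exact/val_inj.
Qed.

Lemma big3 (V : nmodType) (F : 'I_3 -> V) : \sum_j F j = F 0 + F 1 + F 2.
Proof.
rewrite !big_ord_recl big_ord0 addr0 addrA.
by congr (F _ + F _ + F _); exact/val_inj.
Qed.

Definition unpt3 (x : 'cV[R]_3) : R * R * R := (x 0 0, x 1 0, x 2 0).

Lemma pt3E (z : R * R * R) :
  (pt3 z 0 0 = z.1.1) * (pt3 z 1 0 = z.1.2) * (pt3 z 2 0 = z.2).
Proof. by rewrite !mxE. Qed.

Lemma pt3K : cancel (@pt3 R) unpt3.
Proof. by case=> [[x y] z]; rewrite /unpt3 !pt3E. Qed.

Lemma unpt3K : cancel unpt3 (@pt3 R).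
Proof.
by move=> x; apply/matrixP => i j; rewrite (ord1 j) {j}; elim/ord3P: i;
  rewrite pt3E.
Qed.

Lemma det_mx3 (A : 'M[R]_3) : \det A =
  A 0 0 * (A 1 1 * A 2 2 - A 1 2 * A 2 1)
  - A 0 1 * (A 1 0 * A 2 2 - A 1 2 * A 2 0)
  + A 0 2 * (A 1 0 * A 2 1 - A 1 1 * A 2 0).
Proof.
rewrite (expand_det_row _ 0) big3 /cofactor.
rewrite !(expand_det_row _ 0) !big_ord_recl !big_ord0 /cofactor !det_mx11 !mxE /=.
rewrite /= !(expr0, expr1, mul1r, addr0, add0n) sqrrN expr1n !mul1r.
do ![rewrite (_ : lift (0 : 'I_3) 0 = 1); last exact/val_inj].
rewrite (_ : lift (0 : 'I_3) (lift 0 0) = 2); last exact/val_inj.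
do ![rewrite (_ : lift (1 : 'I_3) 0 = 0); last exact/val_inj].
rewrite (_ : lift (1 : 'I_3) (lift 0 0) = 2); last exact/val_inj.
do ![rewrite (_ : lift (2 : 'I_3) 0 = 0); last exact/val_inj].
rewrite (_ : lift (2 : 'I_3) (lift 0 0) = 1); last exact/val_inj.
rewrite (_ : lift (0 : 'I_3) (lift (lift ord0 ord0) 0) = 1); last exact/val_inj.
rewrite (_ : lift (1 : 'I_3) (lift (lift ord0 ord0) 0) = 0); last exact/val_inj.
rewrite (_ : lift (2 : 'I_3) (lift (lift ord0 ord0) 0) = 0); last exact/val_inj.
ring.
Qed.
End Coordinates.

Section TripleProduct.
Local Open Scope ereal_scope.
Context {R : realType} d (T : measurableType d).
Variable m : {sigma_finite_measure set T -> \bar R}.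

(* The library makes the product of two measures sigma-finite only for
   subprobabilities. *)
Lemma sigma_finite_prod : sigma_finite setT (m \x m).
Proof.
have /sigma_finiteP[F [FT ndF Foo]] := sigma_finiteT m.
exists (fun n => F n `*` F n).
  apply/seteqP; split=> // -[x y] _.
  have : setT x by []. have : setT y by []. rewrite FT => -[k _ Fky] [n _ Fnx].
  exists (maxn n k) => //; split => /=.
    by move: Fnx; apply/subsetPset/ndF/leq_maxl.
  by move: Fky; apply/subsetPset/ndF/leq_maxr.
move=> k; have [mF Fk] := Foo k; split; first exact: measurableX.
by rewrite product_measure1E// lte_mul_pinfty// ge0_fin_numE.
Qed.

Definition sprod : {sigma_finite_measure set (T * T)%type -> \bar R} :=
  HB.pack (m \x m) (Measure_isSigmaFinite.Build _ _ _ (m \x m) sigma_finite_prod).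
Let mm := sprod.

Lemma integral_swap2 (f : T * T -> \bar R) :
  measurable_fun setT f -> (forall z, 0 <= f z) ->
  \int[m \x m]_z f (z.2, z.1) = \int[m \x m]_z f z.
Proof.
move=> mf f0.
have ms : measurable_fun setT (fun z : T * T => (z.2, z.1)).
  by apply: measurable_fun_pair.
rewrite (@fubini_tonelli1 _ _ _ _ R m m f)//.
rewrite (@fubini_tonelli2 _ _ _ _ R m m (fun z => f (z.2, z.1)))//.
exact: (measurableT_comp mf ms).
Qed.

Lemma integral_swap12 (f : T * T * T -> \bar R) :
  measurable_fun setT f -> (forall z, 0 <= f z) ->
  \int[m \x m \x m]_z f (z.1.2, z.1.1, z.2) = \int[m \x m \x m]_z f z.
Proof.
move=> mf f0.
have ms : measurable_fun setT (fun z : T * T * T => (z.1.2, z.1.1, z.2)).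
  apply: measurable_fun_pair => //; apply: measurable_fun_pair.
    exact: (measurableT_comp measurable_snd measurable_fst).
  exact: (measurableT_comp measurable_fst measurable_fst).
have mfs : measurable_fun setT (fun z => f (z.1.2, z.1.1, z.2)).
  exact: (measurableT_comp mf ms).
rewrite (@fubini_tonelli2 _ _ _ _ R mm m f)//.
have E := @fubini_tonelli2 _ _ _ _ R mm m _ mfs (fun z => f0 _).
etransitivity; first exact: E.
apply: eq_integral => z _; rewrite /fubini_G /=.
by rewrite (integral_swap2 (f := fun p => f (p, z)))//; exact: measurable_fun_pair1.
Qed.

Lemma integral_prod3 (f : T * T * T -> \bar R) :
  measurable_fun setT f -> (forall z, 0 <= f z) ->
  \int[m \x m \x m]_z f z = \int[m]_x \int[m]_y \int[m]_z f (x, y, z).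
Proof.
move=> mf f0.
rewrite (@fubini_tonelli1 _ _ _ _ R mm m f)//.
rewrite (@fubini_tonelli1 _ _ _ _ R m m (fubini_F m f))//.
- exact: measurable_fun_fubini_tonelli_F.
- by move=> x; exact: integral_ge0.
Qed.

Lemma integral_swap23 (f : T * T * T -> \bar R) :
  measurable_fun setT f -> (forall z, 0 <= f z) ->
  \int[m \x m \x m]_z f (z.1.1, z.2, z.1.2) = \int[m \x m \x m]_z f z.
Proof.
move=> mf f0.
have ms : measurable_fun setT (fun z : T * T * T => (z.1.1, z.2, z.1.2)).
  apply: measurable_fun_pair => //; last first.
    exact: (measurableT_comp measurable_snd measurable_fst).
  apply: measurable_fun_pair => //.
  exact: (measurableT_comp measurable_fst measurable_fst).
have mfs : measurable_fun setT (fun z => f (z.1.1, z.2, z.1.2)).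
  exact: (measurableT_comp mf ms).
rewrite [RHS](integral_prod3 mf f0).
have E := integral_prod3 mfs (fun z => f0 _).
etransitivity; first exact: E.
apply: eq_integral => x _ /=.
rewrite (@fubini_tonelli _ _ _ _ R m m (fun p => f (x, p.1, p.2)))//.
apply: (measurableT_comp mf (g := fun p => (x, p.1, p.2))).
by apply: measurable_fun_pair => //; exact: measurable_fun_pair.
Qed.
End TripleProduct.

Section ChangeOfVariables.
Context {R : realType}.
Notation mu := (@lebesgue_measure R).
Notation R3 := (measurableTypeR R * measurableTypeR R * measurableTypeR R)%type.
Local Open Scope ereal_scope.

(* For linear phi, k is the inverse of |det phi|. *)
Definition scales (phi : R3 -> R3) (k : R) : Prop :=
  measurable_fun setT phi /\
  forall f : R3 -> \bar R, measurable_fun setT f -> (forall z, 0 <= f z) ->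
    \int[leb3]_z f (phi z) = k%:E * \int[leb3]_z f z.

Lemma scales_comp phi psi k l :
  scales phi k -> scales psi l -> scales (phi \o psi) (l * k).
Proof.
move=> [mphi phiE] [mpsi psiE]; split; first exact: measurableT_comp.
move=> f mf f0; rewrite EFinM -muleA -phiE// -(psiE (f \o phi))//=.
exact: measurableT_comp.
Qed.

Lemma measurable_coords :
  [/\ measurable_fun setT (fun z : R3 => z.1.1 : R),
      measurable_fun setT (fun z : R3 => z.1.2 : R)
    & measurable_fun setT (fun z : R3 => z.2 : R)].
Proof.
split; last exact: measurable_snd.
- exact: (measurableT_comp measurable_fst measurable_fst).
- exact: (measurableT_comp measurable_snd measurable_fst).
Qed.

Lemma scales_swap12 : scales (fun z => (z.1.2, z.1.1, z.2)) 1.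
Proof.
have [? ? ?] := measurable_coords.
split; first by apply: measurable_fun_pair => //; exact: measurable_fun_pair.
by move=> f mf f0; rewrite mul1e; exact: (@integral_swap12 R _ _ mu).
Qed.

Lemma scales_swap23 : scales (fun z => (z.1.1, z.2, z.1.2)) 1.
Proof.
have [? ? ?] := measurable_coords.
split; first by apply: measurable_fun_pair => //; exact: measurable_fun_pair.
by move=> f mf f0; rewrite mul1e; exact: (@integral_swap23 R _ _ mu).
Qed.

(** Fubini in the last coordinate leaves a one-dimensional affine change of variables, with slope
    [a] and an offset that depends on the two other coordinates. *)
Lemma scales_shear (a : R) (g : measurableTypeR R * measurableTypeR R -> R) :
  a != 0%R -> measurable_fun setT g ->
  scales (fun z => (z.1, a * z.2 + g z.1)%R) `|a|^-1.
Proof.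
move=> a0 mg.
pose phi : R3 -> R3 := fun z => (z.1, a * z.2 + g z.1)%R.
have mphi : measurable_fun setT phi.
  apply: measurable_fun_pair; first exact: measurable_fst.
  apply: measurable_funD; last exact: (measurableT_comp mg measurable_fst).
  by apply: measurable_funM => //; exact: measurable_snd.
split=> // f mf f0.
have mfphi := measurableT_comp mf mphi.
have ka : (0 <= `|a|^-1)%R by rewrite invr_ge0.
pose mm := sprod mu.
have E1 := @fubini_tonelli1 _ _ _ _ R mm mu (f \o phi) mfphi.
have E2 := @fubini_tonelli1 _ _ _ _ R mm mu f mf.
rewrite [LHS]E1; last by move=> z; exact: f0.
rewrite [in RHS]E2// -ge0_integralZl//; last 2 first.
- exact: measurable_fun_fubini_tonelli_F.
- by move=> x _; exact: integral_ge0.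
apply: eq_integral => x _.
apply: (@integral_affine1 R a (g x) (fun y => f (x, y))) => //.
exact: measurable_fun_pair2.
Qed.
End ChangeOfVariables.

Lemma lup_decomposition (F : fieldType) n (A : 'M[F]_n.+1) :
  exists s L U, [/\ perm_mx s *m A = L *m U,
    forall i j : 'I_n.+1, (i <= j)%N -> L i j = (i == j)%:R
    & forall i j : 'I_n.+1, (j < i)%N -> U i j = 0].
Proof.
have := cormen_lup_correct A; have := cormen_lup_perm A.
have := @cormen_lup_lower _ _ A; have := @cormen_lup_upper _ _ A.
case: (cormen_lup A) => [[P L] U] /= Uup Llow /is_perm_mxP[s ->] PA.
by exists s, L, U.
Qed.

Section LinearChangeOfVariables.
Context {R : realType}.
Notation R3 := (measurableTypeR R * measurableTypeR R * measurableTypeR R)%type.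
Implicit Types A B : 'M[R]_3.

Let mxmap A (z : R3) : R3 := unpt3 (A *m pt3 z).
Let good A := scales (mxmap A) `|\det A|^-1.

Let good_mul A B : good A -> good B -> good (A *m B).
Proof.
move=> gA gB; rewrite /good det_mulmx normrM invfM mulrC.
rewrite (_ : mxmap _ = mxmap A \o mxmap B); first exact: scales_comp.
by apply/funext => z; rewrite /mxmap/= unpt3K mulmxA.
Qed.

Definition row_op (i : 'I_3) (r : 'rV[R]_3) : 'M[R]_3 :=
  \matrix_(j, l) if j == i then r 0 l else (j == l)%:R.

Let good_tperm01 : good (tperm_mx 0 1).
Proof.
rewrite /good det_perm odd_tperm /= expr1 normrN1 invr1.
rewrite (_ : mxmap _ = fun z => (z.1.2, z.1.1, z.2)); first exact: scales_swap12.
apply/funext => z; rewrite /mxmap /unpt3 !mxE !big3 !mxE /=.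
by rewrite ?tpermL ?tpermR ?tpermD//= !(mul0r, mul1r, add0r, addr0).
Qed.

Let good_tperm12 : good (tperm_mx 1 2).
Proof.
rewrite /good det_perm odd_tperm /= expr1 normrN1 invr1.
rewrite (_ : mxmap _ = fun z => (z.1.1, z.2, z.1.2)); first exact: scales_swap23.
apply/funext => z; rewrite /mxmap /unpt3 !mxE !big3 !mxE /=.
by rewrite ?tpermL ?tpermR ?tpermD//= !(mul0r, mul1r, add0r, addr0).
Qed.

Let good1 : good 1%:M.
Proof.
rewrite (_ : 1%:M = tperm_mx 0 1 *m tperm_mx 0 1); first by apply: good_mul; exact: good_tperm01.
by rewrite -perm_mxM tperm2 perm_mx1.
Qed.

Let good_tperm i j : good (tperm_mx i j).
Proof.
have g02 : good (tperm_mx 0 2).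
  rewrite (_ : tperm_mx 0 2 = tperm_mx 0 1 *m tperm_mx 1 2 *m tperm_mx 0 1).
    by apply: good_mul; [apply: good_mul|]; [exact: good_tperm01|exact: good_tperm12|exact: good_tperm01].
  rewrite -!perm_mxM /tperm_mx; congr perm_mx.
  by rewrite -[X in (X * _ * _)%g]tpermV -mulgA -conjgE tpermJ tpermR tpermD.
have tt1 (k : 'I_3) : tperm_mx k k = 1%:M :> 'M[R]_3 by rewrite /tperm_mx tperm1 perm_mx1.
have tC (k l : 'I_3) : tperm_mx k l = tperm_mx l k :> 'M[R]_3 by rewrite /tperm_mx tpermC.
by elim/ord3P: i; elim/ord3P: j; rewrite ?tt1// tC.
Qed.

Let good_perm s : good (perm_mx s).
Proof.
have [ts -> _] := prod_tpermP s.
elim: ts => [|t ts IH]; first by rewrite big_nil perm_mx1.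
rewrite big_cons perm_mxM; apply: good_mul => //.
exact: good_tperm.
Qed.

Let good_row2 (r : 'rV[R]_3) : r 0 2 != 0 -> good (row_op 2 r).
Proof.
move=> r0; rewrite /good det_mx3 !mxE /=.
rewrite !(mul0r, mul1r, mulr0, mulr1, subr0, addr0).
rewrite (_ : mxmap _ = fun z => (z.1, r 0 2 * z.2 + (r 0 0 * z.1.1 + r 0 1 * z.1.2))).
  apply: (scales_shear (g := fun z => (r 0 0 * z.1 + r 0 1 * z.2))) => //.
  by apply: measurable_funD; apply: measurable_funM.
apply/funext => -[[x y] z]; rewrite /mxmap /unpt3 !mxE !big3 !mxE /=.
rewrite !(mul0r, mul1r, add0r, addr0); congr (_, _).
ring.
Qed.

Let good_row (i : 'I_3) (r : 'rV[R]_3) : r 0 i != 0 -> good (row_op i r).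
Proof.
move=> r0; pose s := tperm i 2.
rewrite (_ : row_op i r = perm_mx s *m row_op 2 (r *m perm_mx s) *m perm_mx s).
  apply: good_mul; last exact: good_perm.
  apply: good_mul; first exact: good_perm.
  apply: good_row2.
  by rewrite -[s]tpermV -col_permE mxE tpermR.
have sV : (s^-1 = s)%g by exact: tpermV.
rewrite -row_permE -{3}sV -col_permE -[X in r *m perm_mx X]sV -col_permE.
apply/matrixP => j l; rewrite !mxE.
rewrite /s tpermK (inj_eq perm_inj).
by rewrite (canF_eq (tpermK i 2)) tpermR.
Qed.

(** The scaling property is multiplicative, so an LUP decomposition reduces it to permutations,
    generated by two coordinate swaps, and to matrices that alter one row, which are shears up to a
    permutation. *)
Lemma scales_mx A : A \in unitmx -> scales (fun z => unpt3 (A *m pt3 z)) `|\det A|^-1.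
Proof.
move=> uA; have [s [L [U [PA Llow Uup]]]] := lup_decomposition A.
have -> : A = perm_mx s^-1%g *m (L *m U).
  by rewrite -PA mulmxA -perm_mxM mulVg perm_mx1 mul1mx.
have dU : \det U != 0.
  apply/eqP => dU0; move: uA; rewrite unitmxE.
  have : \det (perm_mx s *m A) = 0 by rewrite PA det_mulmx dU0 mulr0.
  rewrite det_mulmx => /eqP; rewrite mulf_eq0 => /orP[|/eqP->]; last by rewrite unitr0.
  by rewrite det_perm signr_eq0.
have UE : \det U = U 0 0 * U 1 1 * U 2 2.
  rewrite det_mx3 (Uup 1 0)// (Uup 2 0)// (Uup 2 1)//; ring.
rewrite UE !mulf_eq0 !negb_or in dU; case/andP: dU => /andP[U0 U1] U2.
apply: good_mul => //; apply: good_mul.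
  (* The factors are ordered so that each altered row combines rows of the right-hand product that
     are still rows of the identity; it is therefore copied unchanged. The same holds for [U]
     below. *)
  rewrite (_ : L = row_op 1 (row 1 L) *m row_op 2 (row 2 L)).
    by apply: good_mul; apply: good_row; rewrite !mxE Llow// eqxx oner_neq0.
  apply/matrixP; elim/ord3P; elim/ord3P; rewrite !mxE big3 !mxE /= ?mxE;
  by rewrite ?(Llow 0 0 isT, Llow 0 1 isT, Llow 0 2 isT, Llow 1 1 isT, Llow 1 2 isT, Llow 2 2 isT)//=
    ?(mul0r, mul1r, mulr0, mulr1, addr0, add0r).
rewrite (_ : U = row_op 2 (row 2 U) *m row_op 1 (row 1 U) *m row_op 0 (row 0 U)).
  by do 2 (apply: good_mul; last by apply: good_row; rewrite !mxE); apply: good_row; rewrite !mxE.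
apply/matrixP; elim/ord3P; elim/ord3P; rewrite !mxE big3 !mxE /= !big3 !mxE /= ?mxE;
by rewrite ?(Uup 1 0)// ?(Uup 2 0)// ?(Uup 2 1)//= ?(mul0r, mul1r, mulr0, mulr1, addr0, add0r).
Qed.
End LinearChangeOfVariables.

Section ContinuousMeasurable.
Context {R : realType}.
Notation R3 := (measurableTypeR R * measurableTypeR R * measurableTypeR R)%type.

Lemma cvg_cV3 (T : Type) (F : set_system T) (FF : Filter F) (g : T -> 'cV[R]_3) (a : 'cV[R]_3) :
  (forall i, g x i 0 @[x --> F] --> a i 0) -> g x @[x --> F] --> a.
Proof.
move=> ga; apply/cvg_ballP => e e0.
have H i : \forall x \near F, ball (a i 0) e (g x i 0).
  by move/cvg_ballP: (ga i); apply.
near=> x; split=> // i j; rewrite (ord1 j).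
by elim/ord3P: i; near: x; exact: H.
Unshelve. all: by end_near. Qed.

Lemma continuous_pt3 : continuous (@pt3 R : R * R * R -> 'cV[R]_3).
Proof.
move=> [[x y] z]; apply: cvg_cV3; elim/ord3P.
- rewrite pt3E /=; under eq_fun do rewrite pt3E.
  exact: (cvg_comp _ _ cvg_fst cvg_fst).
- rewrite pt3E /=; under eq_fun do rewrite pt3E.
  exact: (cvg_comp _ _ cvg_fst cvg_snd).
- rewrite pt3E /=; under eq_fun do rewrite pt3E.
  exact: cvg_snd.
Qed.

Let rnd (n : nat) (x : R) : R := (Num.floor (x * n.+1%:R))%:~R / n.+1%:R.

Let rnd_near n x : `|x - rnd n x| <= n.+1%:R^-1.
Proof.
have n0 : 0 < n.+1%:R :> R by [].
rewrite -(ler_pM2r n0) mulVf ?gt_eqF// -[X in _ * X <= _](gtr0_norm n0) -normrM mulrBl.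
rewrite /rnd mulfVK ?gt_eqF//; set y := x * _.
have /andP[h1 h2] := floor_itv y.
rewrite ger0_norm ?subr_ge0//; move: h2; rewrite intrD; lra.
Qed.

Let rnd_cvg (x : R) : rnd n x @[n --> \oo] --> x.
Proof.
apply/cvgrPdist_lt => e e0; near=> n.
apply: le_lt_trans (rnd_near n x) _.
by near: n; exact: near_infty_natSinv_lt (PosNum e0).
Unshelve. all: by end_near. Qed.

Let measurable_floor (n : nat) (i : int) :
  measurable [set x : measurableTypeR R | Num.floor (x * n.+1%:R) = i].
Proof.
have n0 : 0 < n.+1%:R :> R by [].
rewrite (_ : [set _ | _] = `[i%:~R / n.+1%:R, (i + 1)%:~R / n.+1%:R[%classic).
  exact: measurable_itv.
apply/seteqP; split => x /=; rewrite in_itv/= ler_pdivrMr// ltr_pdivlMr//.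
  by move=> <-; exact: floor_itv.
by move=> /andP[h1 h2]; apply: floor_def; rewrite h1 h2.
Qed.

(** Round the coordinates down to the grid of mesh 1/(n+1). The rounded function is constant on each
    of countably many boxes, hence measurable for the product sigma-algebra, and it converges
    pointwise to [f]. *)
Lemma measurable_continuous3 (f : 'cV[R]_3 -> R) : continuous f ->
  measurable_fun [set: R3] (f \o (@pt3 R)).
Proof.
move=> cf.
apply: (measurable_fun_cvg (h := fun n (z : R3) =>
    f (pt3 (rnd n z.1.1, rnd n z.1.2, rnd n z.2)))); last first.
  move=> [[x y] z] _.
  have H : (pt3 (rnd n x, rnd n y, rnd n z) : 'cV[R]_3) @[n --> \oo] --> pt3 (x, y, z).
    by apply: cvg_cV3; elim/ord3P; rewrite pt3E; under eq_fun do rewrite pt3E; exact: rnd_cvg.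
  exact: (cvg_comp _ _ H (cf _)).
move=> n _ Y mY; rewrite setTI.
pose box (t : int * int * int) : set R3 :=
  [set z | [/\ Num.floor (z.1.1 * n.+1%:R) = t.1.1, Num.floor (z.1.2 * n.+1%:R) = t.1.2
             & Num.floor (z.2 * n.+1%:R) = t.2]].
pose val (t : int * int * int) := f (pt3 (t.1.1%:~R / n.+1%:R, t.1.2%:~R / n.+1%:R, t.2%:~R / n.+1%:R)).
rewrite (_ : _ @^-1` _ = \bigcup_t (if `[< Y (val t) >] then box t else set0)); last first.
  apply/seteqP; split => [z /= Yz|z [t _]].
    exists (Num.floor (z.1.1 * n.+1%:R), Num.floor (z.1.2 * n.+1%:R), Num.floor (z.2 * n.+1%:R)) => //.
    by rewrite /val/= asboolT.
  by case: asboolP => // Yt [/= e1 e2 e3]; move: Yt; rewrite /val /rnd -e1 -e2 -e3.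
apply: countable_bigcupT_measurable; first exact: countableP.
move=> t; case: ifP => // _.
rewrite (_ : box t = ([set x : measurableTypeR R | Num.floor (x * n.+1%:R) = t.1.1] `*` [set x : measurableTypeR R| Num.floor (x * n.+1%:R) = t.1.2])
   `*` [set x : measurableTypeR R| Num.floor (x * n.+1%:R) = t.2]).
  by apply: measurableX; [apply: measurableX|]; exact: measurable_floor.
by apply/seteqP; split => z [] //= [].
Qed.
End ContinuousMeasurable.

(** * Barycentric coordinates and integrals over tetrahedra *)

Section Barycentric.
Context {R : realType}.
Notation point3 := 'cV[R]_3.
Implicit Types (w v : 'I_4 -> point3) (x : point3).

Lemma big4 (V : nmodType) (F : 'I_4 -> V) : \sum_j F j = F 0 + F 1 + F 2 + F 3.
Proof.
rewrite !big_ord_recl big_ord0 addr0 !addrA.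
by congr (F _ + F _ + F _ + F _); exact/val_inj.
Qed.

Lemma ord4P (P : 'I_4 -> Prop) : P 0 -> P 1 -> P 2 -> P 3 -> forall i, P i.
Proof.
move=> P0 P1 P2 P3; case=> [[|[|[|[|//]]]] lti].
- by rewrite (_ : Ordinal lti = 0)//; exact/val_inj.
- by rewrite (_ : Ordinal lti = 1)//; exact/val_inj.
- by rewrite (_ : Ordinal lti = 2)//; exact/val_inj.
- by rewrite (_ : Ordinal lti = 3)//; exact/val_inj.
Qed.

(** Homogeneous coordinates: with a 1 appended, barycentric coordinates solve a square linear
    system, and affine independence becomes invertibility of [hom w]. *)
Definition homc x : 'cV[R]_(3 + 1) := col_mx x 1%:M.
Definition hom w : 'M[R]_(3 + 1, 4) := \matrix_(i, j) homc (w j) i 0.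
Definition bar w (i : 'I_4) x : R := (invmx (hom w) *m homc x) i 0.
(** The constant gradient of a barycentric coordinate; it is an inward normal to the face opposite
    to the vertex [i]. *)
Definition grad w (i : 'I_4) : point3 := \col_j invmx (hom w) i (lshift 1 j).
Definition dot (a b : point3) : R := \sum_i a i 0 * b i 0.
Definition indep w : bool := hom w \in unitmx.
(** Six times the volume of the tetrahedron, that is, the Jacobian of its parametrization by the
    standard simplex. *)
Definition vol w : R := `|\det (hom w)|.

Lemma mul_hom w (c : 'cV[R]_4) :
  hom w *m c = col_mx (\sum_i c i 0 *: w i) (\sum_i c i 0)%:M.
Proof.
apply/matrixP => i j; rewrite (ord1 j) {j} mxE.
case: (split_ordP i) => i' ->{i}.
  rewrite col_mxEu summxE; apply: eq_bigr => l _.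
  by rewrite [hom _ _ _]mxE /homc col_mxEu mxE mulrC.
rewrite col_mxEd mxE (ord1 i') eqxx mulr1n; apply: eq_bigr => l _.
by rewrite [hom _ _ _]mxE /homc col_mxEd mxE eqxx mul1r.
Qed.

Lemma affinely_independent_indep v : affinely_independent v -> indep v.
Proof.
move=> av; rewrite /indep -unitmx_tr unitmxE unitfE; apply/negP => /det0P[c c0].
move=> /(congr1 trmx); rewrite trmx_mul trmxK trmx0 mul_hom => E.
move/eqP: c0; apply; apply/matrixP => i j; rewrite (ord1 i) [RHS]mxE.
move: E; rewrite -(col_mx0 _ 3 1 1) => /eq_col_mx[E0 /matrixP/(_ 0 0)].
rewrite !mxE eqxx mulr1n => E1.
by have := av _ E1 E0 j; rewrite mxE.
Qed.

Lemma bar_unique w (c : 'I_4 -> R) x : indep w ->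
  \sum_i c i = 1 -> x = \sum_i c i *: w i -> forall i, bar w i x = c i.
Proof.
move=> iw c1 -> i; rewrite /bar.
have -> : homc (\sum_i c i *: w i) = hom w *m (\col_i c i).
  rewrite mul_hom /homc; congr col_mx.
    by apply: eq_bigr => j _; rewrite mxE.
  by congr (_%:M); rewrite -c1; apply: eq_bigr => j _; rewrite mxE.
by rewrite mulKmx// mxE.
Qed.

Lemma bar_hom w x : indep w ->
  x = \sum_i bar w i x *: w i /\ \sum_i bar w i x = 1.
Proof.
move=> iw; have := mul_hom w (invmx (hom w) *m homc x); rewrite mulKVmx//.
move=> /eq_col_mx[xE /matrixP/(_ 0 0)].
by rewrite !mxE eqxx !mulr1n => <-; split.
Qed.

Lemma sum_bar w x : indep w -> \sum_i bar w i x = 1.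
Proof. by move=> iw; case: (bar_hom x iw). Qed.

Lemma barE w i x : bar w i x = dot (grad w i) x + bar w i 0.
Proof.
rewrite /bar /dot /homc !mxE !big_split_ord /=; rewrite [X in _ = _ + (X + _)]big1 ?add0r.
  by congr (_ + _); apply: eq_bigr => j _; rewrite ?col_mxEu ?col_mxEd ?mxE.
by move=> j _; rewrite col_mxEu mxE mulr0.
Qed.

Lemma dotDr a b c : dot a (b + c) = dot a b + dot a c.
Proof. by rewrite /dot -big_split/=; apply: eq_bigr => i _; rewrite mxE mulrDr. Qed.
Lemma dotZr a (k : R) b : dot a (k *: b) = k * dot a b.
Proof. by rewrite /dot mulr_sumr; apply: eq_bigr => i _; rewrite mxE mulrCA. Qed.
Lemma dotC a b : dot a b = dot b a.
Proof. by apply: eq_bigr => i _; rewrite mulrC. Qed.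
Lemma dotDl a b c : dot (a + b) c = dot a c + dot b c.
Proof. by rewrite dotC dotDr ![dot c _]dotC. Qed.
Lemma dotZl (k : R) a b : dot (k *: a) b = k * dot a b.
Proof. by rewrite dotC dotZr dotC. Qed.
Lemma dotNr a b : dot a (- b) = - dot a b.
Proof. by rewrite -scaleN1r dotZr mulN1r. Qed.
Lemma dotBr a b c : dot a (b - c) = dot a b - dot a c.
Proof. by rewrite dotDr dotNr. Qed.
Lemma dotNl a b : dot (- a) b = - dot a b.
Proof. by rewrite dotC dotNr dotC. Qed.
Lemma dotBl a b c : dot (a - b) c = dot a c - dot b c.
Proof. by rewrite dotDl dotNl. Qed.
Lemma dot0r a : dot a 0 = 0.
Proof. by rewrite -(scale0r a) dotZr mul0r. Qed.
Lemma dot0l a : dot 0 a = 0.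
Proof. by rewrite dotC dot0r. Qed.
Lemma dot_sumr (I : Type) (s : seq I) (P : pred I) a (F : I -> point3) :
  dot a (\sum_(i <- s | P i) F i) = \sum_(i <- s | P i) dot a (F i).
Proof. by elim/big_rec2: _ => [|i y1 y2 _ <-]; rewrite ?dot0r ?dotDr. Qed.
Lemma dot_suml (I : Type) (s : seq I) (P : pred I) a (F : I -> point3) :
  dot (\sum_(i <- s | P i) F i) a = \sum_(i <- s | P i) dot (F i) a.
Proof. by elim/big_rec2: _ => [|i y1 y2 _ <-]; rewrite ?dot0l ?dotDl. Qed.
Lemma dot_eq0 a : dot a a = 0 -> a = 0.
Proof.
move=> /eqP; rewrite psumr_eq0; last by move=> i _; rewrite -expr2 sqr_ge0.
move=> /allP H; apply/matrixP => i j; rewrite (ord1 j) mxE.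
by have := H i (mem_index_enum _); rewrite mulf_eq0 orbb => /eqP.
Qed.
Lemma dot_ge0 a : 0 <= dot a a.
Proof. by apply: sumr_ge0 => i _; rewrite -expr2 sqr_ge0. Qed.

Lemma bar_vertex w i j : indep w -> bar w i (w j) = (i == j)%:R.
Proof.
move=> iw; apply: (bar_unique (c := fun i => (i == j)%:R)) => //.
  by rewrite (bigD1 j)//= eqxx big1 ?addr0// => l /negbTE->.
by rewrite (bigD1 j)//= eqxx big1 ?addr0 ?scale1r// => l /negbTE->; rewrite scale0r.
Qed.

Lemma grad_dot w i j k : indep w ->
  dot (grad w i) (w j - w k) = (i == j)%:R - (i == k)%:R.
Proof.
move=> iw; rewrite dotBr -(bar_vertex i j iw) -(bar_vertex i k iw).
rewrite (barE w i (w j)) (barE w i (w k)); ring.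
Qed.

Lemma bar_line w i x (t : R) y : bar w i (x + t *: y) = bar w i x + t * dot (grad w i) y.
Proof. rewrite barE [in RHS]barE dotDr dotZr; ring. Qed.

Lemma sum_grad w : indep w -> \sum_i grad w i = 0.
Proof.
move=> iw; apply: dot_eq0; set g := \sum_i _.
have := sum_bar g iw; rewrite -(sum_bar 0 iw) => /eqP; rewrite -subr_eq0 => /eqP H.
rewrite -[RHS]H /g dot_suml -sumrB; apply: eq_bigr => i _.
by rewrite [in RHS]barE addrK.
Qed.

Lemma tetraP w x : indep w -> tetra w x <-> (forall i, 0 <= bar w i x).
Proof.
move=> iw; split=> [[c [c0 c1 xE]] i|b0].
  by rewrite (bar_unique iw c1 xE).
by have [xE s1] := bar_hom x iw; exists (bar w ^~ x).
Qed.

Lemma vol_gt0 w : indep w -> 0 < vol w.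
Proof. by rewrite /indep unitmxE unitfE /vol normr_gt0. Qed.
End Barycentric.

Section Continuity.
Context {R : realType}.
Notation point3 := 'cV[R]_3.

Lemma contD (T : topologicalType) (f g : T -> R) :
  continuous f -> continuous g -> continuous (fun x => f x + g x).
Proof. by move=> cf cg x; apply: cvgD; [exact: cf|exact: cg]. Qed.
Lemma contB (T : topologicalType) (f g : T -> R) :
  continuous f -> continuous g -> continuous (fun x => f x - g x).
Proof. by move=> cf cg x; apply: cvgB; [exact: cf|exact: cg]. Qed.
Lemma contM (T : topologicalType) (f g : T -> R) :
  continuous f -> continuous g -> continuous (fun x => f x * g x).
Proof. by move=> cf cg x; apply: cvgM; [exact: cf|exact: cg]. Qed.
Lemma contC (T : topologicalType) (a : R) : continuous (fun _ : T => a).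
Proof. by move=> x; exact: cvg_cst. Qed.
Lemma cont_coord i : continuous (fun x : point3 => x i 0).
Proof. exact: coord_continuous. Qed.
Lemma cont_sum (T : topologicalType) (I : Type) (s : seq I) (P : pred I) (f : I -> T -> R) :
  (forall i, P i -> continuous (f i)) -> continuous (fun x => \sum_(i <- s | P i) f i x).
Proof.
move=> cf; elim: s => [|i s IH].
  by under eq_fun do rewrite big_nil; exact: contC.
under eq_fun do rewrite big_cons.
by move: (cf i); case: (P i) => // cfi; apply: contD => //; exact: cfi.
Qed.
Lemma cont_pt (U : topologicalType) (g : U -> point3) :
  (forall i, continuous (fun u => g u i 0)) -> continuous g.
Proof. by move=> cg u; apply: cvg_cV3 => i; exact: cg. Qed.
Lemma cont_comp (T U V : topologicalType) (f : T -> U) (g : U -> V) :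
  continuous f -> continuous g -> continuous (fun x => g (f x)).
Proof. by move=> cf cg x; exact: (cvg_comp _ _ (cf x) (cg _)). Qed.
Lemma cont_xyz : [/\ continuous (fun z : R * R * R => z.1.1),
  continuous (fun z : R * R * R => z.1.2) & continuous (fun z : R * R * R => z.2)].
Proof.
split=> z; last exact: cvg_snd.
- exact: (cvg_comp _ _ cvg_fst cvg_fst).
- exact: (cvg_comp _ _ cvg_fst cvg_snd).
Qed.

End Continuity.

Section SimplexIntegral.
Context {R : realType}.
Notation point3 := 'cV[R]_3.
Notation mu := (@lebesgue_measure R).
Notation R3 := (measurableTypeR R * measurableTypeR R * measurableTypeR R)%type.
Implicit Types (w : 'I_4 -> point3) (x : point3).

Definition simplex3 : set R3 :=
  [set z | [/\ 0 <= z.1.1, 0 <= z.1.2, 0 <= z.2 & z.1.1 + z.1.2 + z.2 <= 1]].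

Definition par w (z : R3) : point3 :=
  z.1.1 *: w 0 + z.1.2 *: w 1 + z.2 *: w 2 + (1 - z.1.1 - z.1.2 - z.2) *: w 3.

Lemma tetra_parP w x : tetra w x <-> exists2 z, simplex3 z & x = par w z.
Proof.
split=> [[c [c0 + ->]]|[z [z0 z1 z2 z3] ->]].
  rewrite big4 => c1; exists (c 0, c 1, c 2) => /=.
    split => //=; have := c0 3; lra.
  by rewrite big4 /par/=; congr (_ + _ *: _); lra.
exists (fun i => [:: z.1.1; z.1.2; z.2; 1 - z.1.1 - z.1.2 - z.2]`_i); split.
- by elim/ord4P => //=; lra.
- by rewrite big4 /=; ring.
- by rewrite big4 /=.
Qed.

Lemma bar_par w z : indep w -> [/\ bar w 0 (par w z) = z.1.1,
  bar w 1 (par w z) = z.1.2, bar w 2 (par w z) = z.2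
  & bar w 3 (par w z) = 1 - z.1.1 - z.1.2 - z.2].
Proof.
move=> iw; pose c := fun i : 'I_4 => [:: z.1.1; z.1.2; z.2; 1 - z.1.1 - z.1.2 - z.2]`_i.
have b i : bar w i (par w z) = c i.
  apply: bar_unique => //; rewrite big4 /c /=; first by ring.
  by [].
by rewrite !b.
Qed.

Lemma tetra_par w z : indep w -> tetra w (par w z) = simplex3 z.
Proof.
move=> iw; apply/propext; rewrite tetraP//; have [b0 b1 b2 b3] := bar_par z iw.
split=> [H|[z0 z1 z2 z3]].
  split; [rewrite -b0|rewrite -b1|rewrite -b2|] => //.
  by have := H 3; rewrite b3; lra.
by elim/ord4P; rewrite ?b0 ?b1 ?b2 ?b3//; lra.
Qed.

Lemma scales_translation (b : point3) : scales (fun z => unpt3 (pt3 z + b)) 1.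
Proof.
have S (c : R) : scales (fun z : R3 => (z.1, z.2 + c)) 1.
  have := @scales_shear R 1 (fun=> c) (oner_neq0 _) (measurable_cst _).
  rewrite normr1 invr1; congr scales; by apply/funext => z; rewrite mul1r.
have S23 (c : R) : scales (fun z : R3 => (z.1.1, z.1.2 + c, z.2)) 1.
  have := scales_comp scales_swap23 (scales_comp (S c) (@scales_swap23 R)).
  by rewrite !mulr1.
have S123 (c : R) : scales (fun z : R3 => (z.1.1 + c, z.1.2, z.2)) 1.
  have := scales_comp scales_swap12 (scales_comp (S23 c) (@scales_swap12 R)).
  by rewrite !mulr1.
have := scales_comp (S (b 2 0)) (scales_comp (S23 (b 1 0)) (S123 (b 0 0))).
rewrite !mulr1; congr scales; apply/funext => z /=.
by rewrite /unpt3 !mxE /=.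
Qed.

Definition edge_mx w : 'M[R]_3 := \matrix_(i, j) (w (lshift 1 j : 'I_(3 + 1)) i 0 - w 3 i 0).

Lemma vol_edge w : vol w = `|\det (edge_mx w)|.
Proof.
pose B : 'M[R]_(3 + 1) := block_mx 1%:M 0 (const_mx (-1)) 1%:M.
pose W : 'M[R]_3 := \matrix_(i, j) w (lshift 1 j : 'I_(3 + 1)) i 0.
have -> : vol w = `|\det (block_mx W (w 3) (const_mx 1) 1%:M : 'M[R]_(3 + 1))|.
  rewrite /vol; congr (`|\det _|); apply/matrixP => i j.
  case: (split_ordP i) => i' ->; case: (split_ordP j) => j' ->;
    rewrite mxE /homc ?block_mxEul ?block_mxEur ?block_mxEdl ?block_mxEdr ?col_mxEu ?col_mxEd ?mxE//.
  - by rewrite (ord1 j'); congr (w _ _ _); exact/val_inj.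
  - by rewrite (ord1 i') eqxx.
  - by rewrite (ord1 i') (ord1 j').
set M := block_mx _ _ _ _.
(* Multiplication by [B] subtracts the last column from the others, which clears the row of ones
   except for its last entry and leaves the edge vectors in the upper block. *)
have -> : \det M = \det (M *m B) by rewrite det_mulmx det_lblock !det1 !mulr1.
rewrite mulmx_block !mulmx1 !mul1mx !mulmx0 !add0r.
rewrite (_ : const_mx 1 + const_mx (-1) = 0); last first.
  by apply/matrixP => i j; rewrite !mxE subrr.
rewrite det_ublock det1 mulr1; congr (`|\det _|).
by apply/matrixP => i j; rewrite !mxE big_ord1 !mxE mulrN1.
Qed.

Lemma parE w z : par w z = edge_mx w *m pt3 z + w 3.
Proof.
apply/matrixP => i j; rewrite (ord1 j) !mxE big3 !mxE /=.
have e (a : 'I_3) (b : 'I_4) : val a = val b -> lshift 1 a = b by move=> ?; exact/val_inj.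
rewrite (e 0 0)// (e 1 1)// (e 2 2)//; ring.
Qed.

Lemma scales_par w : indep w -> scales (fun z => unpt3 (par w z)) (vol w)^-1.
Proof.
move=> iw; have := scales_comp (scales_translation (w 3)) (@scales_mx R (edge_mx w) _).
rewrite mulr1 -vol_edge; have -> : edge_mx w \in unitmx.
  by rewrite unitmxE unitfE -normr_eq0 -vol_edge gt_eqF// vol_gt0.
move=> /(_ isT); congr scales; apply/funext => z /=.
by rewrite unpt3K parE.
Qed.

Lemma measurable_ge0 d (T : measurableType d) (f : T -> R) : measurable_fun setT f ->
  measurable [set z | 0 <= f z].
Proof.
move=> mf; rewrite (_ : [set _ | _] = setT `&` f @^-1` `[0, +oo[%classic).
  by apply: mf => //; exact: measurable_itv.
by apply/seteqP; split => z /=; rewrite in_itv/= andbT; [split|case].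
Qed.

Lemma continuous_bar w i : continuous (bar w i).
Proof.
rewrite (_ : bar w i = fun x => \sum_j grad w i j 0 * x j 0 + bar w i 0).
  apply: contD; last exact: contC.
  by apply: cont_sum => j _; apply: contM; [exact: contC|exact: cont_coord].
by apply/funext => y; rewrite barE.
Qed.

Lemma measurable_tetra w : indep w -> measurable ((@pt3 R) @^-1` tetra w : set R3).
Proof.
move=> iw.
rewrite (_ : _ @^-1` _ = \bigcap_(i in [set: 'I_4]) [set z | 0 <= (bar w i \o (@pt3 R)) z]).
  apply: fin_bigcap_measurable => // i _; apply: measurable_ge0.
  apply: measurable_continuous3; exact: continuous_bar.
by apply/seteqP; split => z /=; rewrite tetraP// => H i; [move=> _|]; exact: H.
Qed.

Lemma continuous_par w : continuous (par w : R * R * R -> point3).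
Proof.
have [c1 c2 c3] := @cont_xyz R.
apply: cont_pt => i; under eq_fun do rewrite !mxE.
have cC (a : R) : continuous (fun z : R * R * R => a) by exact: contC.
by do ! [apply: contD => //]; apply: contM => //; do ! [apply: contB => //].
Qed.

Lemma bounded_tetra w (f : point3 -> R) : continuous f ->
  exists M, forall x, tetra w x -> `|f x| <= M.
Proof.
move=> cf.
have cp : compact ((`[0, 1] `*` `[0, 1] `*` `[0, 1])%classic : set (R * R * R)).
  by apply: compact_setX; [apply: compact_setX|]; exact: segment_compact.
have cg : continuous (fun z : R * R * R => f (par w z)).
  exact: (cont_comp (@continuous_par w) cf).
have /compact_bounded[M [_ Mb]] := continuous_compact (continuous_subspaceT cg) cp.
exists (M + 1) => x /tetra_parP[z [z0 z1 z2 z3] ->].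
apply: (Mb (M + 1)); first by rewrite ltrDl.
exists z => //; split; [split|] => /=; rewrite in_itv /=; lra.
Qed.

Lemma leb3_box (A B C : set (measurableTypeR R)) :
  measurable A -> measurable B -> measurable C ->
  (leb3 (A `*` B `*` C) = mu A * mu B * mu C)%E.
Proof.
move=> mA mB mC.
etransitivity; first by apply: product_measure1E => //; exact: measurableX.
by congr (_ * _)%E; exact: product_measure1E.
Qed.

Lemma leb3_tetra w : indep w -> (leb3 ((@pt3 R) @^-1` tetra w) < +oo)%E.
Proof.
move=> iw.
have [M0 H0] := bounded_tetra w (@cont_coord R 0).
have [M1 H1] := bounded_tetra w (@cont_coord R 1).
have [M2 H2] := bounded_tetra w (@cont_coord R 2).
pose I (M : R) : set (measurableTypeR R) := `[- M, M]%classic.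
have mI M : measurable (I M) by exact: measurable_itv.
have fI M : (mu (I M) < +oo)%E.
  by rewrite /I lebesgue_measure_itv /=; case: ifP => // _; rewrite ltry.
have : (leb3 ((@pt3 R) @^-1` tetra w) <= leb3 (I M0 `*` I M1 `*` I M2))%E.
  apply: le_measure; rewrite ?inE; [exact: measurable_tetra| |].
    by apply: measurableX => //; exact: measurableX.
  move=> z /= Tz; have := H0 _ Tz; have := H1 _ Tz; have := H2 _ Tz.
  by rewrite !pt3E !ler_norml /I; split; [split|] => /=; rewrite in_itv.
move/le_lt_trans; apply.
rewrite leb3_box//.
have fn M : mu (I M) \is a fin_num by rewrite ge0_fin_numE.
by rewrite -(fineK (fn M0)) -(fineK (fn M1)) -(fineK (fn M2)) -!EFinM ltry.
Qed.

Lemma integrable_tetra w (f : point3 -> R) : indep w -> continuous f ->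
  leb3.-integrable ((@pt3 R) @^-1` tetra w) (EFin \o (f \o (@pt3 R))).
Proof.
move=> iw cf; apply: measurable_bounded_integrable.
- exact: measurable_tetra.
- exact: leb3_tetra.
- apply: measurable_funTS; exact: measurable_continuous3.
have [M HM] := bounded_tetra w cf.
exists M; split; first exact: num_real.
by move=> y My z Tz; apply: le_trans (HM _ Tz) (ltW My).
Qed.

Lemma integral_scales (phi : R3 -> R3) (k : R) (g : R3 -> \bar R) :
  scales phi k -> leb3.-integrable setT g ->
  (\int[leb3]_z g (phi z) = k%:E * \int[leb3]_z g z)%E.
Proof.
move=> [mphi phiE] ig; have mg := measurable_int _ ig.
rewrite [LHS]integralE [in RHS]integralE.
rewrite (_ : (fun z => g (phi z))^\+%E = fun z => g^\+%E (phi z)); last first.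
  by apply/funext => z; rewrite -[LHS]/((g \o phi)^\+%E z) funepos_comp.
rewrite (_ : (fun z => g (phi z))^\-%E = fun z => g^\-%E (phi z)); last first.
  by apply/funext => z; rewrite -[LHS]/((g \o phi)^\-%E z) funeneg_comp.
rewrite (phiE (g^\+)%E)//; last exact: measurable_funepos.
rewrite (phiE (g^\-)%E)//; last exact: measurable_funeneg.
have fp := integrable_fin_num measurableT (integrable_funepos measurableT ig).
have fn := integrable_fin_num measurableT (integrable_funeneg measurableT ig).
by rewrite [RHS]muleBr// fin_num_adde_defl// fin_numN.
Qed.

Lemma integral_tetra w (f : point3 -> R) : indep w -> continuous f ->
  integral3 (tetra w) f = vol w * Rintegral leb3 simplex3 (fun z => f (par w z)).
Proof.
move=> iw cf; rewrite /integral3 Rintegral_mkcond [in RHS]Rintegral_mkcond.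
have ig := integrable_tetra iw cf.
have mT := measurable_tetra iw.
pose g := (f \o (@pt3 R)) \_ ((@pt3 R) @^-1` tetra w).
have ig' : leb3.-integrable setT (EFin \o g).
  by rewrite /g -restrict_EFin; exact: (integrable_mkcond _ mT).1.
have := integral_scales (scales_par iw) ig'.
move=> E; transitivity (vol w * fine (\int[leb3]_z (EFin \o g) (unpt3 (par w z)))%E).
  rewrite E fineM//; last exact: integrable_fin_num.
  by rewrite mulrA mulfV ?mul1r// gt_eqF// vol_gt0.
congr (_ * fine _); apply: eq_integral => z _; congr (_%:E); rewrite /g /patch /=.
have -> : (unpt3 (par w z) \in (@pt3 R) @^-1` tetra w) = (z \in simplex3).
  by apply/idP/idP; rewrite !inE /= unpt3K tetra_par.
by rewrite unpt3K.
Qed.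
End SimplexIntegral.

Section SignedTransfer.
Local Open Scope ereal_scope.
Context {R : realType} d (T : measurableType d).
Variables (m : {measure set T -> \bar R}) (phi : T -> T) (k : R).

Lemma integral_transfer (g : T -> \bar R) :
  (forall f : T -> \bar R, measurable_fun setT f -> (forall z, 0 <= f z) ->
    \int[m]_z f (phi z) = k%:E * \int[m]_z f z) ->
  m.-integrable setT g -> \int[m]_z g (phi z) = k%:E * \int[m]_z g z.
Proof.
move=> phiE ig; have mg := measurable_int _ ig.
rewrite [LHS]integralE [in RHS]integralE.
rewrite (_ : (fun z => g (phi z))^\+%E = fun z => g^\+%E (phi z)); last first.
  by apply/funext => z; rewrite -[LHS]/((g \o phi)^\+%E z) funepos_comp.
rewrite (_ : (fun z => g (phi z))^\-%E = fun z => g^\-%E (phi z)); last first.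
  by apply/funext => z; rewrite -[LHS]/((g \o phi)^\-%E z) funeneg_comp.
rewrite (phiE (g^\+)%E)//; last exact: measurable_funepos.
rewrite (phiE (g^\-)%E)//; last exact: measurable_funeneg.
have fp := integrable_fin_num measurableT (integrable_funepos measurableT ig).
have fn := integrable_fin_num measurableT (integrable_funeneg measurableT ig).
by rewrite [RHS]muleBr// fin_num_adde_defl// fin_numN.
Qed.
End SignedTransfer.

Lemma cont_pair (T U V : topologicalType) (f : T -> U) (g : T -> V) :
  continuous f -> continuous g -> continuous (fun x => (f x, g x)).
Proof. by move=> cf cg x; exact: (cvg_pair (cf x) (cg x)). Qed.

(** * Green's formula on a tetrahedron *)

Section Triangle.
Context {R : realType}.
Notation point3 := 'cV[R]_3.
Notation mu := (@lebesgue_measure R).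
Notation R2 := (measurableTypeR R * measurableTypeR R)%type.
Notation R3 := (measurableTypeR R * measurableTypeR R * measurableTypeR R)%type.
Implicit Types (w : 'I_4 -> point3).
Let mu2 := sprod mu.

Definition simplex2 : set R2 := [set z | [/\ 0 <= z.1, 0 <= z.2 & z.1 + z.2 <= 1]].

Definition tri_pt (p q r : point3) (z : R2) : point3 :=
  z.1 *: p + z.2 *: q + (1 - z.1 - z.2) *: r.

(* The surface integral over the triangle pqr divided by twice its area: with
   this normalization no area occurs in Green's formula. *)
Definition tri (p q r : point3) (f : point3 -> R) : R :=
  Rintegral mu2 simplex2 (fun z => f (tri_pt p q r z)).

Lemma continuous_unpt3 : continuous (@unpt3 R : point3 -> R * R * R).
Proof.
by do ! [apply: cont_pair]; exact: cont_coord.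
Qed.

Lemma measurable_continuous_triple (g : R * R * R -> R) : continuous g ->
  measurable_fun [set: R3] g.
Proof.
move=> cg; have := @measurable_continuous3 R (fun x => g (unpt3 x)) _.
rewrite (_ : _ \o _ = g); last by apply/funext => z /=; rewrite pt3K.
by apply; exact: (cont_comp continuous_unpt3 cg).
Qed.

Lemma measurable_continuous_pair (g : R * R -> R) : continuous g ->
  measurable_fun [set: R2] g.
Proof.
move=> cg; have : measurable_fun [set: R3] (fun z => g z.1).
  apply: measurable_continuous_triple; apply: cont_comp cg => z; exact: cvg_fst.
move=> mg; have := @measurable_fun_pair1 _ _ _ R2 (measurableTypeR R) R (fun z => g z.1) 0 mg.
exact.
Qed.

Lemma measurable_simplex2 : measurable simplex2.
Proof.
rewrite (_ : simplex2 = [set z | 0 <= z.1] `&` [set z | 0 <= z.2] `&` [set z | 0 <= 1 - z.1 - z.2]).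
  do ! [apply: measurableI]; apply: measurable_ge0; apply: measurable_continuous_pair => z.
  - exact: cvg_fst.
  - exact: cvg_snd.
  - by do ! [apply: cvgB]; [exact: cvg_cst|exact: cvg_fst|exact: cvg_snd].
by apply/seteqP; split => z /= => [[z0 z1 z2]|[[z0 z1] z2]]; do ?split => //; lra.
Qed.

Lemma measurable_simplex3 : measurable (@simplex3 R).
Proof.
have [c1 c2 c3] := @cont_xyz R.
rewrite (_ : simplex3 = [set z | 0 <= z.1.1] `&` [set z | 0 <= z.1.2] `&` [set z | 0 <= z.2]
   `&` [set z | 0 <= 1 - z.1.1 - z.1.2 - z.2]).
  do ! [apply: measurableI]; apply: measurable_ge0; apply: measurable_continuous_triple => //.
  by do ! [apply: contB => //]; exact: contC.
by apply/seteqP; split => z /= => [[z0 z1 z2 z3]|[[[z0 z1] z2] z3]]; do ?split => //; lra.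
Qed.

Let I01 : set (measurableTypeR R) := `[0, 1]%classic.
Let mI01 : measurable I01. Proof. exact: measurable_itv. Qed.
Let muI01 : mu I01 = 1%E.
Proof. by rewrite /I01 lebesgue_measure_itv /= lte01 oppr0 adde0. Qed.

Lemma integrable_simplex3 (g : R * R * R -> R) : continuous g ->
  leb3.-integrable simplex3 (EFin \o g).
Proof.
move=> cg; apply: measurable_bounded_integrable.
- exact: measurable_simplex3.
- have : (leb3 (@simplex3 R) <= leb3 (I01 `*` I01 `*` I01))%E.
    apply: le_measure; rewrite ?inE; [exact: measurable_simplex3| |].
      by apply: measurableX => //; exact: measurableX.
    by move=> z /= [z0 z1 z2 z3]; split; [split|] => /=; rewrite /I01 /= in_itv /=; lra.
  by move/le_lt_trans; apply; rewrite leb3_box// muI01 !mule1 ltry.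
- by apply: measurable_funTS; exact: measurable_continuous_triple.
have cp : compact ((`[0, 1] `*` `[0, 1] `*` `[0, 1])%classic : set (R * R * R)).
  by apply: compact_setX; [apply: compact_setX|]; exact: segment_compact.
have /compact_bounded[M [Mr Mb]] := continuous_compact (continuous_subspaceT cg) cp.
exists M; split=> // y My z [z0 z1 z2 z3]; apply: (Mb y) => //.
by exists z => //; split; [split|] => /=; rewrite in_itv /=; lra.
Qed.

Lemma integrable_simplex2 (g : R * R -> R) : continuous g ->
  mu2.-integrable simplex2 (EFin \o g).
Proof.
move=> cg; apply: measurable_bounded_integrable.
- exact: measurable_simplex2.
- have : (mu2 simplex2 <= mu2 (I01 `*` I01))%E.
    apply: le_measure; rewrite ?inE; [exact: measurable_simplex2| |].
      exact: measurableX.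
    by move=> z /= [z0 z1 z2]; split => /=; rewrite /I01 /= in_itv /=; lra.
  move/le_lt_trans; apply; rewrite (_ : mu2 _ = mu I01 * mu I01)%E.
    by rewrite muI01 mule1 ltry.
  exact: product_measure1E.
- by apply: measurable_funTS; exact: measurable_continuous_pair.
have cp : compact ((`[0, 1] `*` `[0, 1])%classic : set (R * R)).
  by apply: compact_setX; exact: segment_compact.
have /compact_bounded[M [Mr Mb]] := continuous_compact (continuous_subspaceT cg) cp.
exists M; split=> // y My z [z0 z1 z2]; apply: (Mb y) => //.
by exists z => //; split => /=; rewrite in_itv /=; lra.
Qed.

(** Fubini with the last coordinate inside, then the fundamental theorem of calculus on the segment
    above each point [p] of the triangle. *)
Lemma integral_simplex3_derive (F dF : R * R * R -> R) :
  continuous F -> continuous dF ->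
  (forall (p : R * R) (t : R), is_derive t (1 : R) (fun s => F (p, s)) (dF (p, t))) ->
  Rintegral leb3 simplex3 dF =
  Rintegral mu2 simplex2 (fun p => F (p, 1 - p.1 - p.2) - F (p, 0)).
Proof.
move=> cF cdF FD; rewrite Rintegral_mkcond [in RHS]Rintegral_mkcond.
have idF := integrable_simplex3 cdF.
have ig : leb3.-integrable setT (EFin \o (dF \_ simplex3)).
  by rewrite -restrict_EFin; exact: (integrable_mkcond _ measurable_simplex3).1.
rewrite /Rintegral; congr fine.
have := @integral12_prod_meas1 _ _ _ _ R mu2 mu _ ig.
move=> /esym E; etransitivity; first exact: E.
apply: eq_integral => p _; rewrite /fubini_F /patch.
have cF2 : continuous (fun t => F (p, t)).
  by apply: cont_comp cF; apply: cont_pair => t; [exact: cvg_cst|exact: cvg_id].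
have cdF2 : continuous (fun t => dF (p, t)).
  by apply: cont_comp cdF; apply: cont_pair => t; [exact: cvg_cst|exact: cvg_id].
have inI t : ((p, t) \in simplex3) = (p \in simplex2) && (t \in `[0, 1 - p.1 - p.2]%classic).
  apply/idP/andP; rewrite !inE /simplex3 /simplex2 /= in_itv /=.
    by move=> [z0 z1 z2 z3]; split; [split=> //; lra|lra].
  by move=> [[z0 z1 z2] h]; split => //; lra.
case: ifPn => pS; last first.
  by rewrite [LHS]integral0_eq// => t _ /=; rewrite inI (negbTE pS).
transitivity (\int[mu]_(t in `[0%R, (1 - p.1 - p.2)%R]) (dF (p, t))%:E)%E.
  rewrite [RHS]integral_mkcond; apply: eq_integral => t _; rewrite /patch /= inI pS /=.
  by case: ifP.
move: pS; rewrite inE => -[p0 p1 p2].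
have [e0|e0|e0] := ltgtP 0 (1 - p.1 - p.2); last 2 first.
- by clear E; exfalso; lra.
- by rewrite -e0 set_itv1 integral_set1 subrr.
rewrite (@continuous_FTC2 _ _ (fun t => F (p, t)))//.
- exact: continuous_subspaceT.
- split.
  + by move=> t _; have := FD p t => -[].
  + exact/cvg_at_right_filter/cF2.
  + exact/cvg_at_left_filter/cF2.
- move=> t _; by rewrite derive1E; have [_ ->] := FD p t.
Qed.

Lemma continuous_tri_pt (p q r : point3) : continuous (tri_pt p q r : R * R -> point3).
Proof.
apply: cont_pt => i; under eq_fun do rewrite !mxE.
have c1 : continuous (fun z : R * R => z.1) by move=> z; exact: cvg_fst.
have c2 : continuous (fun z : R * R => z.2) by move=> z; exact: cvg_snd.
have cC (a : R) : continuous (fun z : R * R => a) by exact: contC.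
by do ! [apply: contD => //]; apply: contM => //; do ! [apply: contB => //].
Qed.

Lemma integrable_tri (p q r : point3) (f : point3 -> R) : continuous f ->
  mu2.-integrable simplex2 (EFin \o (fun z => f (tri_pt p q r z))).
Proof.
by move=> cf; apply: integrable_simplex2; exact: (cont_comp (@continuous_tri_pt p q r) cf).
Qed.

Let transfer2 (phi : R2 -> R2) (g : R * R -> R) :
  (forall f : R2 -> \bar R, measurable_fun setT f -> (forall z, 0 <= f z)%E ->
    (\int[mu2]_z f (phi z) = 1 * \int[mu2]_z f z)%E) ->
  (forall z, simplex2 (phi z) = simplex2 z) -> continuous g ->
  Rintegral mu2 simplex2 (fun z => g (phi z)) = Rintegral mu2 simplex2 g.
Proof.
move=> phiE phiS cg; rewrite Rintegral_mkcond [in RHS]Rintegral_mkcond.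
have ig : mu2.-integrable setT (EFin \o (g \_ simplex2)).
  rewrite -restrict_EFin; apply: (integrable_mkcond _ measurable_simplex2).1.
  exact: integrable_simplex2.
have := @integral_transfer R _ R2 mu2 phi 1 _ phiE ig; rewrite mul1e => E.
rewrite /Rintegral -E; congr fine; apply: eq_integral => z _.
congr (_%:E); rewrite /patch; congr (if _ then _ else _).
by apply/idP/idP; rewrite !inE phiS.
Qed.

Lemma tri_swap12 p q r f : continuous f -> tri p q r f = tri q p r f.
Proof.
move=> cf; rewrite /tri -(@transfer2 (fun z => (z.2, z.1)) (fun z => f (tri_pt q p r z))).
- apply: eq_Rintegral => z _; congr f; rewrite /tri_pt /=.
  by rewrite [_ *: q + _]addrC; congr (_ + _ *: _); ring.
- by move=> g mg g0; rewrite mul1e; exact: (@integral_swap2 R _ _ mu).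
- by move=> z; apply/propext; split=> -[/= z1 z2 z3]; split => //=; rewrite addrC.
- exact: (cont_comp (@continuous_tri_pt q p r) cf).
Qed.

(** The map (x, y) -> (x, 1 - x - y) preserves both the measure and the reference triangle, and it
    exchanges the last two vertices. *)
Lemma tri_swap23 p q r f : continuous f -> tri p q r f = tri p r q f.
Proof.
move=> cf; rewrite /tri -(@transfer2 (fun z => (z.1, 1 - z.1 - z.2)) (fun z => f (tri_pt p r q z))).
- apply: eq_Rintegral => z _; congr f; rewrite /tri_pt /=.
  by rewrite -!addrA; congr (_ + _); rewrite addrC; congr (_ + _ *: _); ring.
- move=> g mg g0; rewrite mul1e.
  have mphi : measurable_fun setT (fun z : R2 => (z.1, 1 - z.1 - z.2) : R2).
    apply: measurable_fun_pair; first exact: measurable_fst.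
    by apply: measurable_funB => //; apply: measurable_funB.
  have mgphi := measurableT_comp mg mphi.
  have E1 := @fubini_tonelli1 _ _ _ _ R mu mu _ mgphi (fun z => g0 _).
  have E2 := @fubini_tonelli1 _ _ _ _ R mu mu _ mg g0.
  etransitivity; first exact: E1.
  etransitivity; last by symmetry; exact: E2.
  apply: eq_integral => x _; rewrite /fubini_F /=.
  have := @integral_affine1 R (-1) (1 - x) (fun y => g (x, y)).
  rewrite normrN1 invr1 mul1e oppr_eq0 oner_eq0 => /(_ isT) <-//; last first.
    exact: measurable_fun_pair2.
  by apply: eq_integral => y _; congr (g (_, _)); ring.
- move=> z; apply/propext; split=> -[/= z1 z2 z3]; split => //=; lra.
- exact: (cont_comp (@continuous_tri_pt p r q) cf).
Qed.

(** In the parametrization [par] the direction [w 2 - w 3] is the last coordinate direction. The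
    segments start on the face opposite to [w 2] and end on the face opposite to [w 3]. *)
Lemma green_tetra23 w (f df : point3 -> R) : indep w -> continuous f -> continuous df ->
  (forall x (t : R), is_derive t (1 : R) (fun s => f (x + s *: (w 2 - w 3)))
     (df (x + t *: (w 2 - w 3)))) ->
  integral3 (tetra w) df =
  vol w * (tri (w 0) (w 1) (w 2) f - tri (w 0) (w 1) (w 3) f).
Proof.
move=> iw cf cdf fD; rewrite integral_tetra//; congr (_ * _).
have lineE (p : R * R) t : par w (p, t) = par w (p, 0) + t *: (w 2 - w 3).
  by apply/matrixP => i j; rewrite !mxE /=; ring.
have D (p : R * R) (t : R) :
    is_derive t (1 : R) (fun s => f (par w (p, s))) (df (par w (p, t))).
  rewrite lineE (_ : (fun s => _) = fun s => f (par w (p, 0) + s *: (w 2 - w 3))).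
    exact: fD.
  by apply/funext => s; rewrite lineE.
have := integral_simplex3_derive (cont_comp (@continuous_par _ w) cf)
  (cont_comp (@continuous_par _ w) cdf) D.
move=> ->; transitivity (Rintegral mu2 simplex2 (fun z =>
    f (tri_pt (w 0) (w 1) (w 2) z) - f (tri_pt (w 0) (w 1) (w 3) z))).
  apply: eq_Rintegral => z _; congr (f _ - f _); apply/matrixP => i j;
  by rewrite !mxE /=; ring.
by rewrite RintegralB//; [exact: measurable_simplex2|exact: integrable_tri|exact: integrable_tri].
Qed.
End Triangle.

(** * Directional derivatives and the calculus of smooth functions *)

Section DirectionalDerivative.
Context {R : realType}.
Notation point3 := 'cV[R]_3.
Implicit Types (f g : point3 -> R) (x v : point3).

Definition ddir v f : point3 -> R := fun x => \sum_j v j 0 * partial j f x.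

Let is_derive_lineP f x v (t : R) (d : R) :
  (h^-1 *: (f (h *: v + (x + t *: v)) - f (x + t *: v)) @[h --> (0:R)^'] --> d) ->
  is_derive t (1 : R) (fun s => f (x + s *: v)) d.
Proof.
have E : (fun h : R => h^-1 *: (f (h *: v + (x + t *: v)) - f (x + t *: v))) =
  (fun h : R => h^-1 *: (((fun s => f (x + s *: v)) \o shift t) (h *: (1 : R)) - f (x + t *: v))).
  apply/funext => h /=; congr (_ *: (f _ - _)).
  by rewrite [h *: 1]mulr1 scalerDl addrCA.
rewrite E => c; split; first by apply: cvgP c.
exact: cvg_lim c.
Qed.

Lemma is_derive_line f x v (t : R) : derivable f (x + t *: v) v ->
  is_derive t (1 : R) (fun s => f (x + s *: v)) ('D_v f (x + t *: v)).
Proof. by move=> df; apply: is_derive_lineP; exact: df. Qed.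

Let mvt_coord f (k : 'I_3) x (a : R) :
  (forall y, derivable f y (delta_mx k 0)) ->
  exists2 y : point3, (forall j, `|y j 0 - x j 0| <= `|a| * (j == k)%:R) &
    f (x + a *: delta_mx k 0) - f x = a * partial k f y.
Proof.
move=> df; set e := delta_mx k 0.
have D t := is_derive_line (df (x + t *: e)).
have dg t : derivable (fun s : R => f (x + s *: e)) t 1 by have [] := D t.
have cg : continuous (fun s : R => f (x + s *: e)).
  by move=> t; apply/differentiable_continuous; rewrite -derivable1_diffP.
have bnd c : `|c| <= `|a| -> forall j, `|(x + c *: e) j 0 - x j 0| <= `|a| * (j == k)%:R.
  move=> ca j; rewrite !mxE addrAC subrr add0r eqxx andbT normrM normr_nat.
  by case: (j == k); rewrite ?mulr1 ?mulr0.
have [a0|a0|a0] := ltgtP 0 a.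
- have [c] := MVT a0 (fun t _ => D t) (continuous_subspaceT cg).
  rewrite in_itv /= => /andP[c0 ca]; rewrite scale0r addr0 subr0 => E.
  exists (x + c *: e); last by rewrite E mulrC.
  by apply: bnd; rewrite !ger0_norm// ltW.
- have [c] := MVT a0 (fun t _ => D t) (continuous_subspaceT cg).
  rewrite in_itv /= => /andP[c0 ca]; rewrite scale0r addr0 sub0r => E.
  exists (x + c *: e); last by rewrite -[LHS]opprB E mulrN opprK mulrC.
  by apply: bnd; rewrite !ler0_norm ?lerN2// ltW.
- exists x; last by rewrite -a0 scale0r addr0 subrr mul0r.
  by move=> j; rewrite subrr normr0 mulr_ge0.
Qed.

(** Go from y to y + h v one coordinate at a time. The mean value theorem turns each of the three
    increments into a partial derivative at a point within O(h) of y, and continuity of the partial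
    derivatives gives the limit. *)
Lemma is_derive_ddir f : (forall k y, derivable f y (delta_mx k 0)) ->
  (forall k, continuous (partial k f)) ->
  forall x v (t : R), is_derive t (1 : R) (fun s => f (x + s *: v)) (ddir v f (x + t *: v)).
Proof.
move=> df cdf x v t; apply: is_derive_lineP; set y := x + t *: v.
pose e k : point3 := delta_mx k 0.
pose P2 h := y + (h * v 2 0) *: e 2; pose P1 h := P2 h + (h * v 1 0) *: e 1.
have vE h : h *: v + y = P1 h + (h * v 0 0) *: e 0.
  rewrite addrC /P1 /P2 -!addrA; congr (_ + _).
  by apply/matrixP; elim/ord3P => j; rewrite (ord1 j) !mxE /= !(mulr0, mulr1, add0r, addr0).
have /choice[q2 q2P] : forall h : R, exists q : point3, (forall j, `|q j 0 - y j 0| <= `|h * v 2 0|) /\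
    f (P2 h) - f y = h * v 2 0 * partial 2 f q.
  move=> h; have [q qb qE] := mvt_coord y (h * v 2 0) (df 2); exists q; split=> // j.
  by apply: le_trans (qb j) _; rewrite ler_piMr// lern1 leq_b1.
have /choice[q1 q1P] : forall h : R, exists q : point3, (forall j, `|q j 0 - P2 h j 0| <= `|h * v 1 0|) /\
    f (P1 h) - f (P2 h) = h * v 1 0 * partial 1 f q.
  move=> h; have [q qb qE] := mvt_coord (P2 h) (h * v 1 0) (df 1); exists q; split=> // j.
  by apply: le_trans (qb j) _; rewrite ler_piMr// lern1 leq_b1.
have /choice[q0 q0P] : forall h : R, exists q : point3, (forall j, `|q j 0 - P1 h j 0| <= `|h * v 0 0|) /\
    f (h *: v + y) - f (P1 h) = h * v 0 0 * partial 0 f q.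
  move=> h; rewrite vE; have [q qb qE] := mvt_coord (P1 h) (h * v 0 0) (df 0); exists q; split=> // j.
  by apply: le_trans (qb j) _; rewrite ler_piMr// lern1 leq_b1.
have shiftE (z : point3) (a : R) k j : `|(z + a *: e k) j 0 - z j 0| <= `|a|.
  rewrite !mxE eqxx andbT addrAC subrr add0r normrM normr_nat ler_piMr//.
  by rewrite lern1 leq_b1.
have P2b h j : `|P2 h j 0 - y j 0| <= `|h| * `|v 2 0| by rewrite -normrM shiftE.
have P1b h j : `|P1 h j 0 - P2 h j 0| <= `|h| * `|v 1 0| by rewrite -normrM shiftE.
pose C := `|v 0 0| + `|v 1 0| + `|v 2 0|.
have C0 : 0 <= C by rewrite !addr_ge0.
have small (q : R -> point3) : (forall h j, `|q h j 0 - y j 0| <= `|h| * C) ->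
    q h @[h --> (0:R)^'] --> y.
  move=> gb; apply: cvg_cV3 => j; apply/cvgrPdist_le => eps eps0.
  have e0 : 0 < eps / (C + 1) by rewrite divr_gt0// ltr_wpDl.
  near=> h; rewrite distrC; apply: le_trans (gb h j) _.
  apply: (@le_trans _ _ (eps / (C + 1) * C)).
    by rewrite ler_wpM2r//; near: h; exact: dnbhs0_le.
  by rewrite mulrAC ler_pdivrMr ?ltr_wpDl// ler_pM2l// lerDl.
have tri3 (a b c d : R) (A B D : R) : `|a - b| <= A -> `|b - c| <= B -> `|c - d| <= D ->
    `|a - d| <= A + B + D.
  move=> h1 h2 h3; rewrite (_ : a - d = (a - b) + (b - c) + (c - d)); last by ring.
  by do 2 (apply: le_trans (ler_normD _ _) _; apply: lerD => //).
have c2 : q2 h @[h --> (0:R)^'] --> y.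
  apply: small => h j; apply: le_trans ((q2P h).1 j) _.
  by rewrite normrM ler_wpM2l// /C lerDr addr_ge0.
have c1 : q1 h @[h --> (0:R)^'] --> y.
  apply: small => h j.
  apply: (@le_trans _ _ (`|h| * `|v 1 0| + `|h| * `|v 2 0| + 0)).
    apply: (tri3 _ (P2 h j 0) (y j 0)) => //; last by rewrite subrr normr0.
    by have := (q1P h).1 j; rewrite normrM.
  by rewrite addr0 -mulrDr ler_wpM2l// /C -addrA lerDr.
have c0 : q0 h @[h --> (0:R)^'] --> y.
  apply: small => h j; rewrite /C !mulrDr.
  apply: (tri3 _ (P1 h j 0) (P2 h j 0)) => //.
  by have := (q0P h).1 j; rewrite normrM.
have c k (q : R -> point3) : q h @[h --> (0:R)^'] --> y ->
    v k 0 * partial k f (q h) @[h --> (0:R)^'] --> v k 0 * partial k f y.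
  by move=> cq; apply: cvgMr; exact: (cvg_comp _ _ cq (cdf k _)).
rewrite /ddir big3.
have CC : v 0 0 * partial 0 f (q0 h) + v 1 0 * partial 1 f (q1 h) + v 2 0 * partial 2 f (q2 h)
    @[h --> (0:R)^'] --> v 0 0 * partial 0 f y + v 1 0 * partial 1 f y + v 2 0 * partial 2 f y.
  by apply: cvgD; [apply: cvgD|]; exact: c.
apply: cvg_trans CC; apply: near_eq_cvg; near=> h.
have h0 : h != 0 by near: h; exact: nbhs_dnbhs_neq.
have -> : f (h *: v + y) - f y = (f (h *: v + y) - f (P1 h)) + (f (P1 h) - f (P2 h)) + (f (P2 h) - f y).
  by ring.
rewrite (q0P h).2 (q1P h).2 (q2P h).2 /GRing.scale /=.
by field.
Unshelve. all: by end_near. Qed.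
End DirectionalDerivative.

Section SmoothClosure.
Context {R : realType}.
Notation point3 := 'cV[R]_3.
Implicit Types (f g : point3 -> R) (x v : point3).

Lemma CnW n f : Cn n.+1 f -> Cn n f.
Proof.
elim: n f => [|n IH] f; first by case.
by move=> [cf df dn]; split=> // j; exact/IH/dn.
Qed.

Lemma partial_cst j (a : R) : partial j (fun _ => a) = fun _ => 0.
Proof. by apply/funext => x; rewrite /partial derive_cst. Qed.

Lemma Cn_cst n (a : R) : Cn n (fun _ : point3 => a).
Proof.
elim: n a => [|n IH] a; first exact: contC.
split=> [|x j|j]; [exact: contC|exact: derivable_cst|].
by rewrite partial_cst; exact: IH.
Qed.

Lemma partialD j f g : (forall x, derivable f x (delta_mx j 0)) ->
  (forall x, derivable g x (delta_mx j 0)) ->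
  partial j (fun x => f x + g x) = fun x => partial j f x + partial j g x.
Proof. by move=> df dg; apply/funext => x; rewrite /partial deriveD. Qed.

Lemma partialM j f g : (forall x, derivable f x (delta_mx j 0)) ->
  (forall x, derivable g x (delta_mx j 0)) ->
  partial j (fun x => f x * g x) = fun x => f x * partial j g x + partial j f x * g x.
Proof.
move=> df dg; apply/funext => x; rewrite /partial deriveM//.
by congr (_ + _); exact: mulrC.
Qed.

Lemma CnD n f g : Cn n f -> Cn n g -> Cn n (fun x => f x + g x).
Proof.
elim: n f g => [|n IH] f g; first exact: contD.
move=> [cf df dnf] [cg dg dng]; split=> [|x j|j].
- exact: contD.
- by apply: derivableD.
- by rewrite partialD => [|x|x]; [exact: (IH _ _ (dnf j) (dng j))|exact: df|exact: dg].
Qed.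

Lemma CnM n f g : Cn n f -> Cn n g -> Cn n (fun x => f x * g x).
Proof.
elim: n f g => [|n IH] f g; first exact: contM.
move=> Cf Cg; have := (CnW Cf, CnW Cg) => -[Cf' Cg'].
case: Cf Cg => [cf df dnf] [cg dg dng]; split=> [|x j|j].
- exact: contM.
- by apply: derivableM.
- by rewrite partialM => [|x|x]; [|exact: df|exact: dg];
    apply: CnD; [exact: (IH _ _ Cf' (dng j))|exact: (IH _ _ (dnf j) Cg')].
Qed.

Lemma smooth_cst (a : R) : smooth (fun _ : point3 => a).
Proof. by move=> n; exact: Cn_cst. Qed.
Lemma smoothD f g : smooth f -> smooth g -> smooth (fun x => f x + g x).
Proof. by move=> sf sg n; exact: CnD. Qed.
Lemma smoothM f g : smooth f -> smooth g -> smooth (fun x => f x * g x).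
Proof. by move=> sf sg n; exact: CnM. Qed.
Lemma smooth_continuous f : smooth f -> continuous f.
Proof. by move=> /(_ 0%N). Qed.
Lemma smooth_derivable f : smooth f -> forall x j, derivable f x (delta_mx j 0).
Proof. by move=> /(_ 1%N)[]. Qed.
Lemma smooth_partial f j : smooth f -> smooth (partial j f).
Proof. by move=> sf n; have [_ _ H] := sf n.+1; exact: H. Qed.
Lemma smooth_sum (I : Type) (s : seq I) (P : pred I) (F : I -> point3 -> R) :
  (forall i, P i -> smooth (F i)) -> smooth (fun x => \sum_(i <- s | P i) F i x).
Proof.
move=> sF; elim: s => [|i s IH].
  by under eq_fun do rewrite big_nil; exact: smooth_cst.
under eq_fun do rewrite big_cons.
by move: (sF i); case: (P i) => // sFi; apply: smoothD => //; exact: sFi.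
Qed.
Lemma smooth_prod (I : Type) (s : seq I) (P : pred I) (F : I -> point3 -> R) :
  (forall i, P i -> smooth (F i)) -> smooth (fun x => \prod_(i <- s | P i) F i x).
Proof.
move=> sF; elim: s => [|i s IH].
  by under eq_fun do rewrite big_nil; exact: smooth_cst.
under eq_fun do rewrite big_cons.
by move: (sF i); case: (P i) => // sFi; apply: smoothM => //; exact: sFi.
Qed.

Lemma smooth_ddir f v : smooth f -> smooth (ddir v f).
Proof.
move=> sf; apply: smooth_sum => j _; apply: smoothM; first exact: smooth_cst.
exact: smooth_partial.
Qed.

Lemma is_derive_smooth f : smooth f -> forall x v (t : R),
  is_derive t (1 : R) (fun s => f (x + s *: v)) (ddir v f (x + t *: v)).
Proof.
move=> sf; apply: is_derive_ddir => [k y|k]; first exact: smooth_derivable.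
exact/smooth_continuous/smooth_partial.
Qed.

Lemma ddirD f g v : smooth f -> smooth g ->
  ddir v (fun x => f x + g x) = fun x => ddir v f x + ddir v g x.
Proof.
move=> sf sg; apply/funext => x; rewrite /ddir -big_split/=; apply: eq_bigr => j _.
by rewrite partialD ?mulrDr// => y; exact: smooth_derivable.
Qed.

Lemma ddirM f g v : smooth f -> smooth g ->
  ddir v (fun x => f x * g x) = fun x => f x * ddir v g x + ddir v f x * g x.
Proof.
move=> sf sg; apply/funext => x; rewrite /ddir mulr_sumr mulr_suml -big_split/=.
apply: eq_bigr => j _; rewrite partialM => [|y|y]; [ring|exact: smooth_derivable|exact: smooth_derivable].
Qed.

Lemma ddir_cst (a : R) v : ddir v (fun _ => a) = fun _ => 0.
Proof. by apply/funext => x; rewrite /ddir big1// => j _; rewrite partial_cst mulr0. Qed.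

Lemma ddirZ f (a : R) v : smooth f -> ddir v (fun x => a * f x) = fun x => a * ddir v f x.
Proof.
move=> sf; rewrite ddirM//; last exact: smooth_cst.
by rewrite ddir_cst; apply/funext => x; rewrite mul0r addr0.
Qed.

Lemma ddir_addv f u v x : ddir (u + v) f x = ddir u f x + ddir v f x.
Proof. by rewrite /ddir -big_split; apply: eq_bigr => j _ /=; rewrite mxE mulrDl. Qed.
Lemma ddir_scalev f (a : R) v x : ddir (a *: v) f x = a * ddir v f x.
Proof. by rewrite /ddir mulr_sumr; apply: eq_bigr => j _ /=; rewrite mxE mulrA. Qed.
Lemma ddir_delta f j : ddir (delta_mx j 0) f = partial j f.
Proof.
apply/funext => x; rewrite /ddir (bigD1 j)//= mxE !eqxx mul1r big1 ?addr0// => i ij.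
by rewrite mxE (negbTE ij) mul0r.
Qed.

Definition aff (b : point3) (a : R) : point3 -> R := fun x => dot b x + a.

Lemma affE b a x (t : R) v : aff b a (x + t *: v) = aff b a x + t * dot b v.
Proof. by rewrite /aff dotDr dotZr addrAC. Qed.

Lemma cont_aff b a : continuous (aff b a).
Proof.
apply: contD; last exact: contC.
by apply: cont_sum => i _; apply: contM; [exact: contC|exact: cont_coord].
Qed.

Lemma is_derive_aff b a j x : is_derive x (delta_mx j 0) (aff b a) (b j 0).
Proof.
have c : h^-1 *: (aff b a (h *: delta_mx j 0 + x) - aff b a x) @[h --> (0:R)^'] --> b j 0.
  have E : \forall h \near (0:R)^', b j 0 = h^-1 *: (aff b a (h *: delta_mx j 0 + x) - aff b a x).
    near=> h; have h0 : h != 0 by near: h; exact: nbhs_dnbhs_neq.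
    rewrite [_ + x]addrC affE addrAC subrr add0r.
    have -> : dot b (delta_mx j 0) = b j 0.
      rewrite /dot (bigD1 j)//= mxE !eqxx mulr1 big1 ?addr0// => i ij.
      by rewrite mxE (negbTE ij) mulr0.
    by rewrite /GRing.scale /= mulKf.
  by apply: cvg_trans (near_eq_cvg E) _; exact: cvg_cst.
by split; [exact: cvgP c|exact: cvg_lim c].
Unshelve. all: by end_near. Qed.

Lemma partial_aff b a j : partial j (aff b a) = fun _ => b j 0.
Proof. by apply/funext => x; have [_] := is_derive_aff b a j x. Qed.

Lemma smooth_aff b a : smooth (aff b a).
Proof.
case=> [|n]; first exact: cont_aff.
split=> [|x j|j]; first exact: cont_aff.
  by have [] := is_derive_aff b a j x.
by rewrite partial_aff; exact: Cn_cst.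
Qed.

Lemma ddir_aff b a v : ddir v (aff b a) = fun _ => dot b v.
Proof.
by apply/funext => x; apply: eq_bigr => j _; rewrite partial_aff mulrC.
Qed.
End SmoothClosure.

(** * Smooth functions vanishing on a half-line *)

Section Bump.
Context {R : realType}.
Notation point3 := 'cV[R]_3.

(* The functions t^-m exp(-1/t), extended by 0 to t <= 0, are closed under
   differentiation up to linear combinations, so smoothness is proved for all m
   at once. *)
Definition flat (m : nat) (t : R) : R := if 0 < t then t^-1 ^+ m * expR (- t^-1) else 0.

Lemma flat_le0 m t : t <= 0 -> flat m t = 0.
Proof. by rewrite /flat ltNge => ->. Qed.

Lemma flat_ge0 m t : 0 <= flat m t.
Proof. by rewrite /flat; case: ifPn => // t0; rewrite mulr_ge0 ?exprn_ge0 ?expR_ge0// invr_ge0 ltW. Qed.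

Lemma flat0_gt0 t : 0 < t -> 0 < flat 0 t.
Proof. by rewrite /flat => ->; rewrite mul1r expR_gt0. Qed.

Lemma flat0_le1 t : flat 0 t <= 1.
Proof.
rewrite /flat; case: ifPn => // t0; rewrite mul1r -expR0 ler_expR oppr_le0 invr_ge0.
exact: ltW.
Qed.

(** From exp(u) >= 1 + u > u at u = s/n, with s = 1/t and n = m + 2, follows exp(s) >= (s/n)^n. A
    bound of order t^2 is what makes the difference quotient of [flat m] at 0 tend to 0. *)
Lemma flat_bound m t : 0 < t -> flat m t <= (m.+2)%:R ^+ m.+2 * t ^+ 2.
Proof.
move=> t0; rewrite /flat t0; set n := m.+2; set s := t^-1.
have s0 : 0 < s by rewrite invr_gt0.
have n0 : 0 < n%:R :> R by rewrite ltr0n.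
have E : (s / n%:R) ^+ n <= expR s.
  have -> : expR s = expR (s / n%:R) ^+ n.
    by rewrite -expRM_natl mulrC divfK// gt_eqF.
  apply: lerXn2r; rewrite ?nnegrE ?expR_ge0 ?divr_ge0 ?ltW//.
  by apply: lt_le_trans (expR_ge1Dx _); rewrite ltrDr.
have -> : t ^+ 2 = s ^+ m * (s ^+ n)^-1.
  by rewrite /n -[m.+2]addn2 exprD invfM mulrA mulfV ?mul1r -?exprVn ?invrK// expf_neq0 ?gt_eqF.
have sm : 0 < s ^+ m by exact: exprn_gt0.
rewrite mulrCA (ler_pM2l sm) expRN.
rewrite (_ : _ * _ = ((s / n%:R) ^+ n)^-1); last first.
  by rewrite -expr_div_n -[RHS]exprVn invf_div.
by rewrite lef_pV2 ?posrE ?expR_gt0// exprn_gt0// divr_gt0.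
Qed.

Lemma is_derive_flat m t : is_derive t (1 : R) (flat m) (flat m.+2 t - m%:R * flat m.+1 t).
Proof.
have [t0|t0|<-] := ltgtP 0 t.
- have nE : \forall s \near t, s^-1 ^+ m * expR (- s^-1) = flat m s.
    near=> s; rewrite /flat; have -> // : 0 < s.
    by near: s; exact: lt_nbhsr.
  apply: near_eq_is_derive nE _ => //.
  have t1 : t != 0 by rewrite gt_eqF.
  have D1 : is_derive t (1 : R) (fun s => s^-1) (- t ^- 2 *: (1 : R)).
    exact: (is_deriveV (f := id)).
  have D2 : is_derive t (1 : R) (expR \o (fun s => - s^-1)) (expR (- t^-1) * (- (- t ^- 2 *: (1 : R)))).
    by apply: is_derive1_comp.
  have D3 := is_deriveM (is_deriveX m D1) D2.
  rewrite exprfctE in D3.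
  apply: (is_derive_eq D3).
  rewrite /flat t0 /GRing.scale /= !mulr1 !opprK.
  clear D3; case: m => [|m] /=; first by rewrite !expr0 !mul0r mulr0 subr0 addr0 mul1r exprVn mulrC.
  by rewrite -!exprVn; set u := t^-1; rewrite !exprS; ring.
- have nE : \forall s \near t, (cst 0 : R -> R) s = flat m s.
    near=> s; rewrite flat_le0//; apply: ltW; near: s; exact: lt_nbhsl.
  apply: near_eq_is_derive nE _ => //.
  by rewrite !flat_le0 ?ltW// mulr0 subrr; exact: is_derive_cst.
- rewrite !flat_le0// mulr0 subrr.
  have c : h^-1 *: ((flat m \o shift 0) (h *: (1 : R)) - flat m 0) @[h --> (0:R)^'] --> (0 : R).
    apply/cvgrPdist_le => e e0; pose C : R := (m.+2)%:R ^+ m.+2.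
    have C0 : 0 < C by rewrite exprn_gt0// ltr0n.
    near=> h; rewrite sub0r normrN /= addr0 (@flat_le0 m 0)// subr0 [h *: 1]mulr1 /GRing.scale /=.
    have [h0|h0] := ltP 0 h; last by rewrite flat_le0// mulr0 normr0 ltW.
    have nn : 0 <= h^-1 * flat m h by rewrite mulr_ge0 ?flat_ge0// invr_ge0 ltW.
    rewrite (ger0_norm nn) [h^-1 * _]mulrC ler_pdivrMr//.
    apply: le_trans (flat_bound m h0) _; rewrite expr2 mulrA ler_pM2r// -/C.
    rewrite mulrC -ler_pdivlMr// -(gtr0_norm h0).
    by near: h; apply: dnbhs0_le; rewrite divr_gt0.
  by split; [exact: cvgP c|exact: cvg_lim c].
Unshelve. all: by end_near. Qed.

Lemma continuous_flat m : continuous (flat m).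
Proof.
move=> t; apply/differentiable_continuous; rewrite -derivable1_diffP.
by have [] := is_derive_flat m t.
Qed.

Lemma is_derive_flat_aff m (b : point3) a j x :
  is_derive x (delta_mx j 0) (fun y => flat m (aff b a y))
    (b j 0 * (flat m.+2 (aff b a x) - m%:R * flat m.+1 (aff b a x))).
Proof.
set d := (_ - _ : R).
have D : is_derive (0 : R) (1 : R) (flat m \o (fun s => aff b a x + s * b j 0)) (d * b j 0).
  apply: is_derive1_comp.
    by rewrite mul0r addr0; exact: is_derive_flat.
  rewrite -[X in is_derive _ _ _ X]add0r.
  apply: is_deriveD.
  have := is_deriveZ (b j 0) (is_derive_id (0 : R) (1 : R)).
  rewrite [_ *: 1]mulr1; congr is_derive; apply/funext => y; exact: mulrC.
have c : h^-1 *: (flat m (aff b a (h *: delta_mx j 0 + x)) - flat m (aff b a x)) @[h --> (0:R)^'] --> b j 0 * d.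
  have [dD vD] := D; rewrite mulrC -vD.
  have -> : (fun h : R => h^-1 *: (flat m (aff b a (h *: delta_mx j 0 + x)) - flat m (aff b a x))) =
     (fun h : R => h^-1 *: (((flat m \o (fun s => aff b a x + s * b j 0)) \o shift 0) (h *: (1 : R))
        - (flat m \o (fun s => aff b a x + s * b j 0)) 0)).
    apply/funext => h /=; rewrite addr0 mul0r addr0 [h *: 1]mulr1 [_ + x]addrC affE.
    congr (_ *: (flat m (_ + _ * _) - _)).
    rewrite /dot (bigD1 j)//= mxE !eqxx mulr1 big1 ?addr0// => i ij.
    by rewrite mxE (negbTE ij) mulr0.
  exact: dD.
by split; [exact: cvgP c|exact: cvg_lim c].
Qed.

Lemma smooth_flat_aff m (b : point3) a : smooth (fun x => flat m (aff b a x)).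
Proof.
have cf k : continuous (fun x => flat k (aff b a x)).
  exact: (cont_comp (@cont_aff _ b a) (@continuous_flat k)).
move=> n; elim: n m => [|n IH] m; first exact: cf.
split=> [|x j|j]; first exact: cf.
  by have [] := is_derive_flat_aff m b a j x.
rewrite (_ : partial j _ = fun x =>
  b j 0 * (flat m.+2 (aff b a x) + - m%:R * flat m.+1 (aff b a x))); last first.
  by apply/funext => x; rewrite /partial; have [_ ->] := is_derive_flat_aff m b a j x; rewrite mulNr.
apply: CnM; first exact: Cn_cst.
by apply: CnD => //; apply: CnM => //; exact: Cn_cst.
Qed.
End Bump.

(** * The divergence theorem on a tetrahedron *)

Section Divergence.
Context {R : realType}.
Notation point3 := 'cV[R]_3.
Implicit Types (w v : 'I_4 -> point3) (f : point3 -> R).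

Definition opp_face w (a : 'I_4) f : R :=
  tri (w (lift a 0)) (w (lift a 1)) (w (lift a 2)) f.

Lemma lift4E : ((lift (0 : 'I_4) 0 = 1) * (lift (0 : 'I_4) 1 = 2) * (lift (0 : 'I_4) 2 = 3) *
  (lift (1 : 'I_4) 0 = 0) * (lift (1 : 'I_4) 1 = 2) * (lift (1 : 'I_4) 2 = 3) *
  (lift (2 : 'I_4) 0 = 0) * (lift (2 : 'I_4) 1 = 1) * (lift (2 : 'I_4) 2 = 3) *
  (lift (3 : 'I_4) 0 = 0) * (lift (3 : 'I_4) 1 = 1) * (lift (3 : 'I_4) 2 = 2))%type.
Proof. by do ! split; exact/val_inj. Qed.

Lemma hom_perm w (s : 'I_4 -> 'I_4) (s_inj : injective s) :
  hom (w \o s) = hom w *m perm_mx (perm s_inj)^-1.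
Proof. by rewrite -col_permE; apply/matrixP => i j; rewrite !mxE permE. Qed.

Lemma indep_perm w (s : 'I_4 -> 'I_4) : injective s -> indep w -> indep (w \o s).
Proof.
by move=> s_inj; rewrite /indep (hom_perm w s_inj) unitmx_mul unitmx_perm andbT.
Qed.

Lemma vol_perm w (s : 'I_4 -> 'I_4) : injective s -> vol (w \o s) = vol w.
Proof.
move=> s_inj; rewrite /vol (hom_perm w s_inj) det_mulmx normrM det_perm.
by rewrite normr_sign mulr1.
Qed.

Lemma tetra_perm w (s : 'I_4 -> 'I_4) : injective s -> indep w -> tetra (w \o s) = tetra w.
Proof.
move=> s_inj iw; have iws := indep_perm s_inj iw.
have b i x : bar (w \o s) i x = bar w (s i) x.
  apply: (bar_unique (c := fun i => bar w (s i) x)) => //.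
    by rewrite -(sum_bar x iw) [RHS](reindex_inj s_inj).
  by have [xE _] := bar_hom x iw; rewrite [LHS]xE (reindex_inj s_inj).
apply/seteqP; split => x; rewrite !tetraP// => H i; last by rewrite b.
by have [g gK sK] := injF_bij s_inj; rewrite -(sK i) -b.
Qed.

Lemma green_perm w (s : 'I_4 -> 'I_4) f : injective s -> indep w -> smooth f ->
  integral3 (tetra w) (ddir (w (s 2) - w (s 3)) f) =
  vol w * (tri (w (s 0)) (w (s 1)) (w (s 2)) f - tri (w (s 0)) (w (s 1)) (w (s 3)) f).
Proof.
move=> s_inj iw sf; rewrite -(tetra_perm s_inj iw) -(vol_perm w s_inj).
have := @green_tetra23 R (w \o s) f (ddir (w (s 2) - w (s 3)) f); apply.
- exact: indep_perm.
- exact: smooth_continuous.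
- exact/smooth_continuous/smooth_ddir.
- by move=> x t; exact: is_derive_smooth.
Qed.

(** The edge from [w b] to [w a] is parallel to the two faces containing it, so only the faces
    opposite to its ends contribute. Relabelling the vertices reduces the twelve ordered pairs to
    one, and the symmetry of [tri] puts the vertices of each face back in order. *)
Lemma green_tetra w (a b : 'I_4) f : a != b -> indep w -> smooth f ->
  integral3 (tetra w) (ddir (w a - w b) f) = vol w * (opp_face w b f - opp_face w a f).
Proof.
move=> + iw sf; have cf := smooth_continuous sf.
have inj (s : 'I_4 -> 'I_4) : uniq [:: s 0; s 1; s 2; s 3] -> injective s.
  rewrite /= !inE !negb_or => /and4P[/and3P[/eqP h1 /eqP h2 /eqP h3] /andP[/eqP h4 /eqP h5] /eqP h6 _].
  by elim/ord4P; elim/ord4P => // ?; exfalso; auto.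
have G p q r t : uniq [:: p; q; r; t] -> integral3 (tetra w) (ddir (w r - w t) f) =
    vol w * (tri (w p) (w q) (w r) f - tri (w p) (w q) (w t) f).
  by move=> u; apply: (green_perm (s := fun i => [:: p; q; r; t]`_i)) => //; exact: inj.
have S12 p q r : tri p q r f = tri q p r f by exact: tri_swap12.
have S23 p q r : tri p q r f = tri p r q f by exact: tri_swap23.
have rot p q r : tri p q r f = tri r p q f by rewrite S23 S12.
rewrite /opp_face; elim/ord4P: a; elim/ord4P: b => // _; rewrite !lift4E.
- by rewrite (G 2 3 0 1 isT) (rot (w 2) (w 3) (w 0)) (rot (w 2) (w 3) (w 1)) .
- by rewrite (G 1 3 0 2 isT) (rot (w 1) (w 3) (w 0)) (S23 (w 1) (w 3) (w 2)) .
- by rewrite (G 1 2 0 3 isT) (rot (w 1) (w 2) (w 0)) .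
- by rewrite (G 2 3 1 0 isT) (rot (w 2) (w 3) (w 1)) (rot (w 2) (w 3) (w 0)) .
- by rewrite (G 0 3 1 2 isT) (S23 (w 0) (w 3) (w 1)) (S23 (w 0) (w 3) (w 2)) .
- by rewrite (G 0 2 1 3 isT) (S23 (w 0) (w 2) (w 1)) .
- by rewrite (G 1 3 2 0 isT) (S23 (w 1) (w 3) (w 2)) (rot (w 1) (w 3) (w 0)) .
- by rewrite (G 0 3 2 1 isT) (S23 (w 0) (w 3) (w 2)) (S23 (w 0) (w 3) (w 1)) .
- by rewrite (G 0 1 2 3 isT) .
- by rewrite (G 1 2 3 0 isT) (rot (w 1) (w 2) (w 0)) .
- by rewrite (G 0 2 3 1 isT) (S23 (w 0) (w 2) (w 1)) .
- by rewrite (G 0 1 3 2 isT) .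
Qed.

Lemma int3D w (f g : point3 -> R) : indep w -> continuous f -> continuous g ->
  integral3 (tetra w) (fun x => f x + g x) = integral3 (tetra w) f + integral3 (tetra w) g.
Proof.
move=> iw cf cg; rewrite /integral3 -RintegralD//.
- exact: measurable_tetra.
- exact: integrable_tetra.
- exact: integrable_tetra.
Qed.

Lemma int3Z w (k : R) f : indep w -> continuous f ->
  integral3 (tetra w) (fun x => k * f x) = k * integral3 (tetra w) f.
Proof.
move=> iw cf; rewrite /integral3 -RintegralZl//.
- exact: measurable_tetra.
- exact: integrable_tetra.
Qed.

Lemma int3_0 (D : set point3) : integral3 D (fun _ => 0) = 0.
Proof. by rewrite /integral3 /Rintegral [X in fine X]integral0. Qed.

Lemma int3_sum w (I : Type) (s : seq I) (P : pred I) (F : I -> point3 -> R) : indep w ->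
  (forall i, P i -> continuous (F i)) ->
  integral3 (tetra w) (fun x => \sum_(i <- s | P i) F i x)
  = \sum_(i <- s | P i) integral3 (tetra w) (F i).
Proof.
move=> iw cF; elim: s => [|i s IH].
  by rewrite big_nil; under eq_fun do rewrite big_nil; exact: int3_0.
rewrite big_cons -IH; under eq_fun do rewrite big_cons.
have := cF i; case: (P i) => // cFi; rewrite int3D//; first exact: cFi.
exact: cont_sum.
Qed.

Lemma triD (p q r : point3) f g : continuous f -> continuous g ->
  tri p q r (fun x => f x + g x) = tri p q r f + tri p q r g.
Proof.
move=> cf cg; rewrite /tri -RintegralD//.
- exact: measurable_simplex2.
- exact: integrable_tri.
- exact: integrable_tri.
Qed.

Lemma eq_tri (p q r : point3) f g :
  (forall z, simplex2 z -> f (tri_pt p q r z) = g (tri_pt p q r z)) -> tri p q r f = tri p q r g.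
Proof. by move=> fg; apply: eq_Rintegral => z; rewrite inE; exact: fg. Qed.

Lemma tri_0 (p q r : point3) : tri p q r (fun _ => 0) = 0.
Proof. by rewrite /tri /Rintegral [X in fine X]integral0. Qed.

Lemma tri_sum (p q r : point3) (I : Type) (s : seq I) (P : pred I) (F : I -> point3 -> R) :
  (forall i, P i -> continuous (F i)) ->
  tri p q r (fun x => \sum_(i <- s | P i) F i x) = \sum_(i <- s | P i) tri p q r (F i).
Proof.
move=> cF; elim: s => [|i s IH].
  by rewrite big_nil; under eq_fun do rewrite big_nil; exact: tri_0.
rewrite big_cons -IH; under eq_fun do rewrite big_cons.
have := cF i; case: (P i) => // cFi; rewrite triD//; first exact: cFi.
exact: cont_sum.
Qed.

Lemma simplex2_face w (a : 'I_4) z : indep w -> simplex2 z ->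
  let x := tri_pt (w (lift a 0)) (w (lift a 1)) (w (lift a 2)) z in
  [/\ tetra w x, bar w a x = 0, bar w (lift a 0) x = z.1, bar w (lift a 1) x = z.2
    & bar w (lift a 2) x = 1 - z.1 - z.2].
Proof.
move=> iw [z1 z2 z3] x.
pose c (j : 'I_4) := if unlift a j is Some i then [:: z.1; z.2; 1 - z.1 - z.2]`_i else 0.
have cl i : c (lift a i) = [:: z.1; z.2; 1 - z.1 - z.2]`_i by rewrite /c liftK.
have ca : c a = 0 by rewrite /c unlift_none.
have cb i : bar w i x = c i.
  apply: bar_unique => //; rewrite (bigD1_ord a)//= ca big3 !cl /=.
    by ring.
  by rewrite scale0r add0r.
split; rewrite ?cb ?cl ?ca//.
rewrite tetraP// => i; rewrite cb; case: (unliftP a i) => [j|] ->; rewrite ?ca ?cl//.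
by elim/ord3P: j => //=; lra.
Qed.

Lemma opp_face0 w (a : 'I_4) f : indep w ->
  (forall x, tetra w x -> bar w a x = 0 -> f x = 0) -> opp_face w a f = 0.
Proof.
move=> iw f0; rewrite -[RHS](tri_0 (w (lift a 0)) (w (lift a 1)) (w (lift a 2))).
by apply: eq_tri => z Sz; have [Tx bx _ _ _] := simplex2_face a iw Sz; exact: f0.
Qed.

(** The barycentric coordinates of [y] and of 0 differ by [dot (grad w a) y], and the gradients add
    up to 0. This rewrites coordinate derivatives as derivatives along edges. *)
Lemma grad_sum w (b : 'I_4) (y : point3) : indep w ->
  y = \sum_a dot (grad w a) y *: (w a - w b).
Proof.
move=> iw; have [yE _] := bar_hom y iw; have [zE _] := bar_hom 0 iw.
under eq_bigr do rewrite scalerBr; rewrite sumrB -scaler_suml -dot_suml sum_grad// dot0l scale0r subr0.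
transitivity (y - 0); first by rewrite subr0.
rewrite [X in X - _]yE [X in _ - X]zE -sumrB; apply: eq_bigr => a _.
by rewrite -scalerBl [bar w a y]barE addrK.
Qed.

Definition vdiv (W : point3 -> point3) : point3 -> R :=
  fun x => \sum_j partial j (fun y => W y j 0) x.

Lemma smooth_dot (g : point3) (W : point3 -> point3) :
  (forall j, smooth (fun y => W y j 0)) -> smooth (fun y => dot g (W y)).
Proof.
by move=> sW; apply: smooth_sum => j _; apply: smoothM => //; exact: smooth_cst.
Qed.

Lemma ddir_dot (g u : point3) (W : point3 -> point3) x :
  (forall j, smooth (fun y => W y j 0)) ->
  ddir u (fun y => dot g (W y)) x = \sum_i g i 0 * ddir u (fun y => W y i 0) x.
Proof.
move=> sW; rewrite /dot !big3; under eq_fun do rewrite big3.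
have s i : smooth (fun y => g i 0 * W y i 0) by apply: smoothM => //; exact: smooth_cst.
rewrite ddirD//; last exact: smoothD.
by rewrite ddirD// !ddirZ.
Qed.

Lemma vdivE w (b : 'I_4) (W : point3 -> point3) x : indep w ->
  (forall j, smooth (fun y => W y j 0)) ->
  vdiv W x = \sum_a ddir (w a - w b) (fun y => dot (grad w a) (W y)) x.
Proof.
move=> iw sW; under eq_bigr do rewrite ddir_dot//.
rewrite exchange_big /=; apply: eq_bigr => i _.
have := grad_sum b (delta_mx i 0) iw => E.
rewrite -[LHS](congr1 (fun h => h x) (ddir_delta _ _)) {1}E.
have -> (s : seq 'I_4) (F : 'I_4 -> point3) (h : point3 -> R) :
    ddir (\sum_(a <- s) F a) h x = \sum_(a <- s) ddir (F a) h x.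
  elim: s => [|a s IH]; last by rewrite !big_cons ddir_addv IH.
  by rewrite !big_nil /ddir big1// => j _; rewrite mxE mul0r.
apply: eq_bigr => a _; rewrite ddir_scalev; congr (_ * _).
rewrite /dot (bigD1 i)//= [delta_mx _ _ _ _]mxE !eqxx mulr1 big1 ?addr0// => j ij.
by rewrite [delta_mx _ _ _ _]mxE (negbTE ij) mulr0.
Qed.

(** Write the divergence with derivatives along the edges issued from the vertex [b]. The
    contributions of the face opposite to [b] cancel because the gradients sum to 0; the sign is
    there because gradients point inwards. *)
Lemma divergence_tetra w (W : point3 -> point3) : indep w ->
  (forall j, smooth (fun y => W y j 0)) ->
  integral3 (tetra w) (vdiv W) =
  - vol w * \sum_a opp_face w a (fun x => dot (grad w a) (W x)).
Proof.
move=> iw sW; pose b : 'I_4 := 0.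
have sg a : smooth (fun x => dot (grad w a) (W x)) by exact: smooth_dot.
have -> : vdiv W = fun x => \sum_a ddir (w a - w b) (fun y => dot (grad w a) (W y)) x.
  by apply/funext => x; exact: vdivE.
rewrite int3_sum//; last by move=> a _; exact/smooth_continuous/smooth_ddir.
transitivity (\sum_a vol w * (opp_face w b (fun x => dot (grad w a) (W x))
    - opp_face w a (fun x => dot (grad w a) (W x)))).
  apply: eq_bigr => a _; have [->|ab] := eqVneq a b; last by rewrite green_tetra.
  rewrite !subrr mulr0 -[RHS](int3_0 (tetra w)); congr integral3; apply/funext => x.
  by rewrite /ddir big1// => j _; rewrite mxE mul0r.
rewrite -mulr_sumr sumrB mulNr mulrBr -tri_sum; last first.
  by move=> a _; exact: smooth_continuous.
rewrite [X in vol w * X](_ : _ = 0) ?mulr0 ?sub0r//.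
rewrite -[RHS](tri_0 (w (lift b 0)) (w (lift b 1)) (w (lift b 2))).
by apply: eq_tri => z _; rewrite -dot_suml sum_grad// dot0l.
Qed.
End Divergence.

(** * Functions orthogonal to all test functions *)

Section DynkinIntegral.
Context {R : realType} d (T : measurableType d) (m : {measure set T -> \bar R}).
Local Open Scope ereal_scope.

(** The sets over whose preimage [H] has integral 0 form a Dynkin system. The set [K] freezes the
    remaining coordinates, so that the lemma can be applied to one coordinate at a time. *)
Lemma dynkin_integral d' (X : measurableType d') (G : set (set X)) (g : T -> X)
    (H : T -> \bar R) (K : set T) :
  d'.-measurable = <<s G >> -> setI_closed G -> measurable_fun setT g ->
  m.-integrable setT H -> measurable K -> \int[m]_(x in K) H x = 0 ->
  (forall A, G A -> \int[m]_(x in K `&` g @^-1` A) H x = 0) ->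
  forall A, measurable A -> \int[m]_(x in K `&` g @^-1` A) H x = 0.
Proof.
move=> eG IG mg iH mK K0 G0 A mA; have : <<s G >> A by rewrite -eG.
have mgA B : measurable B -> measurable (g @^-1` B).
  by move=> mB; rewrite -[_ @^-1` _]setTI; exact: mg.
pose P B := \int[m]_(x in K `&` g @^-1` B) H x = 0.
apply: (@dynkin_induction _ _ G P eG IG) => //.
- by rewrite /P preimage_setT setIT.
- move=> S mS; rewrite /P => S0; have := K0.
  rewrite -{1}(setIT K) -(setUCr (g @^-1` S)) setIUr integral_setU//; first by rewrite S0 add0e.
  + by apply: measurableI => //; exact: mgA.
  + by apply: measurableI => //; apply: measurableC; exact: mgA.
  + by apply: measurable_funTS; exact: measurable_int iH.
  + by apply/disj_setPS => x [[_ Sx] [_ /(_ Sx)]].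
- move=> F mF tF F0; rewrite /P preimage_bigcup setI_bigcupr integral_bigcup.
  + by apply: eseries0 => n _ _; exact: F0.
  + apply/trivIsetP => i j _ _ ij; move/trivIsetP : tF => /(_ i j I I ij) tF.
    apply/seteqP; split => // x [[_ Fi] [_ Fj]].
    by have : (F i `&` F j) (g x); [split|rewrite tF].
  + by move=> k; apply: measurableI => //; exact: mgA.
  + apply: integrableS iH => //; apply: bigcup_measurable => k _.
    by apply: measurableI => //; exact: mgA.
Qed.
End DynkinIntegral.

Section Fundamental.
Context {R : realType}.
Notation point3 := 'cV[R]_3.
Notation mu := (@lebesgue_measure R).
Notation R3 := (measurableTypeR R * measurableTypeR R * measurableTypeR R)%type.

Let ray (a : R) : set (measurableTypeR R) := [set x | x < a].

Let rayE : (@measurable _ (measurableTypeR R)) = <<s [set A | exists a, A = ray a] >>.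
Proof.
rewrite -[LHS]/(measurable : set (set (g_sigma_algebraType (@ocitv R)))).
by rewrite RGenInftyO.measurableE; congr (<<s _ >>).
Qed.

Let rayI : setI_closed [set A | exists a, A = ray a].
Proof.
move=> _ _ [a ->] [b ->]; exists (Num.min a b); apply/seteqP.
by split => x; rewrite /ray /= lt_min => /andP.
Qed.

(** [None] is the whole line: the total set demanded by the Dynkin argument is then covered by the
    same smooth approximation as the half-lines. *)
Let oray (o : option R) : set (measurableTypeR R) := if o is Some a then ray a else setT.

Let measurable_oray o : measurable (oray o).
Proof.
case: o => [a|]; last exact: measurableT.
by rewrite rayE; apply: sub_gen_smallest; exists a.
Qed.

(* Smooth approximations of the indicator functions of half-lines. *)
Let cut (o : option R) (n : nat) (t : R) : R :=
  if o is Some a then flat 0 (n.+1%:R * (a - t)) else 1.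

Let cut01 o n t : 0 <= cut o n t <= 1.
Proof. by case: o => [a|] /=; rewrite ?flat_ge0 ?flat0_le1// ler01 lexx. Qed.

Let cvg_cut o t : cut o n t @[n --> \oo] --> ((t \in oray o)%:R : R).
Proof.
case: o => [a|] /=; last by rewrite in_setT; exact: cvg_cst.
have [ta|at_] := ltP t a.
  rewrite mem_set//.
  have s0 : 0 < a - t by rewrite subr_gt0.
  rewrite (_ : (fun n => _) = fun n => expR (- ((a - t)^-1 * harmonic n))); last first.
    apply/funext => n; rewrite /flat mulr_gt0// expr0 mul1r invfM mulrC.
    by rewrite /harmonic.
  have -> : true%:R = expR (- ((a - t)^-1 * 0)) :> R by rewrite mulr0 oppr0 expR0.
  suff h : - ((a - t)^-1 * @harmonic R n) @[n --> \oo] --> - ((a - t)^-1 * 0).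
    exact: (cvg_comp _ _ h (@continuous_expR R _)).
  by apply: cvgN; apply: cvgMr; exact: cvg_harmonic.
rewrite memNset; last by rewrite /ray /=; apply/negP; rewrite -leNgt.
rewrite (_ : (fun n => _) = fun n => 0); first exact: cvg_cst.
by apply/funext => n; rewrite flat_le0// mulr_ge0_le0// subr_le0.
Qed.

Let smooth_cut o n i : smooth (fun x : point3 => cut o n (x i 0)).
Proof.
case: o => [a|] /=; last exact: smooth_cst.
rewrite (_ : (fun x => _) = fun x : point3 =>
  flat 0 (aff (- n.+1%:R *: delta_mx i 0) (n.+1%:R * a) x)); first exact: smooth_flat_aff.
apply/funext => x; rewrite /aff dotZl /dot (bigD1 i)//= big1; last first.
  by move=> j ji; rewrite mxE (negbTE ji) mul0r.
by rewrite !mxE !eqxx; congr flat; rewrite mulNr mul1r addr0 mulrBr addrC.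
Qed.

(** Products of the functions [cut] converge boundedly to indicators of octants, so [H] has integral
    0 on octants by dominated convergence. [dynkin_integral] then passes to boxes, coordinate by
    coordinate, and from boxes to all measurable sets. *)
Lemma ae0_smooth_orthogonal (H : R3 -> R) : leb3.-integrable setT (EFin \o H) ->
  (forall psi : point3 -> R, smooth psi -> (forall x, 0 <= psi x <= 1) ->
     Rintegral leb3 setT (fun z => H z * psi (pt3 z)) = 0) ->
  {ae leb3, forall z, H z = 0}.
Proof.
move=> iH H0; pose Q (A B C : set (measurableTypeR R)) :=
  (\int[leb3]_(z in A `*` B `*` C) (H z)%:E = 0)%E.
have mbox (A B C : set (measurableTypeR R)) : measurable A -> measurable B -> measurable C ->
    measurable (A `*` B `*` C : set R3).
  by move=> mA mB mC; apply: measurableX => //; exact: measurableX.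
have Q0 a b c : Q (oray a) (oray b) (oray c).
  pose psi n (x : point3) := cut a n (x 0 0) * cut b n (x 1 0) * cut c n (x 2 0).
  have psi01 n x : 0 <= psi n x <= 1.
    rewrite /psi; have /andP[a0 a1] := cut01 a n (x 0 0).
    have /andP[b0 b1] := cut01 b n (x 1 0); have /andP[c0 c1] := cut01 c n (x 2 0).
    by rewrite !mulr_ge0//= mulr_ile1// ?mulr_ge0// mulr_ile1.
  have spsi n : smooth (psi n) by do !apply: smoothM; exact: smooth_cut.
  pose O := (oray a `*` oray b `*` oray c : set R3).
  have mO : measurable O by apply: mbox; exact: measurable_oray.
  have mH := measurable_int _ iH.
  have mHR : measurable_fun setT H by apply/measurable_EFinP.
  have mpsi n : measurable_fun setT (fun z : R3 => psi n (pt3 z)).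
    by apply: measurable_continuous3; exact: smooth_continuous.
  have cv (z : R3) : (EFin \o (fun n => H z * psi n (pt3 z))) n @[n --> \oo] -->
      ((EFin \o H) \_ O) z.
    have -> : ((EFin \o H) \_ O) z = (H z * ((z.1.1 \in oray a)%:R
        * (z.1.2 \in oray b)%:R * (z.2 \in oray c)%:R))%:E.
      rewrite patchE; have -> : (z \in O) = [&& z.1.1 \in oray a, z.1.2 \in oray b & z.2 \in oray c].
        apply/idP/and3P; rewrite !inE; first by case=> -[].
        by case=> *; split.
      by do 3 case: (_ \in _); rewrite /= ?mulr1 ?mulr0 ?mul0r.
    apply: cvg_EFin; first by near=> n.
    apply: cvgMr; apply: cvgM; first apply: cvgM.
    + by have := cvg_cut (o := a) (t := z.1.1); rewrite /psi pt3E.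
    + by have := cvg_cut (o := b) (t := z.1.2); rewrite /psi pt3E.
    + by have := cvg_cut (o := c) (t := z.2); rewrite /psi pt3E.
  have Hle n z : (`|(H z * psi n (pt3 z))%:E| <= `|(H z)%:E|)%E.
    rewrite !abse_EFin lee_fin normrM ler_piMr//.
    by have /andP[p0 p1] := psi01 n (pt3 z); rewrite ger0_norm.
  have [|||||_ _ L] := @dominated_convergence _ _ _ leb3 setT measurableT
     (fun n z => (H z * psi n (pt3 z))%:E) ((EFin \o H) \_ O) (fun z => `|(H z)%:E|%E).
  - by move=> n; apply/measurable_EFinP; exact: measurable_funM.
  - by apply/(measurable_restrictT _ mO); exact: measurable_funTS.
  - by apply: aeW => z _; exact: cv.
  - exact: integrable_abse.
  - apply: aeW => z n _; exact: Hle.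
  rewrite /Q integral_mkcond; apply/(cvg_unique _ L) => //.
  rewrite (_ : (fun n => _) = fun n => 0%E); first exact: cvg_cst.
  apply/funext => n; have ip : leb3.-integrable setT (EFin \o (fun z => H z * psi n (pt3 z))).
    apply: le_integrable (integrable_abse iH) => //; first by apply/measurable_EFinP; exact: measurable_funM.
    by move=> z _; rewrite abse_id; exact: Hle.
  have := H0 _ (spsi n) (psi01 n); rewrite /Rintegral => E.
  by rewrite -[RHS](congr1 EFin E) fineK//; exact: integrable_fin_num ip.
have Q1 A b c : measurable A -> Q A (oray b) (oray c).
  move=> mA; have mg : measurable_fun setT (fun z : R3 => z.1.1).
    exact: measurableT_comp measurable_fst measurable_fst.
  have := @dynkin_integral _ _ _ leb3 _ _ _ _ _ (setT `*` oray b `*` oray c) rayE rayI mg iH.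
  have E B : setT `*` oray b `*` oray c `&` (fun z : R3 => z.1.1) @^-1` B = B `*` oray b `*` oray c.
    by apply/seteqP; split => z /=; [case=> -[[_ ? ?] ?]|case=> -[? ? ?]].
  move=> /(_ _ _ _ A mA); rewrite E; apply.
  - by apply: mbox => //; exact: measurable_oray.
  - exact: Q0 None b c.
  - by move=> _ [a ->]; rewrite E; exact: Q0 (Some a) b c.
have Q2 A B c : measurable A -> measurable B -> Q A B (oray c).
  move=> mA mB; have mg : measurable_fun setT (fun z : R3 => z.1.2).
    exact: measurableT_comp measurable_snd measurable_fst.
  have := @dynkin_integral _ _ _ leb3 _ _ _ _ _ (A `*` setT `*` oray c) rayE rayI mg iH.
  have E B' : A `*` setT `*` oray c `&` (fun z : R3 => z.1.2) @^-1` B' = A `*` B' `*` oray c.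
    by apply/seteqP; split => z /=; [case=> -[[? _ ?] ?]|case=> -[? ? ?]].
  move=> /(_ _ _ _ B mB); rewrite E; apply.
  - by apply: mbox => //; exact: measurable_oray.
  - exact: Q1 None c mA.
  - by move=> _ [b ->]; rewrite E; exact: Q1 (Some b) c mA.
have Q3 A B C : measurable A -> measurable B -> measurable C -> Q A B C.
  move=> mA mB mC; have mg : measurable_fun setT (fun z : R3 => z.2) by exact: measurable_snd.
  have := @dynkin_integral _ _ _ leb3 _ _ _ _ _ (A `*` B `*` setT) rayE rayI mg iH.
  have E C' : A `*` B `*` setT `&` (fun z : R3 => z.2) @^-1` C' = A `*` B `*` C'.
    by apply/seteqP; split => z /=; [case=> -[[? ?] _] ?|case=> -[? ?] ?].
  move=> /(_ _ _ _ C mC); rewrite E; apply.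
  - exact: mbox.
  - exact: Q2 None mA mB.
  - by move=> _ [c ->]; rewrite E; exact: Q2 (Some c) mA mB.
have rectI d1 d2 (X1 : measurableType d1) (X2 : measurableType d2) :
    setI_closed [set A `*` B | A in (@measurable _ X1) & B in (@measurable _ X2)].
  move=> _ _ [A mA [B mB <-]] [A' mA' [B' mB' <-]]; rewrite -setXI.
  exists (A `&` A'); first exact: measurableI.
  by exists (B `&` B') => //; exact: measurableI.
have Q4 (S : set (measurableTypeR R * measurableTypeR R)) (C : set (measurableTypeR R)) :
    measurable S -> measurable C -> (\int[leb3]_(z in S `*` C) (H z)%:E = 0)%E.
  move=> mS mC; have mg : measurable_fun setT (fun z : R3 => z.1) by exact: measurable_fst.
  have := @dynkin_integral _ _ _ leb3 _ _ _ _ _ (setT `*` C)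
    (measurable_prod_measurableType _ _) (rectI _ _ _ _) mg iH.
  have E S' : setT `*` C `&` (fun z : R3 => z.1) @^-1` S' = S' `*` C.
    by apply/seteqP; split => z /=; [case=> -[_ ?] ?|case=> ? ?].
  move=> /(_ _ _ _ S mS); rewrite E; apply.
  - exact: measurableX.
  - by rewrite -setXTT; exact: Q3.
  - by move=> _ [A mA [B mB <-]]; rewrite E; exact: Q3.
have Q5 (S : set R3) : measurable S -> (\int[leb3]_(z in S) (H z)%:E = 0)%E.
  move=> mS; have mg : measurable_fun setT (fun z : R3 => z) by exact: measurable_id.
  have := @dynkin_integral _ _ _ leb3 _ _ _ _ _ setT
    (measurable_prod_measurableType _ _) (rectI _ _ _ _) mg iH.
  move=> /(_ _ _ _ S mS); rewrite setTI; apply.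
  - exact: measurableT.
  - by rewrite -setXTT; exact: Q4.
  - by move=> _ [A mA [B mB <-]]; rewrite setTI; exact: Q4.
have := @integral_ae_eq _ _ _ leb3 setT measurableT (cst 0) _ iH.
case=> [|E _ mE|N [mN N0 sN]]; [exact: measurable_cst|by rewrite Q5// integral0|].
by exists N; split => // z /= nz; apply: sN => /= /(_ I) -[] /nz.
Unshelve. all: by end_near.
Qed.
End Fundamental.

(** * Almost everywhere statements for continuous functions *)

Section Almost.
Context {R : realType}.
Notation point3 := 'cV[R]_3.
Notation mu := (@lebesgue_measure R).
Notation R2 := (measurableTypeR R * measurableTypeR R)%type.
Notation R3 := (measurableTypeR R * measurableTypeR R * measurableTypeR R)%type.
Implicit Types (w : 'I_4 -> point3).

Lemma near_pos (T : topologicalType) (g : T -> R) x : continuous g -> 0 < g x ->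
  \forall y \near x, 0 < g y.
Proof.
move=> cg gx; apply: (cg x [set t | 0 < t]).
by apply: open_nbhs_nbhs; split; [exact: open_gt|].
Qed.

Lemma near_neq0 (T : topologicalType) (g : T -> R) x : continuous g -> g x != 0 ->
  \forall y \near x, g y != 0.
Proof.
move=> cg gx; apply: (cg x [set t | t != 0]).
by apply: open_nbhs_nbhs; split; [exact: open_neq|].
Qed.

Lemma nbhs_not_negligible2 (z : R * R) (U : set (R * R)) : nbhs z U ->
  ~ (sprod mu).-negligible (U : set R2).
Proof.
move=> /nbhs_ballP[e /= e0 sU] nU.
pose B (x : R) : set (measurableTypeR R) := ball x e.
have mB x : measurable (B x) by apply: measurable_ball.
have {sU}nB : (sprod mu).-negligible (B z.1 `*` B z.2 : set R2).
  by apply: negligibleS nU => y [b1 b2]; apply: sU.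
move/negligibleP : nB => /(_ (measurableX (mB _) (mB _))).
move=> E; have : (mu (B z.1) * mu (B z.2) = 0)%E.
  by etransitivity; [apply/esym; exact: product_measure1E|exact: E].
rewrite /B !lebesgue_measure_ball ?ltW// -EFinM => -[/eqP].
by rewrite mulf_eq0 orbb mulrn_eq0 /= gt_eqF.
Qed.

Lemma nbhs_not_negligible3 (z : R * R * R) (U : set (R * R * R)) : nbhs z U ->
  ~ (@leb3 R).-negligible (U : set R3).
Proof.
move=> /nbhs_ballP[e /= e0 sU] nU.
pose B (x : R) : set (measurableTypeR R) := ball x e.
have mB x : measurable (B x) by apply: measurable_ball.
have {sU}nB : (@leb3 R).-negligible (B z.1.1 `*` B z.1.2 `*` B z.2 : set R3).
  by apply: negligibleS nU => y [[b1 b2] b3]; apply: sU.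
move/negligibleP : nB => /(_ (measurableX (measurableX (mB _) (mB _)) (mB _))).
move=> E; have : (mu (B z.1.1) * mu (B z.1.2) * mu (B z.2) = 0)%E.
  by etransitivity; [apply/esym; exact: leb3_box|exact: E].
rewrite /B !lebesgue_measure_ball ?ltW// -!EFinM => -[/eqP].
by rewrite !mulf_eq0 orbb orbb mulrn_eq0 /= gt_eqF.
Qed.

Lemma near_bar_gt0 w x : (forall i, 0 < bar w i x) ->
  \forall y \near x, forall i, 0 < bar w i y.
Proof.
move=> x0; apply: (@filter_forall _ _ (fun i y => 0 < bar w i y) (nbhs x)) => i.
exact: (near_pos (@continuous_bar R w i) (x0 i)).
Qed.

Lemma ae_tetra_eq0 w (f : point3 -> R) : indep w -> continuous f ->
  ae_on (tetra w) (fun x => f x = 0) ->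
  forall x, (forall i, 0 < bar w i x) -> f x = 0.
Proof.
move=> iw cf nf x x0; apply/eqP; apply/negP => /negP fx.
have H : \forall y \near x, tetra w y /\ f y != 0.
  near=> y; split; last first.
    near: y; exact: (near_neq0 cf fx).
  apply/tetraP => // i; apply: ltW; move: i; near: y; exact: near_bar_gt0.
have := @continuous_pt3 R (unpt3 x) [set y | tetra w y /\ f y != 0]; rewrite unpt3K => /(_ H).
move=> /nbhs_not_negligible3; apply; apply: negligibleS nf => z [Tz fz] /= /(_ Tz) E.
by rewrite E eqxx in fz.
Unshelve. all: by end_near.
Qed.

Lemma integral_tetra_eq0 w (f : point3 -> R) : indep w -> continuous f ->
  (forall x, tetra w x -> 0 <= f x) -> integral3 (tetra w) f = 0 ->
  forall x, (forall i, 0 < bar w i x) -> f x = 0.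
Proof.
move=> iw cf f0 If; have mT := measurable_tetra iw; have ig := integrable_tetra iw cf.
have [H _] := @ae_eq_integral_abs _ _ _ leb3 _ mT _ (measurable_int _ ig).
apply: ae_tetra_eq0 => //; apply: filterS (H _) => [z + Tz|]; first by case/(_ Tz).
rewrite -[RHS](congr1 EFin If) /integral3 /Rintegral fineK; last first.
  by apply: integrable_fin_num ig.
by apply: eq_integral => z; rewrite inE => Tz; rewrite /= ger0_norm ?f0.
Qed.

Lemma tri_eq0 (p q r : point3) (f : point3 -> R) : continuous f ->
  (forall z, simplex2 z -> 0 <= f (tri_pt p q r z)) -> tri p q r f = 0 ->
  forall z : R * R, 0 < z.1 -> 0 < z.2 -> z.1 + z.2 < 1 -> f (tri_pt p q r z) = 0.
Proof.
move=> cf f0 If z z1 z2 z12; apply/eqP; apply/negP => /negP fx.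
have ig := integrable_tri p q r cf.
have E : ae_eq (sprod mu) simplex2 (EFin \o (fun z => f (tri_pt p q r z))) (cst 0%E).
  have := @ae_eq_integral_abs _ _ _ (sprod mu) _ (@measurable_simplex2 R) _ (measurable_int _ ig).
  case=> + _ => H; apply: H; rewrite -[RHS](congr1 EFin If) /tri /Rintegral fineK; last first.
    by apply: integrable_fin_num ig => //; exact: measurable_simplex2.
  by apply: eq_integral => y; rewrite inE => Ty; rewrite /= ger0_norm ?f0.
have [c1 c2] : continuous (fun z : R * R => z.1) /\ continuous (fun z : R * R => z.2).
  by split => y; [exact: cvg_fst|exact: cvg_snd].
have H : \forall y \near z, simplex2 y /\ f (tri_pt p q r y) != 0.
  near=> y; split; last first.
    near: y; apply: (near_neq0 (g := fun y => f (tri_pt p q r y))) => //.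
    exact: (cont_comp (@continuous_tri_pt _ p q r) cf).
  split.
  - by apply: ltW; near: y; exact: near_pos c1 _.
  - by apply: ltW; near: y; exact: near_pos c2 _.
  - rewrite -subr_ge0; apply: ltW; near: y.
    apply: (near_pos (g := fun y : R * R => 1 - (y.1 + y.2))); last by rewrite subr_gt0.
    by apply: contB; [exact: contC|exact: contD].
move/nbhs_not_negligible2 : H; apply; apply: negligibleS E => y [Ty fy] /= /(_ Ty) [] E.
by rewrite E eqxx in fy.
Unshelve. all: by end_near.
Qed.

(** After a transposition of the vertices the index is 0; then the parametrization, which scales
    measures by a nonzero factor, pulls the plane back to {0} x R x R, a null box. *)
Lemma null_bar w i : indep w -> (@leb3 R).-negligible [set z : R3 | bar w i (pt3 z) = 0].
Proof.
move=> iw; pose s := tperm (0 : 'I_4) i.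
have iws : indep (w \o s) by apply: indep_perm => //; exact: perm_inj.
have bE x : bar (w \o s) 0 x = bar w i x.
  rewrite -(tpermL 0 i) -/s; apply: (bar_unique (c := fun j => bar w (s j) x)) => //.
    by rewrite -(sum_bar x iw) [RHS](reindex_inj (@perm_inj _ s)).
  by rewrite {1}(bar_hom x iw).1 (reindex_inj (@perm_inj _ s)).
pose N := [set z : R3 | bar (w \o s) 0 (pt3 z) = 0].
have mN : measurable N.
  have := @measurable_continuous3 R _ (@continuous_bar R (w \o s) 0) measurableT [set 0] (measurable_set1 _).
  by rewrite setTI.
rewrite (_ : [set z | _] = N); last by apply/funext => z; rewrite /N /= bE.
apply/negligibleP => //.
have [_ /(_ (fun z => (\1_N z)%:E)) H] := scales_par iws.
have mI : measurable_fun setT (fun z : R3 => (\1_N z)%:E : \bar R).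
  by apply/measurable_EFinP; exact: measurable_indic.
have {H} := H mI (fun z => ler0n _ _).
have -> : (\int[leb3]_z (\1_N z)%:E = leb3 N)%E by rewrite integral_indic// setIT.
move=> E.
have : (\int[leb3]_z (\1_N (unpt3 (par (w \o s) z)))%:E = 0)%E.
  rewrite (_ : (fun z => _) = fun z : R3 => (\1_([set 0] `*` setT `*` setT : set R3) z)%:E).
    rewrite integral_indic//; last by apply: measurableX => //; apply: measurableX.
    by rewrite setIT leb3_box// lebesgue_measure_set1 !mul0e.
  apply/funext => z; rewrite !indicE; congr (_%:R%:E); congr nat_of_bool.
  have [p0 _ _ _] := bar_par z iws.
  apply/idP/idP; rewrite !inE /N /= unpt3K p0; first by move=> ->.
  by case=> -[].
rewrite E => /eqP; rewrite mule_eq0 => /orP[|/eqP//].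
by rewrite eqe invr_eq0 gt_eqF// vol_gt0.
Qed.
End Almost.

(** * The Alfeld split *)

Section AlfeldGeometry.
Context {R : realType}.
Notation point3 := 'cV[R]_3.
Notation R3 := (measurableTypeR R * measurableTypeR R * measurableTypeR R)%type.
Variable v : 'I_4 -> point3.
Hypothesis iv : indep v.
Implicit Types (l m j : 'I_4).

(** The vertices behind [alfeld v l], so that results on general tetrahedra apply to the pieces; the
    barycenter takes the label [l]. *)
Definition alf (l j : 'I_4) : point3 := if j == l then barycenter v else v j.

(** [C] is the identity with its column [l] replaced by the barycentric coordinates 1/4 of the
    barycenter. Its row [l] has a single nonzero entry, which gives the determinant. *)
Lemma vol_alf l : indep (alf l) /\ vol (alf l) = vol v / 4.
Proof.
pose C : 'M[R]_4 := \matrix_(i, j) if j == l then 4^-1 else (i == j)%:R.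
have hE : hom (alf l) = hom v *m C.
  apply/matrixP => i j; rewrite !mxE /alf; under eq_bigr do rewrite !mxE.
  case: eqP => [_|_]; last first.
    rewrite (bigD1 j)//= eqxx mulr1 big1 ?addr0// => k /negbTE kj.
    by rewrite kj mulr0.
  rewrite -mulr_suml mulrC; case: (splitP i) => a _.
    by rewrite !mxE summxE.
  by rewrite !mxE big4 (ord1 a) !eqxx; field.
have dC : \det C = 4^-1.
  rewrite (expand_det_row _ l) (bigD1 l)//= big1 ?addr0; last first.
    by move=> j jl; rewrite mxE (negbTE jl) eq_sym (negbTE jl) mul0r.
  rewrite mxE eqxx /cofactor -signr_odd addnn odd_double expr0 mul1r.
  rewrite (_ : row' l (col' l C) = 1%:M) ?det1 ?mulr1//.
  apply/matrixP => i j; rewrite !mxE eq_sym (negbTE (neq_lift _ _)).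
  by rewrite (inj_eq (@lift_inj _ _)).
have d0 : 4^-1 != 0 :> R by rewrite invr_eq0 pnatr_eq0.
have iC : C \in unitmx by rewrite unitmxE dC unitfE.
split; first by rewrite /indep hE unitmx_mul iC andbT.
by rewrite /vol hE det_mulmx normrM dC [X in _ * X]ger0_norm// invr_ge0 ler0n.
Qed.

Lemma indep_alf l : indep (alf l). Proof. exact: (vol_alf l).1. Qed.

(** Trading v_l for the barycenter c gives x = sum_j (lambda_j - lambda_l) v_j + 4 lambda_l c. Thus
    the piece [l] is where the coordinate [l] of [v] is smallest, and its interior faces are
    equalities between two coordinates of [v]. *)
Lemma bar_alf l j x :
  bar (alf l) j x = if j == l then 4 * bar v l x else bar v j x - bar v l x.
Proof.
pose c j := (bar v j x - bar v l x) + (j == l)%:R * (4 * bar v l x).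
have cE i : (if i == l then 4 * bar v l x else bar v i x - bar v l x) = c i.
  by rewrite /c; case: eqP => [->|_]; rewrite ?subrr ?add0r ?mul1r ?mul0r ?addr0.
have sumD (V : lmodType R) (F : 'I_4 -> V) (a : R) : \sum_j ((j == l)%:R * a) *: F j = a *: F l.
  rewrite (bigD1 l)//= eqxx mul1r big1 ?addr0// => i /negbTE ->.
  by rewrite mul0r scale0r.
rewrite cE; apply: (bar_unique (c := c)); first exact: indep_alf.
- rewrite /c big_split /= sumrB sum_bar//.
  rewrite [X in _ + X](bigD1 l)//= eqxx mul1r [X in _ + (_ + X)]big1 ?addr0 => [|i /negbTE ->]; last by rewrite mul0r.
  by rewrite sumr_const card_ord; ring.
- rewrite {1}(bar_hom x iv).1 /c.
  transitivity (\sum_j (bar v j x - bar v l x) *: v j + (4 * bar v l x) *: barycenter v).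
    rewrite /barycenter scalerA mulrAC divff ?mul1r ?pnatr_eq0// scaler_sumr -big_split /=.
    by apply: eq_bigr => i _; rewrite -scalerDl subrK.
  have <- : \sum_j ((j == l)%:R * (4 * bar v l x)) *: alf l j = (4 * bar v l x) *: barycenter v.
    by rewrite sumD /alf eqxx.
  rewrite -big_split /=; apply: eq_bigr => i _; rewrite [RHS]scalerDl /alf.
  by case: eqP => [->|//]; rewrite subrr !scale0r.
Qed.

Lemma dot_ext (a b : point3) : (forall y, dot a y = dot b y) -> a = b.
Proof.
move=> H; apply/subr0_eq; apply: dot_eq0.
by rewrite dotBl !(dotBr _ a b) !H subrr.
Qed.

Lemma grad_alf l j :
  grad (alf l) j = if j == l then 4 *: grad v l else grad v j - grad v l.
Proof.
have E w i y : dot (grad w i) y = bar w i (0 + 1 *: y) - bar w i 0 :> R.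
  by rewrite bar_line mul1r addrC addKr.
apply: dot_ext => y; rewrite E !bar_alf; case: eqP => _.
  by rewrite dotZl E -mulrBr.
by rewrite dotBl !E; ring.
Qed.

Lemma alfeldP l x : alfeld v l x <-> 0 <= bar v l x /\ forall j, bar v l x <= bar v j x.
Proof.
rewrite -[alfeld v l]/(tetra (alf l)) (tetraP _ (indep_alf l)); split.
  move=> H; have := H l; rewrite bar_alf eqxx pmulr_rge0// => H0; split => // j.
  by have := H j; rewrite bar_alf; case: eqP => [->|_]; rewrite ?lexx ?subr_ge0.
by move=> [H0 H] j; rewrite bar_alf; case: eqP => _; rewrite ?subr_ge0 ?mulr_ge0.
Qed.

Lemma alfeld_sub l : alfeld v l `<=` tetra v.
Proof.
move=> x /alfeldP[H0 H]; apply/tetraP => // j; exact: le_trans H0 (H j).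
Qed.

(* The tetrahedra of the split overlap on their common faces; [first_min]
   breaks the ties, so that every point is attributed to exactly one of them. *)
Definition first_min l x : bool :=
  [forall j, (bar v l x <= bar v j x) && ((j < l)%N ==> (bar v l x < bar v j x))].

Lemma first_min_ex x : exists l, first_min l x.
Proof.
pose P l := [forall j, bar v l x <= bar v j x].
have [l0 Pl0] : exists l, P l.
  exists [arg min_(l < (0 : 'I_4)) bar v l x]%O.
  by case: Order.TotalTheory.arg_minP => // l _ H; apply/forallP => j; exact: H.
case: (@arg_minnP _ l0 P (fun l => l : nat) Pl0) => l /forallP Pl H.
exists l; apply/forallP => j; rewrite Pl /=; apply/implyP => jl.
rewrite ltNge; apply/negP => lj; have : P j.
  by apply/forallP => i; exact: le_trans lj (Pl i).
by move/H; rewrite leqNgt jl.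
Qed.

Lemma first_min_uniq l m x : first_min l x -> first_min m x -> l = m.
Proof.
wlog lm : l m / (l < m)%N.
  move=> H a b; have [|/H/(_ b a)->//|/val_inj//] := ltngtP l m.
  by move=> /H; apply.
move=> /forallP /(_ m) /andP[H _] /forallP /(_ l) /andP[_].
by rewrite lm /= ltNge H.
Qed.

Lemma first_min_alfeld l x : tetra v x -> first_min l x -> alfeld v l x.
Proof.
move=> /tetraP H /forallP m; apply/alfeldP; split; first exact: H.
by move=> j; have /andP[] := m j.
Qed.

Definition glue (V : lmodType R) (Z : 'I_4 -> point3 -> V) (x : point3) : V :=
  \sum_l (first_min l x)%:R *: Z l x.

Lemma glueE (V : lmodType R) (Z : 'I_4 -> point3 -> V) l x :
  first_min l x -> glue Z x = Z l x.
Proof.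
move=> H; rewrite /glue (bigD1 l)//= H scale1r big1 ?addr0// => m ml.
case E : (first_min m x); last by rewrite scale0r.
by rewrite (first_min_uniq E H) eqxx in ml.
Qed.

Lemma ae_first_min l : ae_on (alfeld v l) (fun x => first_min l x).
Proof.
have : {ae leb3, forall z : R3, forall j, bar (alf l) j (pt3 z) <> 0}.
  apply: filter_forall => j; have := null_bar j (indep_alf l).
  by apply: negligibleS => z /= /contrapT.
apply: filterS => z N /alfeldP[_ H].
apply/forallP => j; rewrite H /=; apply/implyP => jl; rewrite lt_neqAle H andbT.
apply/negP => /eqP E; have := N j.
by rewrite bar_alf -E subrr; case: eqP jl => // ->; rewrite ltnn.
Qed.

(** Almost every point of a piece has this piece as its [first_min]; hence the indicators of the
    four pieces add up almost everywhere to that of the whole tetrahedron. *)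
Lemma integral_alfeld (f : point3 -> R) :
  leb3.-integrable ((@pt3 R) @^-1` tetra v) (EFin \o (f \o (@pt3 R))) ->
  integral3 (tetra v) f = \sum_l integral3 (alfeld v l) f.
Proof.
move=> ig; have mA l : measurable ((@pt3 R) @^-1` alfeld v l : set R3).
  exact: measurable_tetra (indep_alf l).
have mT := measurable_tetra iv.
pose F l := (EFin \o (f \o (@pt3 R))) \_ ((@pt3 R) @^-1` alfeld v l).
have iF l : leb3.-integrable setT (F l).
  by apply/(integrable_mkcond _ (mA l)); apply: integrableS ig => // z; exact: alfeld_sub.
have fF l : (\int[leb3]_z F l z)%E = (integral3 (alfeld v l) f)%:E.
  rewrite /F -integral_mkcond /integral3 /Rintegral fineK//.
  apply: (integrable_fin_num (mA l)); apply: integrableS ig => // z; exact: alfeld_sub.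
have iT : leb3.-integrable setT ((EFin \o (f \o (@pt3 R))) \_ ((@pt3 R) @^-1` tetra v)).
  exact/(integrable_mkcond _ mT).
apply: EFin_inj; rewrite -sumEFin; under eq_bigr do rewrite -fF.
rewrite -integral_sum//; rewrite /integral3 /Rintegral fineK; last exact: integrable_fin_num ig.
rewrite integral_mkcond; apply: ae_eq_integral => //.
- exact: measurable_int iT.
- by apply: emeasurable_sum => l; exact: measurable_int (iF l).
have H : {ae leb3, forall z, forall l, alfeld v l (pt3 z) -> first_min l (pt3 z)}.
  by apply: filter_forall => l; exact: ae_first_min.
apply: negligibleS H => z /= N H; apply: N => _; rewrite patchE.
have [Tz|Tz] := boolP (z \in _); last first.
  rewrite big1// => l _; rewrite /F patchE ifF//; apply: contraNF Tz.
  by rewrite !inE; exact: alfeld_sub.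
have [l Hl] := first_min_ex (pt3 z); rewrite (bigD1 l)//= big1 ?adde0.
  rewrite /F patchE mem_set//; apply: first_min_alfeld => //.
  by rewrite inE in Tz.
move=> m ml; rewrite /F patchE memNset// => /H /first_min_uniq /(_ Hl) E.
by rewrite E eqxx in ml.
Qed.
End AlfeldGeometry.

Section SquareIntegrable.
Context {R : realType}.
Notation point3 := 'cV[R]_3.
Notation R3 := (measurableTypeR R * measurableTypeR R * measurableTypeR R)%type.
Variable w : 'I_4 -> point3.
Hypothesis iw : indep w.
Notation T3 := ((@pt3 R) @^-1` tetra w).

Lemma bounded_Lfun2 (f : R3 -> R) (M : R) : measurable_fun setT f ->
  (forall z, T3 z -> `|f z| <= M) -> f \_ T3 \in Lfun leb3 2%:E.
Proof.
move=> mf fM; have mT := measurable_tetra iw.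
have mfT : measurable_fun setT (f \_ T3).
  by apply/(measurable_restrictT _ mT); exact: measurable_funTS.
apply/andP; split; rewrite inE //=.
rewrite /finite_norm unlock poweR_lty//.
rewrite (_ : (fun x => _) = (EFin \o (fun z => (f z) ^+ 2)) \_ T3); last first.
  apply/funext => z; rewrite /= !patchE; case: ifP => _ /=.
    by rewrite powR_mulrn// real_normK// num_real.
  by rewrite normr0 powR0// pnatr_eq0.
rewrite -integral_mkcond.
have : leb3.-integrable T3 (EFin \o (fun z => (f z) ^+ 2)).
  apply: measurable_bounded_integrable => //; first exact: leb3_tetra.
    by apply: measurable_funTS; exact: measurable_funX.
  exists (M ^+ 2); split; first exact: num_real.
  move=> y My z Tz; apply: le_trans (ltW My).
  rewrite normrX ler_pXn2r ?nnegrE ?fM//.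
  exact: le_trans (fM _ Tz).
move=> /(integrable_fin_num mT).
by rewrite ge0_fin_numE//; apply: integral_ge0 => z _; rewrite lee_fin sqr_ge0.
Qed.

Lemma Lfun2_cont (f : point3 -> R) : continuous f ->
  (f \o (@pt3 R)) \_ T3 \in Lfun leb3 2%:E.
Proof.
move=> cf; have [M HM] := bounded_tetra w cf; have mT := measurable_tetra iw.
apply: bounded_Lfun2 (M) _ _; first exact: measurable_continuous3.
by move=> z; exact: HM.
Qed.

Lemma integrable_mul2 (f g : R3 -> R) : f \_ T3 \in Lfun leb3 2%:E ->
  g \_ T3 \in Lfun leb3 2%:E -> leb3.-integrable T3 (EFin \o (fun z => f z * g z)).
Proof.
move=> f2 g2; have := Lfun2_mul_Lfun1 f2 g2 => /Lfun1_integrable H.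
apply/(integrable_mkcond _ (measurable_tetra iw)); move: H; congr (integrable _ _ _).
apply/funext => z; rewrite /= !patchE /=; by case: ifP => // _; rewrite mulr0.
Qed.

Lemma integrable_L2_cont m n (X : set 'M[R]_(m, n)) u i j (f : point3 -> R) :
  L2 (tetra w) X u -> continuous f ->
  leb3.-integrable T3 (EFin \o (fun z => u (pt3 z) i j * f (pt3 z))).
Proof. by move=> [_ H] cf; apply: integrable_mul2; [|exact: Lfun2_cont]. Qed.
End SquareIntegrable.

Section FaceTerms.
Context {R : realType}.
Notation point3 := 'cV[R]_3.
Implicit Types (w v : 'I_4 -> point3).

Lemma sum_lift (V : nmodType) (a : 'I_4) (F : 'I_4 -> V) :
  \sum_i F i = F a + (F (lift a 0) + F (lift a 1) + F (lift a 2)).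
Proof. by rewrite (bigD1_ord a)//= big3. Qed.

Lemma face_ptE w (a : 'I_4) x : indep w -> bar w a x = 0 ->
  x = tri_pt (w (lift a 0)) (w (lift a 1)) (w (lift a 2))
        (bar w (lift a 0) x, bar w (lift a 1) x).
Proof.
move=> iw xa; rewrite {1}(bar_hom x iw).1 (sum_lift a) xa scale0r add0r /tri_pt /=.
have := sum_bar x iw; rewrite (sum_lift a) xa add0r => <-.
by congr (_ + _ *: _); ring.
Qed.

Lemma opp_face_eq0 w (a : 'I_4) (f : point3 -> R) : indep w -> continuous f ->
  (forall x, 0 <= f x) -> opp_face w a f = 0 ->
  forall x, bar w a x = 0 -> (forall j, j != a -> 0 < bar w j x) -> f x = 0.
Proof.
move=> iw cf f0 H x xa xj; rewrite (face_ptE iw xa).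
apply: (tri_eq0 cf _ H) => //=; try by apply: xj; rewrite eq_sym neq_lift.
rewrite -(sum_bar x iw) (sum_lift a) xa add0r ltrDl.
by apply: xj; rewrite eq_sym neq_lift.
Qed.

Lemma opp_face_congr w v (a : 'I_4) f : (forall j, j != a -> w j = v j) ->
  opp_face w a f = opp_face v a f.
Proof. by move=> H; rewrite /opp_face !H// eq_sym neq_lift. Qed.

Lemma opp_face_swap w (a b : 'I_4) f : a != b -> continuous f ->
  opp_face (w \o tperm a b) a f = opp_face w b f.
Proof.
move=> ab cf; rewrite /opp_face /=.
have S p q r := @tri_swap12 R p q r f cf; have S' p q r := @tri_swap23 R p q r f cf.
move: ab; elim/ord4P: a; elim/ord4P: b => ab; rewrite ?lift4E ?tpermL ?tpermR ?tpermD//.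
all: by [rewrite S|rewrite S'|rewrite S S'|rewrite S' S].
Qed.
End FaceTerms.

(** * Green's formula on the Alfeld split *)

Section PiecewiseGreen.
Context {R : realType}.
Notation point3 := 'cV[R]_3.
Variable v : 'I_4 -> point3.
Hypothesis iv : indep v.
Implicit Types (l m : 'I_4) (w : 'I_4 -> point3 -> point3) (phi : point3 -> R).

Lemma triZ (p q r : point3) (k : R) f : continuous f ->
  tri p q r (fun x => k * f x) = k * tri p q r f.
Proof.
move=> cf; rewrite /tri -RintegralZl//; first exact: measurable_simplex2.
exact: integrable_tri.
Qed.

(** The integrand is the expanded divergence of phi times the piece [w l], so this number is a
    combination of integrals over the faces of the piece. *)
Definition green_term w phi l : R :=
  integral3 (alfeld v l) (fun x => vdiv (w l) x * phi x + \sum_j w l x j 0 * partial j phi x).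

Lemma vdivM (u : point3 -> point3) phi x : (forall j, smooth (fun y => u y j 0)) -> smooth phi ->
  vdiv (fun y => phi y *: u y) x = vdiv u x * phi x + \sum_j u x j 0 * partial j phi x.
Proof.
move=> su sp; rewrite /vdiv mulr_suml -big_split /=; apply: eq_bigr => j _.
rewrite (_ : (fun y => (phi y *: u y) j 0) = fun y => u y j 0 * phi y); last first.
  by apply/funext => y; rewrite mxE mulrC.
by rewrite partialM /= 1?addrC// => y; exact: smooth_derivable.
Qed.

Let jump w l m phi x := dot (grad v m - grad v l) (w l x - w m x) * phi x.

Let swap_face l m f : l != m -> continuous f ->
  opp_face (alf v l) m f = opp_face (alf v m) l f.
Proof.
move=> lm cf; rewrite -(@opp_face_swap _ (alf v m) m l) 1?eq_sym//.
apply: opp_face_congr => j jm; rewrite /alf /=.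
have [->|jl] := eqVneq j l; first by rewrite tpermR eqxx.
by rewrite (_ : tperm m l j = j) ?(negbTE jm)// tpermD// eq_sym.
Qed.

(** The 4 comes from [grad (alf v l) l = 4 *: grad v l] on boundary faces. Each interior face is met
    from both sides with opposite normals, which produces the jump; the sum over ordered pairs
    counts it twice, hence the factor 1/2. *)
Lemma green_alfeld w phi : (forall l j, smooth (fun y => w l y j 0)) -> smooth phi ->
  \sum_l green_term w phi l =
  - (vol v / 4) * (\sum_l 4 * opp_face (alf v l) l (fun x => dot (grad v l) (w l x) * phi x)
    + 2^-1 * \sum_l \sum_(m | m != l) opp_face (alf v l) m (jump w l m phi)).
Proof.
move=> sw sp.
have sd (g : point3) l : continuous (fun x => dot g (w l x) * phi x).
  by apply/smooth_continuous/smoothM => //; exact: smooth_dot.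
have cj l m : continuous (jump w l m phi).
  rewrite /jump (_ : (fun x => _) = fun x => dot (grad v m - grad v l) (w l x) * phi x +
     dot (grad v l - grad v m) (w m x) * phi x); first by apply: contD; exact: sd.
  by apply/funext => x; rewrite dotBr -[grad v l - _]opprB dotNl; ring.
pose A l m := opp_face (alf v l) m (fun x => dot (grad v m - grad v l) (w l x) * phi x).
have E l : green_term w phi l = - (vol v / 4) *
    (4 * opp_face (alf v l) l (fun x => dot (grad v l) (w l x) * phi x) + \sum_(m | m != l) A l m).
  transitivity (integral3 (tetra (alf v l)) (vdiv (fun y => phi y *: w l y))).
    by congr integral3; apply/funext => x; rewrite vdivM.
  rewrite divergence_tetra ?(vol_alf iv l).2; last 2 first.
  - exact: indep_alf.
  - by move=> j; under eq_fun do rewrite mxE; exact: smoothM.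
  congr (_ * _); rewrite (bigD1 l)//=; congr (_ + _).
    rewrite -triZ//; apply: eq_tri => z _.
    by rewrite grad_alf// eqxx dotZr dotZl; ring.
  by apply: eq_bigr => m ml; apply: eq_tri => z _; rewrite grad_alf// (negbTE ml) dotZr mulrC.
rewrite (eq_bigr _ (fun l _ => E l)) -[LHS]mulr_sumr [in LHS]big_split /=; congr (_ * (_ + _)).
have S : \sum_l \sum_(m | m != l) A l m = \sum_l \sum_(m | m != l) A m l.
  under eq_bigr do rewrite big_mkcond; rewrite exchange_big /=; apply: eq_bigr => l _.
  by rewrite [RHS]big_mkcond; apply: eq_bigr => m _; rewrite eq_sym.
have JA l m : m != l -> opp_face (alf v l) m (jump w l m phi) = A l m + A m l.
  move=> ml; rewrite /A -[X in _ = _ + X]swap_face 1?eq_sym// -triD//; apply: eq_tri => z _.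
  by rewrite /jump dotBr -[grad v l - _]opprB dotNl; ring.
under [in RHS]eq_bigr do under eq_bigr do rewrite JA//.
under [in RHS]eq_bigr do rewrite big_split /=.
by rewrite big_split /= -S; field.
Qed.

(** Zero normal component on the boundary and continuous normal component across the interior faces:
    [grad v l] and [grad v m - grad v l] are normals to these faces. *)
Definition face_conditions w :=
  (forall l x, alfeld v l x -> bar v l x = 0 -> dot (grad v l) (w l x) = 0) /\
  (forall l m x, m != l -> alfeld v l x -> alfeld v m x ->
     dot (grad v m - grad v l) (w l x - w m x) = 0).

Lemma face_conditions_green w phi : (forall l j, smooth (fun y => w l y j 0)) -> smooth phi ->
  face_conditions w -> \sum_l green_term w phi l = 0.
Proof.
move=> sw sp [Fb Fi]; rewrite green_alfeld// !big1 ?mulr0 ?addr0 ?mulr0// => l _.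
  rewrite big1// => m ml; rewrite opp_face0//; first exact: indep_alf.
  move=> x Tx; rewrite bar_alf// (negbTE ml) => /subr0_eq E.
  rewrite /jump Fi ?mul0r//; have [H0 H] := (alfeldP iv _ _).1 Tx.
  by apply/alfeldP => //; rewrite E.
rewrite opp_face0 ?mulr0//; first exact: indep_alf.
move=> x Tx; rewrite bar_alf// eqxx => /eqP; rewrite mulf_eq0 pnatr_eq0 /= => /eqP E.
by rewrite Fb ?mul0r.
Qed.

Lemma sum_pair (F : 'I_4 -> 'I_4 -> R) l m : m != l ->
  (forall a b, b != a -> ~~ ((a == l) && (b == m) || (a == m) && (b == l)) -> F a b = 0) ->
  \sum_a \sum_(b | b != a) F a b = F l m + F m l.
Proof.
move=> ml Z; rewrite (bigD1 l)//= (bigD1 m)//= [X in _ + X + _]big1 ?addr0; last first.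
  by move=> b /andP[bl bm]; rewrite Z// eqxx (negbTE bm) /= (negbTE bl) andbF.
rewrite (bigD1 m)//= [X in _ + (_ + X)]big1 ?addr0; last first.
  move=> a /andP[al am]; rewrite big1// => b ba.
  by rewrite Z// (negbTE al) (negbTE am).
rewrite (bigD1 l) 1?eq_sym//= [X in _ + (_ + X)]big1 ?addr0// => b /andP[bm bl].
by rewrite Z// eqxx (negbTE bl) (negbTE ml).
Qed.

(** Take phi = J chi, where J is the normal component or jump on the chosen face and chi >= 0 is a
    product of [flat] functions, positive inside that face and zero on all the others. Only the
    integral of J^2 chi over the face is left, so J vanishes there. *)
Lemma green_face_conditions w : (forall l j, smooth (fun y => w l y j 0)) ->
  (forall phi, smooth phi -> \sum_l green_term w phi l = 0) ->
  (forall l x, bar v l x = 0 -> (forall j, j != l -> 0 < bar v j x) ->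
     dot (grad v l) (w l x) = 0) /\
  (forall l m x, m != l -> bar v m x = bar v l x -> 0 < bar v l x ->
     (forall j, j != l -> j != m -> bar v l x < bar v j x) ->
     dot (grad v m - grad v l) (w l x - w m x) = 0).
Proof.
move=> sw H; have vol0 : - (vol v / 4) != 0.
  by rewrite oppr_eq0 mulf_neq0// ?invr_eq0 ?pnatr_eq0// gt_eqF// vol_gt0.
have {}H phi : smooth phi -> \sum_l 4 * opp_face (alf v l) l (fun x => dot (grad v l) (w l x) * phi x)
    + 2^-1 * \sum_l \sum_(m | m != l) opp_face (alf v l) m (jump w l m phi) = 0.
  move=> sp; have := H _ sp; rewrite green_alfeld// => /eqP.
  by rewrite mulf_eq0 (negbTE vol0) /= => /eqP.
have sflat a b : smooth (fun x => flat 0 (bar v a x - bar v b x)).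
  rewrite (_ : (fun x => _) = fun x =>
    flat 0 (aff (grad v a - grad v b) (bar v a 0 - bar v b 0) x)); first exact: smooth_flat_aff.
  by apply/funext => x; rewrite barE [bar v b x]barE /aff dotBl; congr flat; ring.
have sflat1 a : smooth (fun x => flat 0 (bar v a x)).
  rewrite (_ : (fun x => _) = fun x => flat 0 (aff (grad v a) (bar v a 0) x)); first exact: smooth_flat_aff.
  by apply/funext => x; rewrite barE.
have flat0 t : t <= 0 -> flat 0 t = 0 :> R by exact: flat_le0.
split=> [l x xl xj|l m x ml xm xl xj].
(* Nonzero only where the coordinate [l] is strictly the smallest, hence zero on the interior faces
   and on the three other boundary faces. *)
- pose chi x := \prod_(a | a != l) flat 0 (bar v a x - bar v l x).
  have schi : smooth chi by apply: smooth_prod.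
  pose J x := dot (grad v l) (w l x).
  have sJ : smooth J by exact: smooth_dot.
  have chi0 y a : a != l -> bar v a y <= bar v l y -> chi y = 0.
    by move=> al ay; rewrite /chi (bigD1 a)//= flat0 ?mul0r// subr_le0.
  have := H _ (smoothM sJ schi); rewrite (bigD1 l)//= [X in _ + X + _]big1; last first.
    move=> a al; rewrite opp_face0 ?mulr0//; first exact: indep_alf.
    move=> y Ty _; have [_ /(_ l) Ha] := (alfeldP iv _ _).1 Ty.
    by rewrite (chi0 y a)// !mulr0.
  rewrite addr0 [X in _ + _ * X]big1 ?mulr0 ?addr0; last first.
    move=> a _; rewrite big1// => b ba; rewrite opp_face0//; first exact: indep_alf.
    move=> y Ty; rewrite bar_alf// (negbTE ba) => /subr0_eq E.
    have [_ Ha] := (alfeldP iv _ _).1 Ty; rewrite /jump.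
    have [al|al] := eqVneq a l; last by rewrite (chi0 y a)// !mulr0.
    by rewrite (chi0 y b) ?mulr0// -?al// E.
  move=> /eqP; rewrite mulf_eq0 pnatr_eq0 /= => /eqP H0.
  have /eqP : J x * (J x * chi x) = 0.
    apply: (@opp_face_eq0 _ (alf v l) l (fun x => J x * (J x * chi x))) => //.
    + exact: indep_alf.
    + by apply/smooth_continuous; do !apply: smoothM.
    + move=> y; rewrite mulrA -expr2 mulr_ge0 ?sqr_ge0//.
      by apply: prodr_ge0 => a _; exact: flat_ge0.
    + by rewrite bar_alf// eqxx xl mulr0.
    + by move=> j jl; rewrite bar_alf// (negbTE jl) xl subr0 xj.
  rewrite mulrA mulf_eq0 mulf_eq0 orbb => /orP[/eqP//|].
  by rewrite gt_eqF// prodr_gt0// => a al; apply: flat0_gt0; rewrite xl subr0 xj.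
(* The first two factors remove the boundary faces of the pieces [l] and [m], the product removes
   every face that involves another piece. *)
- pose chi x := flat 0 (bar v l x) * flat 0 (bar v m x) *
    \prod_(a | (a != l) && (a != m)) flat 0 (bar v a x - bar v l x).
  have schi : smooth chi by do !apply: smoothM => //; apply: smooth_prod.
  pose J x := dot (grad v m - grad v l) (w l x - w m x).
  have sJ : smooth J.
    rewrite (_ : J = fun x => dot (grad v m - grad v l) (w l x) + dot (grad v l - grad v m) (w m x)).
      by apply: smoothD; exact: smooth_dot.
    by apply/funext => y; rewrite /J dotBr -[grad v l - _]opprB dotNl.
  have chi0 y a : a != l -> a != m -> bar v a y <= bar v l y -> chi y = 0.
    by move=> al am ay; rewrite /chi (bigD1 a) ?al//= [flat 0 (bar v a y - _)]flat0 ?mul0r ?mulr0// subr_le0.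
  have := H _ (smoothM sJ schi); rewrite [X in X + _]big1; last first.
    move=> a _; rewrite opp_face0 ?mulr0//; first exact: indep_alf.
    move=> y Ty; rewrite bar_alf// eqxx => /eqP; rewrite mulf_eq0 pnatr_eq0 /= => /eqP E.
    have [_ Ha] := (alfeldP iv _ _).1 Ty; have [El|al] := eqVneq a l.
      by rewrite /chi -El E flat0// !(mul0r, mulr0).
    have [Em|am] := eqVneq a m; last by rewrite (chi0 y a)// !mulr0.
    by rewrite /chi -Em E (flat0 0)// !(mul0r, mulr0).
  rewrite add0r => /eqP; rewrite mulf_eq0 invr_eq0 pnatr_eq0 /= => /eqP.
  have Z a b : b != a -> ~~ ((a == l) && (b == m) || (a == m) && (b == l)) ->
      opp_face (alf v a) b (jump w a b (fun x => J x * chi x)) = 0.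
    move=> ba ab; rewrite opp_face0//; first exact: indep_alf.
    move=> y Ty; rewrite bar_alf// (negbTE ba) => /subr0_eq E.
    have [_ Ha] := (alfeldP iv _ _).1 Ty; rewrite /jump.
    have [/andP[al am]|alm] := boolP ((a != l) && (a != m)); first by rewrite (chi0 y a)// !mulr0.
    have [bl bm] : b != l /\ b != m.
      move: ab alm; rewrite negb_and !negbK; have [al|al] := eqVneq a l.
        by rewrite -al (negbTE ba) (_ : (a == m) = false) ?andbF//= ?orbF//; rewrite al eq_sym (negbTE ml).
      by move=> + /= am; rewrite am /= -(eqP am) ba => ->.
    by rewrite (chi0 y b) ?mulr0// E.
  rewrite (sum_pair ml Z) => {Z}.
  have cf : continuous (fun x => J x * (J x * chi x)).
    exact: smooth_continuous (smoothM sJ (smoothM sJ schi)).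
  rewrite [X in _ + X](_ : _ = opp_face (alf v l) m (jump w l m (fun x => J x * chi x))); last first.
    rewrite [RHS]swap_face 1?eq_sym//; apply: eq_tri => z _; rewrite /jump.
    by rewrite -[grad v l - _]opprB -[w m _ - _]opprB dotNl dotNr opprK.
  move=> /eqP; rewrite -mulr2n mulrn_eq0 /= => /eqP H0.
  have /eqP : J x * (J x * chi x) = 0.
    apply: (@opp_face_eq0 _ (alf v l) m (fun x => J x * (J x * chi x))) => //.
    + exact: indep_alf.
    + move=> y; rewrite mulrA -expr2 mulr_ge0 ?sqr_ge0//.
      by rewrite !mulr_ge0 ?flat_ge0// prodr_ge0// => a _; exact: flat_ge0.
    + by rewrite bar_alf// (negbTE ml) xm subrr.
    + move=> j jm; rewrite bar_alf//; case: eqP => [_|/eqP jl]; first by rewrite mulr_gt0.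
      by rewrite subr_gt0 xj.
  rewrite mulrA mulf_eq0 mulf_eq0 orbb => /orP[/eqP//|].
  rewrite gt_eqF// !mulr_gt0// ?flat0_gt0// ?xm//; apply: prodr_gt0 => a /andP[al am].
  by apply: flat0_gt0; rewrite subr_gt0 xj.
Qed.
End PiecewiseGreen.

(** * Piecewise smooth fields and their weak divergence *)

Section Representation.
Context {R : realType}.
Notation point3 := 'cV[R]_3.
Notation R3 := (measurableTypeR R * measurableTypeR R * measurableTypeR R)%type.
Variable v : 'I_4 -> point3.
Hypothesis iv : indep v.
Notation T3 := ((@pt3 R) @^-1` tetra v).

(** The pieces [Z l] are functions on the whole space, so that they can be smooth and two of them
    can be compared on a common face, while [u] is only known almost everywhere. *)
Definition rep (V : Type) (u : point3 -> V) (Z : 'I_4 -> point3 -> V) : Prop :=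
  forall l, ae_on (alfeld v l) (fun x => u x = Z l x).

Lemma aeS (P Q : R3 -> Prop) : (forall z, P z -> Q z) ->
  {ae leb3, forall z, P z} -> {ae leb3, forall z, Q z}.
Proof. by move=> PQ; apply: negligibleS => z /= nQ /PQ. Qed.

Lemma aeS2 (P Q S : R3 -> Prop) : (forall z, P z -> Q z -> S z) ->
  {ae leb3, forall z, P z} -> {ae leb3, forall z, Q z} -> {ae leb3, forall z, S z}.
Proof.
move=> PQ nP nQ; apply: negligibleS (negligibleU nP nQ) => z /= nS.
by have [Pz|] := pselect (P z); [right => Qz; apply/nS/PQ|left].
Qed.

Lemma ae_onW (D : set point3) (P Q : point3 -> Prop) : (forall x, D x -> P x -> Q x) ->
  ae_on D P -> ae_on D Q.
Proof. by move=> PQ; apply: aeS => z H Dz; apply: PQ => //; exact: H. Qed.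

Lemma rep_glue (V : lmodType R) (Z : 'I_4 -> point3 -> V) : rep (glue v Z) Z.
Proof. by move=> l; apply: ae_onW (ae_first_min iv l) => x _; exact: glueE. Qed.

Lemma ae_alfeld (P : point3 -> Prop) : (forall l, ae_on (alfeld v l) P) -> ae_on (tetra v) P.
Proof.
move=> H; have : {ae leb3, forall z : R3, forall l, alfeld v l (pt3 z) -> P (pt3 z)}.
  by apply: filter_forall => l; exact: H.
apply: filterS => z {}H Tz; have [l Hl] := first_min_ex v (pt3 z).
by apply: (H l); exact: first_min_alfeld Tz Hl.
Qed.

Lemma integral_rep (f : point3 -> R) F :
  leb3.-integrable T3 (EFin \o (f \o (@pt3 R))) -> (forall l, continuous (F l)) ->
  rep f F -> integral3 (tetra v) f = \sum_l integral3 (alfeld v l) (F l).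
Proof.
move=> ig cF fF; rewrite integral_alfeld//; apply: eq_bigr => l _.
have mA : measurable ((@pt3 R) @^-1` alfeld v l : set R3).
  exact: measurable_tetra (indep_alf iv l).
congr fine; apply: ae_eq_integral => //.
- apply: measurable_int; apply: integrableS ig => //; first exact: measurable_tetra.
  by move=> z; exact: alfeld_sub.
- exact: measurable_int (integrable_tetra (indep_alf iv l) (cF l)).
- by apply: negligibleS (fF l) => z /= N H; apply: N => Tz; rewrite H.
Qed.

Let measurable_first_min l : measurable_fun setT (fun z : R3 => (first_min v l (pt3 z))%:R : R).
Proof.
have m1 a b : measurable [set z : R3 | bar v a (pt3 z) <= bar v b (pt3 z)].
  rewrite (_ : [set z | _] = [set z : R3 | 0 <= bar v b (pt3 z) - bar v a (pt3 z)]); last first.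
    by apply/funext => z /=; rewrite subr_ge0.
  apply: (@measurable_ge0 R _ _ (fun z : R3 => bar v b (pt3 z) - bar v a (pt3 z))).
  apply: (@measurable_continuous3 R (fun x => bar v b x - bar v a x)).
  by apply: contB; exact: continuous_bar.
pose A := \bigcap_(j in [set: 'I_4]) ([set z : R3 | bar v l (pt3 z) <= bar v j (pt3 z)] `&`
   (if (j < l)%N then ~` [set z : R3 | bar v j (pt3 z) <= bar v l (pt3 z)] else setT)).
have mA : measurable A.
  apply: fin_bigcap_measurable => // j _; apply: measurableI => //.
  by case: ifP => // _; exact: measurableC.
rewrite (_ : (fun z => _) = \1_A); first exact: measurable_indic.
apply/funext => z; rewrite indicE; congr (nat_of_bool _)%:R.
apply/forallP/idP => [H|/set_mem H].
  apply/mem_set => j _; have /andP[H1 /implyP H2] := H j; split => //.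
  by case: ifP => // /H2; rewrite ltNge => /negP.
move=> j; have [-> /= ] := H j I; case: ifP => //= _ /negP.
by rewrite -ltNge.
Qed.

Lemma L2_glue m n (X : set 'M[R]_(m, n)) (Z : 'I_4 -> point3 -> 'M[R]_(m, n)) :
  (forall l x, X (Z l x)) -> (forall l i j, continuous (fun x => Z l x i j)) ->
  L2 (tetra v) X (glue v Z).
Proof.
move=> XZ cZ; split=> [x _|i j].
  by have [l Hl] := first_min_ex v x; rewrite (glueE _ Hl).
have cF : continuous (fun x => \sum_l `|Z l x i j|).
  apply: cont_sum => l _; exact: (cont_comp (cZ l i j) (@norm_continuous _ R^o)).
have [M HM] := bounded_tetra v cF.
apply: (bounded_Lfun2 iv (M := M)).
  rewrite (_ : (fun z => _) = fun z : R3 => \sum_l (first_min v l (pt3 z))%:R * Z l (pt3 z) i j).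
    apply: measurable_sum => l; apply: measurable_funM; first exact: measurable_first_min.
    exact: (measurable_continuous3 (cZ l i j)).
  by apply/funext => z; rewrite /glue summxE; apply: eq_bigr => l _; rewrite mxE.
move=> z Tz; apply: le_trans (le_trans (ler_norm _) (HM _ Tz)).
have [l Hl] := first_min_ex v (pt3 z); rewrite (glueE _ Hl) (bigD1 l)//= lerDl.
exact: sumr_ge0.
Qed.

(** The product of [h] and [chi], extended by 0, is orthogonal to every smooth function. The weight
    allows conclusions from tests that all vanish outside a region of interest. *)
Lemma ae0_weighted (h chi : point3 -> R) : smooth chi ->
  (forall f, continuous f -> leb3.-integrable T3 (EFin \o (fun z => h (pt3 z) * f (pt3 z)))) ->
  (forall psi, smooth psi -> integral3 (tetra v) (fun x => h x * (chi x * psi x)) = 0) ->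
  ae_on (tetra v) (fun x => chi x != 0 -> h x = 0).
Proof.
move=> sc ih H; have mT := measurable_tetra iv.
pose f (z : R3) := h (pt3 z) * chi (pt3 z).
have ifT : leb3.-integrable setT (EFin \o (f \_ T3)).
  rewrite (_ : _ \o _ = (EFin \o f) \_ T3); last first.
    by apply/funext => z /=; rewrite !patchE; case: ifP.
  by apply/(integrable_mkcond _ mT); exact: ih (smooth_continuous sc).
have : {ae leb3, forall z, (f \_ T3) z = 0}.
  apply: ae0_smooth_orthogonal => // psi spsi _.
  rewrite -[RHS](H _ spsi) /integral3 [RHS]Rintegral_mkcond; congr Rintegral.
  apply/funext => z; rewrite !patchE /f /=; case: ifP => _; last by rewrite mul0r.
  by rewrite mulrA.
apply: aeS => z; rewrite patchE => + Tz; rewrite mem_set// /f => /eqP.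
by rewrite mulf_eq0 => /orP[/eqP//|/eqP ->]; rewrite eqxx.
Qed.

Lemma ae_interior : ae_on (tetra v) (fun x => forall j, 0 < bar v j x).
Proof.
have : {ae leb3, forall z : R3, forall j, bar v j (pt3 z) <> 0}.
  apply: filter_forall => j; have := null_bar j iv.
  by apply: negligibleS => z /= /contrapT.
apply: filterS => z N /(tetraP _ iv) H j.
by rewrite lt_def H andbT; apply/eqP; exact: N.
Qed.

(* Compactly supported in the interior of T; at each interior point, positive for n large. *)
Let cutoff n (x : point3) : R := \prod_j flat 0 (n.+1%:R * bar v j x - 1).

Let smooth_cutoff n : smooth (cutoff n).
Proof.
apply: smooth_prod => j _.
rewrite (_ : (fun x => _) = fun x =>
  flat 0 (aff (n.+1%:R *: grad v j) (n.+1%:R * bar v j 0 - 1) x)); first exact: smooth_flat_aff.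
by apply/funext => x; rewrite barE /aff dotZl; congr flat; ring.
Qed.

Let test_cutoff n psi : smooth psi -> test_function (tetra v) (fun x => cutoff n x * psi x).
Proof.
move=> sp; pose K := \bigcap_(j in [set: 'I_4]) [set x | n.+1%:R^-1 <= bar v j x].
have cK : closed K.
  apply: closed_bigI => j _; apply: (@preimage_closed _ _ (bar v j) [set t | n.+1%:R^-1 <= t]).
    by move=> x _; exact: continuous_bar.
  exact: closed_ge.
have sK : closure [set x | cutoff n x * psi x != 0] `<=` K.
  rewrite [X in _ `<=` X](iffLR (closure_id _) cK); apply: closure_subset => x /=.
  rewrite mulf_eq0 negb_or => /andP[/prodf_neq0 H _] j _ /=; have := H j isT.
  have [h|h _] := leP (n.+1%:R * bar v j x - 1) 0; first by rewrite flat_le0// eqxx.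
  by rewrite -[leLHS]mul1r ler_pdivrMr ?ltr0n// mulrC -subr_ge0 ltW.
have K0 x : K x -> forall j, 0 < bar v j x.
  by move=> Kx j; apply: lt_le_trans (Kx j I); rewrite invr_gt0 ltr0n.
split; first exact: smoothM.
- pose C := [set par v z | z in (`[0, 1] `*` `[0, 1] `*` `[0, 1])%classic : set (R * R * R)].
  have cC : compact C.
    apply: continuous_compact; first exact/continuous_subspaceT/continuous_par.
    by apply: compact_setX; [apply: compact_setX|]; exact: segment_compact.
  apply: subclosed_compact cC _; first exact: closed_closure.
  move=> x /sK Kx; have /(tetra_parP _ _)[z [z0 z1 z2 z3] ->] : tetra v x.
    by apply/tetraP => // j; exact/ltW/K0.
  exists z => //; split; first split; rewrite /= in_itv /=.
  + by rewrite z0 /=; lra.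
  + by rewrite z1 /=; lra.
  + by rewrite z2 /=; lra.
- move=> x /sK /K0 x0; have := near_bar_gt0 x0; rewrite /interior; apply: filterS => y y0.
  by apply/tetraP => // j; exact: ltW.
Qed.

(** The fundamental lemma of the calculus of variations: weighting by [cutoff n] produces test
    functions, and each interior point has a nonzero weight for some n. *)
Lemma ae0_test (h : point3 -> R) :
  (forall f, continuous f -> leb3.-integrable T3 (EFin \o (fun z => h (pt3 z) * f (pt3 z)))) ->
  (forall phi, test_function (tetra v) phi -> integral3 (tetra v) (fun x => h x * phi x) = 0) ->
  ae_on (tetra v) (fun x => h x = 0).
Proof.
move=> ih H.
have : {ae leb3, forall z : R3, forall n, tetra v (pt3 z) -> cutoff n (pt3 z) != 0 -> h (pt3 z) = 0}.
  apply: ae_foralln => n; apply: ae0_weighted => // psi spsi.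
  by apply: H; exact: test_cutoff.
have := ae_interior; apply: aeS2 => z Hz {}H Tz.
have {}Hz := Hz Tz; pose e := \big[Num.min/1]_j bar v j (pt3 z).
have e0 : 0 < e by apply: lt_bigmin => [|j _]; [exact: ltr01|exact: Hz].
have [n Hn] : exists n : nat, e^-1 < n.+1%:R.
  by exists (Num.truncn e^-1); rewrite truncnS_gt.
apply: (H n Tz); apply/prodf_neq0 => j _; rewrite gt_eqF//; apply: flat0_gt0.
rewrite subr_gt0; apply: (@lt_le_trans _ _ (n.+1%:R * e)).
  by rewrite -ltr_pdivrMr// mul1r.
by rewrite ler_wpM2l// /e (bigD1 j)//= ge_min lexx.
Qed.
End Representation.

(** * Face conditions versus the weak definition of bubbles *)

Section Bubble.
Context {R : realType}.
Notation point3 := 'cV[R]_3.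
Notation R3 := (measurableTypeR R * measurableTypeR R * measurableTypeR R)%type.
Variable v : 'I_4 -> point3.
Hypothesis iv : indep v.
Notation T3 := ((@pt3 R) @^-1` tetra v).
Implicit Types (W : 'I_4 -> point3 -> 'M[R]_3) (tau : point3 -> 'M[R]_3) (g : point3 -> point3).

Definition pdiv (W : point3 -> 'M[R]_3) : point3 -> point3 :=
  fun x => \col_i \sum_j partial j (fun y => W y i j) x.

Definition mrow W (i : 'I_3) (l : 'I_4) (x : point3) : point3 := \col_j W l x i j.

Lemma vdiv_mrow W i l x : vdiv (mrow W i l) x = pdiv (W l) x i 0.
Proof.
rewrite mxE; apply: eq_bigr => j _; congr (partial j _ x).
by apply/funext => y; rewrite mxE.
Qed.

Section Trace.
Variables (X : set 'M[R]_3) (tau : point3 -> 'M[R]_3) (W : 'I_4 -> point3 -> 'M[R]_3).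
Hypothesis tau2 : L2 (tetra v) X tau.
Hypothesis tauW : rep v tau W.
Hypothesis sW : forall l i j, smooth (fun x => W l x i j).

Let srow i l j : smooth (fun y => mrow W i l y j 0).
Proof. by rewrite /mrow; under eq_fun do rewrite mxE; exact: sW. Qed.

Lemma smooth_pdiv l i : smooth (fun x => pdiv (W l) x i 0).
Proof.
rewrite /pdiv; under eq_fun do rewrite mxE.
by apply: smooth_sum => j _; exact: smooth_partial.
Qed.

Lemma integrable_trace i phi : smooth phi ->
  leb3.-integrable T3 (EFin \o ((fun x => \sum_j tau x i j * partial j phi x) \o (@pt3 R))).
Proof.
move=> sp; rewrite (_ : _ \o _ = fun z => (\sum_j (tau (pt3 z) i j * partial j phi (pt3 z))%:E)%E); last first.
  by apply/funext => z; rewrite /= sumEFin.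
apply: integrable_sum => // [|j _]; first exact: measurable_tetra.
by apply: (integrable_L2_cont iv i j tau2); exact/smooth_continuous/smooth_partial.
Qed.

Lemma trace_rep i phi : smooth phi ->
  integral3 (tetra v) (fun x => \sum_j tau x i j * partial j phi x) =
  \sum_l green_term v (mrow W i) phi l
  - \sum_l integral3 (alfeld v l) (fun x => pdiv (W l) x i 0 * phi x).
Proof.
move=> sp; have cW l : continuous (fun x => \sum_j W l x i j * partial j phi x).
  apply/smooth_continuous/smooth_sum => j _; apply: smoothM => //; exact: smooth_partial.
have cD l : continuous (fun x => pdiv (W l) x i 0 * phi x).
  by apply/smooth_continuous/smoothM => //; exact: smooth_pdiv.
rewrite (integral_rep iv (integrable_trace i sp) cW); last first.
  by move=> l; apply: ae_onW (tauW l) => x _ ->.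
apply/eqP; rewrite eq_sym subr_eq -big_split /=; apply/eqP; apply: eq_bigr => l _.
rewrite -int3D//; last exact: (indep_alf iv l).
rewrite /green_term; congr integral3; apply/funext => x; rewrite vdiv_mrow addrC; congr (_ + _).
by apply: eq_bigr => j _; rewrite mxE.
Qed.

Lemma green_term0 (w : 'I_4 -> point3 -> point3) (phi : point3 -> R) l : (forall k j, smooth (fun y => w k y j 0)) -> smooth phi ->
  (forall x a, alfeld v l x -> bar (alf v l) a x = 0 -> phi x = 0) ->
  green_term v w phi l = 0.
Proof.
move=> sw sp H.
transitivity (integral3 (tetra (alf v l)) (vdiv (fun y => phi y *: w l y))).
  by congr integral3; apply/funext => x; rewrite vdivM.
rewrite divergence_tetra; last 2 first.
- exact: indep_alf.
- by move=> j; under eq_fun do rewrite mxE; exact: smoothM.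
rewrite big1 ?mulr0// => a _; apply: opp_face0; first exact: indep_alf.
by move=> x Tx ax; rewrite (H x a)// scale0r dot0r.
Qed.

Lemma integrable_vec g i (f : point3 -> R) : L2_vec (tetra v) g -> continuous f ->
  leb3.-integrable T3 (EFin \o (fun z => g (pt3 z) i 0 * f (pt3 z))).
Proof. by move=> g2; exact: (integrable_L2_cont iv i 0 g2). Qed.

Lemma integral_vec g (Z : 'I_4 -> point3 -> point3) i phi : L2_vec (tetra v) g -> rep v g Z ->
  (forall l, continuous (fun x => Z l x i 0)) -> continuous phi ->
  integral3 (tetra v) (fun x => g x i 0 * phi x) =
  \sum_l integral3 (alfeld v l) (fun x => Z l x i 0 * phi x).
Proof.
move=> g2 gZ cZ cp.
apply: (integral_rep iv (f := fun x => g x i 0 * phi x)) => [|l|l].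
- exact: integrable_vec.
- exact: contM.
- by apply: ae_onW (gZ l) => x _ ->.
Qed.

Lemma integral_vecB g g' i phi : L2_vec (tetra v) g -> L2_vec (tetra v) g' -> continuous phi ->
  integral3 (tetra v) (fun x => (g x i 0 - g' x i 0) * phi x) =
  integral3 (tetra v) (fun x => g x i 0 * phi x) - integral3 (tetra v) (fun x => g' x i 0 * phi x).
Proof.
move=> g2 g2' cp; rewrite /integral3 -RintegralB; last 3 first.
- exact: measurable_tetra.
- exact: integrable_vec.
- exact: integrable_vec.
by congr Rintegral; apply/funext => z /=; rewrite mulrBl.
Qed.

Lemma integrable_vecB g g' i (f : point3 -> R) : L2_vec (tetra v) g -> L2_vec (tetra v) g' ->
  continuous f ->
  leb3.-integrable T3 (EFin \o (fun z => (g (pt3 z) i 0 - g' (pt3 z) i 0) * f (pt3 z))).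
Proof.
move=> g2 g2' cf; pose a (u : point3 -> point3) (z : R3) : R := u (pt3 z) i 0 * f (pt3 z).
rewrite (_ : _ \o _ = ((EFin \o a g) \- (EFin \o a g'))%E); last first.
  by apply/funext => z /=; rewrite /a mulrBl EFinB.
by apply: integrableB; [exact: measurable_tetra|exact: integrable_vec|exact: integrable_vec].
Qed.

Lemma L2_pdiv : L2_vec (tetra v) (glue v (fun l => pdiv (W l))).
Proof.
apply: L2_glue => // l i j; rewrite ord1; exact/smooth_continuous/smooth_pdiv.
Qed.

(** Without face terms, Green's formula holds for all smooth functions, so [g] is a weak divergence
    with zero normal trace. Since [Hdiv0] quantifies over all weak divergences, their uniqueness
    almost everywhere is also needed. *)
Lemma bubble_intro g : L2_vec (tetra v) g -> rep v g (fun l => pdiv (W l)) ->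
  (forall i, face_conditions v (mrow W i)) ->
  is_div (tetra v) tau g /\ Hdiv0 (tetra v) X tau.
Proof.
move=> g2 gW F.
have E phi i : smooth phi -> integral3 (tetra v) (fun x => \sum_j tau x i j * partial j phi x)
    = - integral3 (tetra v) (fun x => g x i 0 * phi x).
  move=> sp; rewrite trace_rep// face_conditions_green// sub0r; congr (- _).
  rewrite (integral_vec g2 gW)//; last exact: smooth_continuous.
  by move=> l; exact/smooth_continuous/smooth_pdiv.
have dg : is_div (tetra v) tau g by split => // phi [sp _ _] i; exact: E.
split => //; split; first by split => //; exists g.
move=> g' [g2' dg'] i phi sp; rewrite /normal_trace E// addrC.
rewrite -integral_vecB//; last exact: smooth_continuous.
have H : ae_on (tetra v) (fun x => g' x i 0 - g x i 0 = 0).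
  apply: (ae0_test iv (h := fun x => g' x i 0 - g x i 0)) => [f cf|psi tpsi].
    exact: integrable_vecB.
  have [spsi _ _] := tpsi.
  rewrite integral_vecB//; last exact: smooth_continuous.
  by have := dg' _ tpsi i; rewrite E// => /oppr_inj ->; rewrite subrr.
rewrite (integral_rep iv (F := fun _ _ => 0)) ?big1//.
- by move=> l _; exact: int3_0.
- by apply: integrable_vecB => //; exact: smooth_continuous.
- by move=> l; exact: contC.
- move=> l; apply: aeS H => z H Tz.
  by rewrite H ?mul0r//; exact: alfeld_sub Tz.
Qed.

(** Tests weighted by a function that is positive inside one piece and zero on its faces and on the
    other pieces kill all face terms and identify [g] on that piece. The volume terms then cancel
    for every smooth phi, and only the face terms remain. *)
Lemma bubble_elim g : Hdiv0 (tetra v) X tau -> is_div (tetra v) tau g ->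
  rep v g (fun l => pdiv (W l)) /\
  forall i phi, smooth phi -> \sum_l green_term v (mrow W i) phi l = 0.
Proof.
move=> [_ H] dg; have [g2 _] := dg; have L2D := L2_pdiv.
have repD := rep_glue iv (fun l => pdiv (W l)).
pose D := glue v (fun l => pdiv (W l)).
have cp l i : continuous (fun x => pdiv (W l) x i 0) by exact/smooth_continuous/smooth_pdiv.
have E i phi : smooth phi -> \sum_l green_term v (mrow W i) phi l +
    integral3 (tetra v) (fun x => (g x i 0 - D x i 0) * phi x) = 0.
  move=> sp; rewrite -[RHS](H g dg i phi sp) /normal_trace trace_rep//.
  rewrite integral_vecB//; last exact: smooth_continuous.
  rewrite (integral_vec L2D repD)//; last exact: smooth_continuous.
  by rewrite -addrA; congr (_ + _); rewrite addrC.
have G : rep v g (fun l => pdiv (W l)).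
  move=> l; pose chi x := \prod_j flat 0 (bar (alf v l) j x).
  have schi : smooth chi.
    apply: smooth_prod => j _; rewrite (_ : (fun x => _) = fun x =>
      flat 0 (aff (grad (alf v l) j) (bar (alf v l) j 0) x)); first exact: smooth_flat_aff.
    by apply/funext => x; rewrite barE.
  have Z i : ae_on (tetra v) (fun x => chi x != 0 -> g x i 0 - D x i 0 = 0).
    apply: (ae0_weighted iv (h := fun x => g x i 0 - D x i 0)) => // [f cf|psi spsi].
      exact: integrable_vecB.
    have := E i _ (smoothM schi spsi); rewrite big1 ?add0r// => m _.
    apply: green_term0 => // [|x a Tx ax]; first exact: smoothM.
    rewrite /chi; have [ml|ml] := eqVneq m l.
      by move: ax; rewrite ml => ax; rewrite (bigD1 a)//= ax flat_le0// !mul0r.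
    rewrite (bigD1 m)//= bar_alf// (negbTE ml) flat_le0 ?mul0r// subr_le0.
    by have [_ ->] := (alfeldP iv _ _).1 Tx.
  have {}Z : {ae leb3, forall z : R3, forall i, tetra v (pt3 z) -> chi (pt3 z) != 0 ->
      g (pt3 z) i 0 - D (pt3 z) i 0 = 0}.
    by apply: filter_forall => i; exact: Z.
  move: (aeS2 (fun z => @conj _ _) Z (ae_interior (indep_alf iv l))) (repD l).
  apply: aeS2 => z [{}Z Zi] zD Tz.
  apply/colP => i; apply/subr0_eq; rewrite -(zD Tz).
  apply: Z; first exact: alfeld_sub Tz.
  apply/prodf_neq0 => j _; rewrite gt_eqF//; apply: flat0_gt0; exact: Zi.
split=> // i phi sp; have := E i _ sp.
rewrite (integral_rep iv (F := fun _ _ => 0)).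
- by rewrite [X in _ + X]big1 ?addr0// => l _; exact: int3_0.
- by apply: integrable_vecB => //; exact: smooth_continuous.
- by move=> l; exact: contC.
- move=> l; move: (G l) (repD l); apply: aeS2 => z Gz Dz Tz.
  by rewrite Gz// -Dz// subrr mul0r.
Qed.
End Trace.
End Bubble.

(** * Piecewise polynomials in the Bernstein basis *)

Section PolynomialFunctions.
Context {R : realType}.
Notation point3 := 'cV[R]_3.

(* [pf k f]: f is a polynomial function of total degree at most k. *)
Inductive pf : nat -> (point3 -> R) -> Prop :=
| pf_cst k a : pf k (fun _ => a)
| pf_aff k b a f : pf k f -> pf k.+1 (fun x => aff b a x * f x)
| pf_add k f g : pf k f -> pf k g -> pf k (fun x => f x + g x).

Lemma pf_ext k f g : f =1 g -> pf k f -> pf k g.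
Proof. by move=> /funext ->. Qed.

Lemma pfS k f : pf k f -> pf k.+1 f.
Proof.
move=> pff; apply: pf_ext (pf_aff 0 1 pff) => x.
by rewrite /aff dot0l add0r mul1r.
Qed.

Lemma pfW k l f : (k <= l)%N -> pf k f -> pf l f.
Proof.
move=> kl pff; rewrite -(subnK kl); elim: (l - k)%N => // n IH; exact: pfS.
Qed.

Lemma pfZ k a f : pf k f -> pf k (fun x => a * f x).
Proof.
elim=> {k f} [k c|k b c f _ IH|k f g _ IHf _ IHg]; first exact: pf_cst.
  by apply: pf_ext (pf_aff b c IH) => x; rewrite mulrCA.
by apply: pf_ext (pf_add IHf IHg) => x; rewrite mulrDr.
Qed.

Lemma pf_sum k (I : Type) (s : seq I) (P : pred I) (F : I -> point3 -> R) :
  (forall i, P i -> pf k (F i)) -> pf k (fun x => \sum_(i <- s | P i) F i x).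
Proof.
move=> pF; elim: s => [|i s IH].
  by under eq_fun do rewrite big_nil; exact: pf_cst.
under eq_fun do rewrite big_cons; have := pF i; case: (P i) => // pFi.
by apply: pf_add => //; exact: pFi.
Qed.

Lemma pfM k l f g : pf k f -> pf l g -> pf (k + l) (fun x => f x * g x).
Proof.
move=> + pg; elim=> {k f} [k c|k b c f _ IH|k f h _ IHf _ IHh].
- by apply: pfW (pfZ c pg); exact: leq_addl.
- by apply: pf_ext (pf_aff b c IH) => x; rewrite mulrA.
- by apply: pf_ext (pf_add IHf IHh) => x; rewrite mulrDl.
Qed.

Lemma pf_affine b a : pf 1 (aff b a).
Proof. by apply: pf_ext (pf_aff b a (pf_cst 0 1)) => x; rewrite mulr1. Qed.

Lemma pf_exp k f n : pf k f -> pf (k * n) (fun x => f x ^+ n).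
Proof.
move=> pff; elim: n => [|n IH]; first by rewrite muln0; exact: pf_cst.
by rewrite mulnS; apply: pf_ext (pfM pff IH) => x; rewrite exprS.
Qed.

Lemma pf_prod (I : Type) (s : seq I) (P : pred I) (d : I -> nat) (F : I -> point3 -> R) :
  (forall i, P i -> pf (d i) (F i)) ->
  pf (\sum_(i <- s | P i) d i) (fun x => \prod_(i <- s | P i) F i x).
Proof.
move=> pF; elim: s => [|i s IH].
  by rewrite big_nil; under eq_fun do rewrite big_nil; exact: pf_cst.
have E : (fun x => \prod_(j <- i :: s | P j) F j x) =
    fun x => if P i then F i x * \prod_(j <- s | P j) F j x else \prod_(j <- s | P j) F j x.
  by apply/funext => x; rewrite big_cons.
by rewrite E big_cons; have := pF i; case: (P i) => // pFi; apply: pfM => //; exact: pFi.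
Qed.

Lemma pf_smooth k f : pf k f -> smooth f.
Proof.
elim=> {k f} [k c|k b c f _ IH|k f g _ IHf _ IHg].
- exact: smooth_cst.
- by apply: smoothM => //; exact: smooth_aff.
- exact: smoothD.
Qed.

Lemma pf_partial k f j : pf k f -> pf k.-1 (partial j f).
Proof.
(* The induction needs the first component because [k.-1] truncates at 0: in the product rule the
   term [aff b c] times the derivative of a constant has degree 0 only because that derivative
   vanishes. *)
move=> pff; have [] : (k = 0%N -> partial j f = fun _ => 0) /\ pf k.-1 (partial j f); last by [].
elim: pff => {k f} [k c|k b c f pff [IH0 IH]|k f g pff [IHf0 IHf] pfg [IHg0 IHg]].
- by rewrite partial_cst; split => //; exact: pf_cst.
- split=> //; rewrite partialM => [|x|x]; last 2 first.
  + exact/smooth_derivable/smooth_aff.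
  + exact/smooth_derivable/(pf_smooth pff).
  rewrite partial_aff; apply: pf_add; last exact: pfZ.
  by case: k pff IH0 IH => [|k] _ IH0 IH; [rewrite IH0//; apply: pf_ext (pf_cst 0 0) => x; rewrite mulr0|exact: pf_aff].
- rewrite partialD => [|x|x]; last 2 first.
  + exact/smooth_derivable/(pf_smooth pff).
  + exact/smooth_derivable/(pf_smooth pfg).
  split=> [k0|]; last exact: pf_add.
  by rewrite IHf0// IHg0// addr0.
Qed.

Lemma mpoly_pf k (p : mpoly.mpoly 3 R) : poly_deg_le k p ->
  pf k (fun x => mpoly.meval (fun s => x s 0) p).
Proof.
rewrite /poly_deg_le => pk; under eq_fun do rewrite mevalE.
rewrite (_ : (fun x => _) = fun x : point3 => \sum_(m <- msupp p | m \in msupp p)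
   mcoeff m p * \prod_i x i 0 ^+ m i); last by apply/funext => x; rewrite big_seq.
apply: pf_sum => m mp; apply: pfZ.
apply: (@pfW (mdeg m)); first by rewrite -ltnS; exact: leq_trans (msize_mdeg_lt mp) pk.
rewrite mdegE; apply: pf_prod => i _.
rewrite -[X in pf X]mul1n; apply: pf_ext (pf_exp (m i) (pf_affine (delta_mx i 0) 0)) => x.
congr (_ ^+ _).
rewrite /aff addr0 /dot (bigD1 i)//= mxE !eqxx mul1r big1 ?addr0// => j ji.
by rewrite mxE (negbTE ji) mul0r.
Qed.

Lemma pf_mpoly k f : pf k f ->
  exists p : mpoly.mpoly 3 R, poly_deg_le k p /\ f = fun x => mpoly.meval (fun s => x s 0) p.
Proof.
rewrite /poly_deg_le; elim=> {k f} [k c|k b c f _ [p [pk ->]]|k f g _ [p [pk ->]] _ [q [qk ->]]].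
- exists (mpolyC 3 c); split; first by rewrite msizeC; case: (c != 0).
  by apply/funext => x; rewrite mevalC.
- pose L : mpoly.mpoly 3 R := \sum_i b i 0 *: mpolyX R (mnm1 i) + mpolyC 3 c.
  have L2 : (mpoly.msize L <= 2)%N.
    apply: leq_trans (msizeD_le _ _) _; rewrite geq_max msizeC; apply/andP; split; last by case: (c != 0).
    apply: leq_trans (msize_sum _ _ _) _; apply/bigmax_leqP => i _.
    by apply: leq_trans (msizeZ_le _ _) _; rewrite msizeX mdeg1.
  exists (L * p); split.
    have [->|L0] := eqVneq L 0; first by rewrite mul0r msize0.
    have [->|p0] := eqVneq p 0; first by rewrite mulr0 msize0.
    rewrite msizeM//; have := leq_add L2 pk; rewrite add2n => H.
    by rewrite -subn1 leq_subLR add1n.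
  apply/funext => x; rewrite mevalM; congr (_ * _).
  rewrite /L mevalD mevalC raddf_sum /=; congr (_ + _); apply: eq_bigr => i _.
  by rewrite mevalZ mevalXU.
- exists (p + q); split; last by apply/funext => x; rewrite mevalD.
  by apply: leq_trans (msizeD_le _ _) _; rewrite geq_max pk.
Qed.
End PolynomialFunctions.

Section Kronecker.
Context {R : realType}.

Lemma poly_pos_eq0 (p : {poly R}) : (forall t, 0 < t -> p.[t] = 0) -> p = 0.
Proof.
move=> p0; apply/eqP; apply: contraT => /max_poly_roots H.
pose s := [seq (i.+1)%:R : R | i <- iota 0 (size p)].
have := H s; rewrite size_map size_iota ltnn; apply.
  by apply/allP => _ /mapP[i _ ->]; rewrite /root p0// ltr0n.
by rewrite map_inj_uniq ?iota_uniq// => i j /eqP; rewrite eqr_nat eqSS => /eqP.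
Qed.

Variable k : nat.
Implicit Type b : {ffun 'I_4 -> 'I_k.+1}.

Let code b : nat := (b 0%R + k.+1 * (b 1%R + k.+1 * (b 2%R + k.+1 * b 3%R)))%N.

Let code_inj : injective code.
Proof.
have step (a a' : 'I_k.+1) (n n' : nat) : (a + k.+1 * n = a' + k.+1 * n')%N -> a = a' /\ n = n'.
  move=> E; have := congr1 (modn^~ k.+1) E; rewrite /= ![(_ * n)%N]mulnC ![(k.+1 * n')%N]mulnC.
  rewrite addnC modnMDl [(a' + _)%N]addnC modnMDl !modn_small// => /val_inj aa; split => //.
  by move/eqP: E; rewrite aa eqn_add2l eqn_pmul2l// => /eqP.
move=> b b'; rewrite /code => /step[e0] /step[e1] /step[e2 /val_inj e3].
by apply/ffunP; elim/ord4P.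
Qed.

(* Kronecker's substitution [y_j = t ^ (k.+1 ^ j)]. *)
Lemma monomials_free (c : {ffun 'I_4 -> 'I_k.+1} -> R) :
  (forall y : 'I_4 -> R, (forall j, 0 < y j) -> \sum_b c b * \prod_j y j ^+ b j = 0) ->
  forall b, c b = 0.
Proof.
move=> H b; pose p : {poly R} := \sum_b c b *: 'X^(code b).
have p0 : p = 0.
  apply: poly_pos_eq0 => t t0; have := H (fun j => t ^+ (k.+1 ^ j)) (fun j => exprn_gt0 _ t0).
  rewrite /p horner_sum => E; rewrite -[RHS]E; apply: eq_bigr => {}b _.
  rewrite hornerZ hornerXn; congr (_ * _).
  rewrite (_ : \prod_j _ = \prod_(j < 4) t ^+ (k.+1 ^ j * b j)); last first.
    by apply: eq_bigr => j _; rewrite exprM.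
  rewrite -[RHS](big_morph _ (fun x y => exprD t x y) (expr0 t)); congr (t ^+ _).
  by rewrite big4 /code /= expn0 expn1; ring.
have := congr1 (fun q : {poly R} => q`_(code b)) p0; rewrite coef0 /p coef_sum (bigD1 b)//=.
rewrite coefZ coefXn eqxx mulr1 big1 ?addr0// => b' bb'.
by rewrite coefZ coefXn (inj_eq code_inj) eq_sym (negbTE bb') mulr0.
Qed.
End Kronecker.

Notation expo k := {ffun 'I_4 -> 'I_k.+1}.

(** * The Bernstein basis of a tetrahedron with a distinguished vertex *)

Section Bernstein.
Context {R : realType}.
Notation point3 := 'cV[R]_3.
Implicit Types (l : 'I_4) (y : 'I_4 -> R) (w : 'I_4 -> point3).

(* Vertex [l] plays the role of the barycenter: its exponent is
   [k - \sum_j b j]. *)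
Definition mono k l (b : 'I_4 -> nat) y : R := y l ^+ (k - \sum_j b j) * \prod_(j | j != l) y j ^+ b j.

Definition nodes k l : pred (expo k) :=
  fun b : expo k => ((b l : nat) == 0)%N && (\sum_j b j <= k)%N.

Lemma eq_mono k l (b b' : 'I_4 -> nat) y : (forall j, b j = b' j) -> mono k l b y = mono k l b' y.
Proof.
move=> E; rewrite /mono (eq_bigr _ (fun j _ => E j)); congr (_ * _).
by apply: eq_bigr => j _; rewrite E.
Qed.

Lemma pf_mono w k l (b : 'I_4 -> nat) : (b l = 0)%N -> (\sum_j b j <= k)%N ->
  pf k (fun x => mono k l b (bar w ^~ x)).
Proof.
move=> bl bk; have pbar j : pf 1 (bar w j).
  by apply: pf_ext (pf_affine (grad w j) (bar w j 0)) => x; rewrite [RHS]barE.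
have := pfM (pf_exp (k - \sum_j b j) (pbar l)) (pf_prod (index_enum _) (P := fun j => j != l) (fun j _ => pf_exp (b j) (pbar j))).
rewrite mul1n [X in (_ + X)%N](_ : _ = \sum_j b j)%N ?subnK//.
by rewrite [RHS](bigD1 l)//= bl add0n; apply: eq_bigr => j _; rewrite mul1n.
Qed.

Definition bern k l (b : expo k) y : R := mono k l (fun j => b j) y.

Definition in_span w k l (f : point3 -> R) : Prop :=
  exists c : expo k -> R, forall x, f x = \sum_(b | nodes l b) c b * bern l b (bar w ^~ x).

Lemma in_span_ext w k l f g : f =1 g -> in_span w k l f -> in_span w k l g.
Proof. by move=> /funext ->. Qed.

Lemma in_spanD w k l f g : in_span w k l f -> in_span w k l g -> in_span w k l (fun x => f x + g x).
Proof.
move=> [c cE] [d dE]; exists (fun b => c b + d b) => x; rewrite cE dE -big_split /=.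
by apply: eq_bigr => b _; rewrite mulrDl.
Qed.

Lemma in_spanZ w k l f a : in_span w k l f -> in_span w k l (fun x => a * f x).
Proof.
move=> [c cE]; exists (fun b => a * c b) => x; rewrite cE mulr_sumr.
by apply: eq_bigr => b _; rewrite mulrA.
Qed.

Lemma in_span_sum w k l (I : Type) (s : seq I) (P : pred I) (F : I -> point3 -> R) :
  (forall i, P i -> in_span w k l (F i)) -> in_span w k l (fun x => \sum_(i <- s | P i) F i x).
Proof.
move=> pF; elim: s => [|i s IH].
  by exists (fun _ => 0) => x; rewrite big_nil big1// => b _; rewrite mul0r.
apply: (@in_span_ext _ _ _ (fun x => if P i then F i x + \sum_(j <- s | P j) F j x else \sum_(j <- s | P j) F j x)).
  by move=> x; rewrite big_cons.
by have := pF i; case: (P i) => // pFi; apply: in_spanD => //; exact: pFi.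
Qed.

Lemma in_span_mono w k l (b : 'I_4 -> nat) : (b l = 0)%N -> (\sum_j b j <= k)%N ->
  in_span w k l (fun x => mono k l b (bar w ^~ x)).
Proof.
move=> bl bk; pose b0 : expo k := [ffun j => inord (b j)].
have bE j : b0 j = b j :> nat.
  by rewrite ffunE inordK// ltnS; apply: leq_trans bk; rewrite (bigD1 j)//= leq_addr.
exists (fun b' => (b' == b0)%:R) => x; rewrite (bigD1 b0) /=; last first.
  by rewrite /nodes bE bl eqxx (eq_bigr b).
rewrite eqxx mul1r big1 ?addr0 => [|b' /andP[_ /negbTE ->]]; last by rewrite mul0r.
by apply: eq_mono => j; rewrite bE.
Qed.

(** An affine function is the combination of the barycentric coordinates with its vertex values as
    weights. Multiplying by coordinate [j] raises the exponent at [j]; for [j = l] the exponent [b]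
    stays and the larger degree accounts for the factor. *)
Lemma in_span_aff w k l a0 a f : indep w -> in_span w k l f ->
  in_span w k.+1 l (fun x => aff a0 a x * f x).
Proof.
move=> iw [c cE].
apply: (@in_span_ext _ _ _ (fun x => \sum_j \sum_(b : expo k | nodes l b)
    (aff a0 a (w j) * c b) * (bar w j x * bern l b (bar w ^~ x)))).
  move=> x; rewrite cE mulr_sumr exchange_big /=; apply: eq_bigr => b _.
  have -> : aff a0 a x = \sum_j aff a0 a (w j) * bar w j x.
    have [xE s1] := bar_hom x iw; rewrite /aff {1}xE dot_sumr -[X in _ + X]mulr1 -s1 mulr_sumr -big_split /=.
    by apply: eq_bigr => j _; rewrite dotZr; ring.
  by rewrite mulr_suml; apply: eq_bigr => j _; ring.
apply: in_span_sum => j _; apply: in_span_sum => b /andP[/eqP bl bk].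
apply: in_spanZ; pose b' i : nat := (b i + ((i == j) && (j != l)))%N.
have S : (\sum_i b' i = \sum_i b i + (j != l))%N.
  rewrite big_split /=; congr (_ + _)%N.
  by rewrite (bigD1 j)//= eqxx big1 ?addn0// => i /negbTE ->.
have bl' : b' l = 0%N by rewrite /b' bl; case: (l =P j) => // ->; rewrite eqxx.
apply: (@in_span_ext _ _ _ (fun x => mono k.+1 l b' (bar w ^~ x))).
  move=> x; rewrite /bern /mono S; have [jl|jl] := eqVneq j l.
    rewrite addn0 subSn// exprS jl mulrA; congr (_ * _); apply: eq_bigr => i _.
    by rewrite /b' jl eqxx andbF addn0.
  rewrite addn1 subSS mulrCA; congr (_ * _); rewrite (bigD1 j)//= [in RHS](bigD1 j)//=.
  rewrite /b' eqxx jl addn1 exprS mulrA; congr (_ * _); apply: eq_bigr => i /andP[_ /negbTE ->].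
  by rewrite addn0.
by apply: in_span_mono => //; rewrite S -[X in (_ <= X)%N]addn1 leq_add// leq_b1.
Qed.

Lemma pf_in_span w k l f : indep w -> pf k f -> in_span w k l f.
Proof.
move=> iw; elim=> {k f} [k c|k b c f _ IH|k f g _ IHf _ IHg].
- elim: k => [|k IH].
    have := @in_span_mono w 0 l (fun _ => 0%N); rewrite big1// => /(_ erefl isT) /(in_spanZ c).
    apply: in_span_ext => x; rewrite /mono big1// subn0 expr0 mul1r big1 ?mulr1//.
  by apply: in_span_ext (in_span_aff 0 1 iw IH) => x; rewrite /aff dot0l add0r mul1r.
- exact: in_span_aff.
- exact: in_spanD.
Qed.

(* [on_face a y]: y lies in the interior of the face opposite to [a], or of
   the whole simplex for [a = None]. *)
Definition on_face (a : option 'I_4) y : Prop :=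
  forall j, if Some j == a then y j = 0 else 0 < y j.

(** The exponents whose polynomial survives restriction to the face: the variable that vanishes
    there must not occur. For the distinguished vertex [l] its power is [k - \sum_j b j], hence the
    condition of full degree. *)
Definition alive k (a : option 'I_4) l (b : expo k) : bool :=
  if a is Some a then (if a == l then (\sum_j b j)%N == k else ((b a : nat) == 0)%N) else true.

Lemma mono_dead k a l (b : expo k) y : nodes l b -> ~~ alive a l b -> on_face a y ->
  bern l b y = 0.
Proof.
move=> /andP[bl bk]; case: a => // a /= + /(_ a); rewrite eqxx => + ya.
rewrite /bern /mono; case: eqP => [<-|/eqP al] H.
  by rewrite ya expr0n subn_eq0 leqNgt ltn_neqAle H bk mul0r.
by rewrite [X in _ * X](bigD1 a)//= ya expr0n (negbTE H) mul0r mulr0.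
Qed.

Lemma mono_scale k l (b : 'I_4 -> nat) y s : (b l = 0)%N -> (\sum_j b j <= k)%N ->
  mono k l b (fun j => s * y j) = s ^+ k * mono k l b y.
Proof.
move=> bl bk; rewrite /mono exprMn (eq_bigr (fun j => s ^+ b j * y j ^+ b j)); last first.
  by move=> j _; rewrite exprMn.
rewrite big_split /= -(big_morph _ (fun m n => exprD s m n) (expr0 s)).
have -> : s ^+ k = s ^+ (k - \sum_j b j) * s ^+ (\sum_(j | j != l) b j).
  by rewrite -exprD -{1}(subnK bk); congr (s ^+ (_ + _)); rewrite (bigD1 l)//= bl.
ring.
Qed.

(** All these polynomials are homogeneous of degree [k], so an identity on the simplex extends to
    the cone by scaling with [s]. Setting variable [l] to 1, unless the face makes it 0, then leaves
    distinct monomials in the others. *)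
Lemma mono_free k a l (c : expo k -> R) :
  (forall y, \sum_j y j = 1 -> on_face a y -> \sum_(b | nodes l b) c b * bern l b y = 0) ->
  forall b, nodes l b -> alive a l b -> c b = 0.
Proof.
move=> H b0 b0l b0a; pose c' b := if nodes l b && alive a l b then c b else 0.
suff : c' b0 = 0 by rewrite /c' b0l b0a.
apply: monomials_free => y y0; pose z j := if Some j == a then 0 else if j == l then 1 else y j.
have z0 j : 0 <= z j by rewrite /z; do 2 case: ifP => // _; exact: ltW.
pose s := \sum_j z j; have s0 : 0 < s.
  have [j ja] : exists j, Some j != a.
    by case: a {H b0a c' z z0 s} => [a|]; [exists (lift a 0); apply/eqP => -[] /eqP; rewrite eq_sym (negbTE (neq_lift _ _))|exists 0].
  apply: (@lt_le_trans _ _ (z j)); first by rewrite /z (negbTE ja); case: ifP.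
  by rewrite /s (bigD1 j)//= lerDl sumr_ge0.
have zf : on_face a z.
  by move=> j; rewrite /z; case: (_ == a) => //; case: (_ == l); [exact: ltr01|exact: y0].
have : \sum_(b : expo k | nodes l b) c b * bern l b z = 0.
  have /H : \sum_j s^-1 * z j = 1 by rewrite -mulr_sumr mulVf// gt_eqF.
  have fz : on_face a (fun j => s^-1 * z j).
    by move=> j; have := zf j; case: ifP => _; [move=> ->; rewrite mulr0|rewrite pmulr_rgt0// invr_gt0].
  move=> /(_ fz) E; apply/eqP; rewrite -(mulrI_eq0 _ (x := s^-1 ^+ k)); last first.
    by apply/lregP; rewrite expf_neq0// invr_eq0 gt_eqF.
  apply/eqP; rewrite -[RHS]E mulr_sumr; apply: eq_bigr => b /andP[/eqP bl bk].
  by rewrite /bern (mono_scale _ _ bl bk) mulrCA.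
move=> E; rewrite -[RHS]E [RHS]big_mkcond /=; apply: eq_bigr => b _; rewrite /c'.
case bl : (nodes l b); rewrite /= ?mul0r//; case ba : (alive a l b); last first.
  by rewrite mul0r (mono_dead bl _ zf) ?ba// mulr0.
congr (_ * _); case/andP: bl => /eqP bl bk.
rewrite (bigD1 l)//= bl expr0 mul1r /bern /mono {1}/z eqxx.
have -> : (if Some l == a then 0 else 1) ^+ (k - \sum_j b j) = 1 :> R.
  case: eqP ba => [<-|_ _]; last by rewrite expr1n.
  by rewrite /= eqxx => /eqP ->; rewrite subnn expr0.
rewrite mul1r; apply: eq_bigr => j jl; rewrite /z (negbTE jl).
case: eqP ba => [<-|//]; by rewrite /= (negbTE jl) => /eqP ->; rewrite !expr0.
Qed.

Lemma bern_free w k a l (c : expo k -> R) : indep w ->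
  (forall x, on_face a (bar w ^~ x) -> \sum_(b | nodes l b) c b * bern l b (bar w ^~ x) = 0) ->
  forall b, nodes l b -> alive a l b -> c b = 0.
Proof.
move=> iw H; apply: mono_free => y y1 ya.
have yE : bar w ^~ (\sum_j y j *: w j) = y by apply/funext => j; exact: bar_unique.
by have := H (\sum_j y j *: w j); rewrite yE; apply.
Qed.

Lemma bern_free_mx m n w k a l (C : expo k -> 'M[R]_(m, n)) : indep w ->
  (forall x, on_face a (bar w ^~ x) -> \sum_(b | nodes l b) bern l b (bar w ^~ x) *: C b = 0) ->
  forall b, nodes l b -> alive a l b -> C b = 0.
Proof.
move=> iw H b bl ba; apply/matrixP => i j; rewrite mxE.
apply: (bern_free (c := fun b => C b i j) iw _ bl ba) => x xa.
have := congr1 (fun A : 'M[R]_(m, n) => A i j) (H x xa); rewrite summxE mxE => E.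
by rewrite -[RHS]E; apply: eq_bigr => b' _; rewrite mxE mulrC.
Qed.
End Bernstein.

Section Coefficients.
Context {R : realType}.
Notation point3 := 'cV[R]_3.
Variable v : 'I_4 -> point3.
Hypothesis iv : indep v.
Variables (k m n : nat).
Implicit Types (l : 'I_4) (b : expo k).

Definition node : finType := {p : 'I_4 * expo k | nodes p.1 p.2}.

Definition patchwork (C : 'I_4 -> expo k -> 'M[R]_(m, n)) l (x : point3) : 'M[R]_(m, n) :=
  \sum_(b | nodes l b) bern l b (bar (alf v l) ^~ x) *: C l b.

Lemma pf_patchwork C l i j : pf k (fun x => patchwork C l x i j).
Proof.
apply: (@pf_ext _ _ (fun x => \sum_(b : expo k | nodes l b) C l b i j * bern l b (bar (alf v l) ^~ x))).
  by move=> x; rewrite /patchwork summxE; apply: eq_bigr => b _; rewrite mxE mulrC.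
by apply: pf_sum => b /andP[/eqP bl bk]; apply: pfZ; exact: pf_mono.
Qed.

Lemma patchwork_smooth C l i j : smooth (fun x => patchwork C l x i j).
Proof. exact: pf_smooth (pf_patchwork C l i j). Qed.

Lemma pf_patchworkP (Z : 'I_4 -> point3 -> 'M[R]_(m, n)) :
  (forall l i j, pf k (fun x => Z l x i j)) -> exists C, forall l x, Z l x = patchwork C l x.
Proof.
move=> pZ; have /choice[c cE] : forall p : 'I_4 * 'I_m * 'I_n, exists c : expo k -> R,
    forall x, Z p.1.1 x p.1.2 p.2 = \sum_(b | nodes p.1.1 b) c b * bern p.1.1 b (bar (alf v p.1.1) ^~ x).
  by move=> p; apply: pf_in_span; first exact: indep_alf.
exists (fun l b => \matrix_(i, j) c (l, i, j) b) => l x; apply/matrixP => i j.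
rewrite (cE (l, i, j)) summxE; apply: eq_bigr => b _; by rewrite !mxE mulrC.
Qed.

Lemma patchwork_free (C : 'I_4 -> expo k -> 'M[R]_(m, n)) l :
  (forall x, (forall j, 0 < bar (alf v l) j x) -> patchwork C l x = 0) ->
  forall b, nodes l b -> C l b = 0.
Proof.
move=> H b bl; apply: (@bern_free_mx _ _ _ (alf v l) k None l (C l)) => //.
exact: indep_alf.
Qed.

Section Basis.
Variables (I : finType) (E : I -> 'M[R]_(m, n)).
Notation coef := {ffun node * I -> R^o}.

(** Zero off the nodes: coefficients become functions of all pairs [(l, b)], although only pairs in
    [node] are degrees of freedom. *)
Definition ext (c : coef) l b (e : I) : R :=
  if insub (l, b) is Some p then c (p : node, e) else 0.

Lemma ext_node (c : coef) (p : node) e : ext c (val p).1 (val p).2 e = c (p, e).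
Proof. by rewrite /ext -surjective_pairing valK. Qed.

Definition cf (c : coef) l b : 'M[R]_(m, n) := \sum_e ext c l b e *: E e.

Lemma cfP a c d l b : cf (a *: c + d) l b = a *: cf c l b + cf d l b.
Proof.
rewrite /cf scaler_sumr -big_split /=; apply: eq_bigr => e _; rewrite /ext scalerA -scalerDl.
by case: insub => [p|]; rewrite ?mulr0 ?addr0// !ffunE.
Qed.

Lemma cf_sum (J : Type) (s : seq J) (P : pred J) (a : J -> R) (c : J -> coef) l b :
  cf (\sum_(i <- s | P i) a i *: c i) l b = \sum_(i <- s | P i) a i *: cf (c i) l b.
Proof.
elim: s => [|i s IH]; last by rewrite !big_cons; case: (P i) => //; rewrite cfP IH.
rewrite !big_nil /cf big1// => e _; rewrite /ext; case: insub => [p|]; rewrite ?scale0r//.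
by rewrite ffunE scale0r.
Qed.

Definition field (c : coef) : point3 -> 'M[R]_(m, n) := glue v (patchwork (cf c)).

Lemma patchwork_sum (J : Type) (s : seq J) (P : pred J) (a : J -> R) (c : J -> coef) l x :
  patchwork (cf (\sum_(i <- s | P i) a i *: c i)) l x =
  \sum_(i <- s | P i) a i *: patchwork (cf (c i)) l x.
Proof.
rewrite /patchwork; under eq_bigr do rewrite cf_sum scaler_sumr.
rewrite exchange_big /=; apply: eq_bigr => i _; rewrite scaler_sumr; apply: eq_bigr => b _.
by rewrite !scalerA mulrC.
Qed.

Lemma field_sum (J : Type) (s : seq J) (P : pred J) (a : J -> R) (c : J -> coef) x :
  field (\sum_(i <- s | P i) a i *: c i) x = \sum_(i <- s | P i) a i *: field (c i) x.
Proof.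
have [l Hl] := first_min_ex v x; rewrite /field (glueE _ Hl) patchwork_sum.
by apply: eq_bigr => i _; rewrite (glueE _ Hl).
Qed.

Hypothesis Efree : forall a : I -> R, \sum_e a e *: E e = 0 -> forall e, a e = 0.

Lemma coef_free c : (forall l x, (forall j, 0 < bar (alf v l) j x) -> patchwork (cf c) l x = 0) -> c = 0.
Proof.
move=> H; apply/ffunP => -[p e]; rewrite ffunE -ext_node.
by apply: (Efree (a := ext c (val p).1 (val p).2)); exact: (patchwork_free (H _) (valP p)).
Qed.

Lemma coef_of (C : 'I_4 -> expo k -> 'M[R]_(m, n)) :
  (forall l b, nodes l b -> exists a : I -> R, C l b = \sum_e a e *: E e) ->
  exists c, forall l b, nodes l b -> cf c l b = C l b.
Proof.
move=> H; have /choice[a aE] : forall p : node, exists a : I -> R,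
    C (val p).1 (val p).2 = \sum_e a e *: E e by move=> p; exact: H (valP p).
exists [ffun q => a q.1 q.2] => l b bl.
pose p : node := Sub (l, b) bl; have := aE p; rewrite SubK /= => ->.
rewrite /cf; apply: eq_bigr => e _; congr (_ *: _).
by have := ext_node [ffun q => a q.1 q.2 : R^o] p e; rewrite SubK ffunE.
Qed.

Lemma eq_patchwork (C D : 'I_4 -> expo k -> 'M[R]_(m, n)) l x :
  (forall b, nodes l b -> C l b = D l b) -> patchwork C l x = patchwork D l x.
Proof. by move=> H; apply: eq_bigr => b bl; rewrite H. Qed.

(** Passing to classes almost everywhere loses nothing: a continuous piece that is zero almost
    everywhere is zero inside its tetrahedron, and there the Bernstein polynomials and the matrices
    [E] are independent. *)
Lemma L2dim_coef (U : set (point3 -> 'M[R]_(m, n))) (S : {vspace coef}) :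
  (forall c, c \in S -> U (field c)) ->
  (forall u, U u -> exists2 c, c \in S & rep v u (patchwork (cf c))) ->
  L2dim (tetra v) U (\dim S).
Proof.
move=> SU US; exists (fun i => field (vbasis S)`_i).
have fE (a : 'I_(\dim S) -> R) : (fun x => \sum_i a i *: field (vbasis S)`_i x) =
    field (\sum_i a i *: (vbasis S)`_i).
  by apply/funext => x; rewrite field_sum.
have memS (a : 'I_(\dim S) -> R) : \sum_i a i *: (vbasis S)`_i \in S.
  by apply: memv_suml => i _; apply: memvZ; apply: vbasis_mem; rewrite mem_nth// size_tuple.
split=> [a|u /US[c cS uc]|a H i].
- by rewrite fE; apply: SU.
- exists (fun i => coord (vbasis S) i c); apply: (ae_alfeld iv) => l.
  have := coord_vbasis cS => cE.
  move: (uc l) (ae_first_min iv l); apply: aeS2 => z Hu Hl Tz.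
  rewrite Hu// -[RHS](field_sum _ _ (fun i => coord (vbasis S) i c)) -cE.
  by rewrite /field (glueE _ (Hl Tz)).
- have S0 : \sum_i a i *: (vbasis S)`_i = 0.
    apply: coef_free => l x x0; apply/matrixP => i' j'; rewrite [RHS]mxE.
    apply: (ae_tetra_eq0 (f := fun x => patchwork (cf (\sum_i a i *: (vbasis S)`_i)) l x i' j') (indep_alf iv l)) => //.
      exact/smooth_continuous/patchwork_smooth.
    have H' : ae_on (tetra v) (fun x => field (\sum_i a i *: (vbasis S)`_i) x = 0).
      by apply: ae_onW H => y _; rewrite field_sum.
    move: H' (ae_first_min iv l); apply: aeS2 => z Hz Hl Tz.
    by have := Hz (alfeld_sub iv Tz); rewrite /field (glueE _ (Hl Tz)) => ->; rewrite mxE.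
  have := vbasisP S; rewrite basisEfree => /andP[/freeP /(_ a S0)]; exact.
Qed.
End Basis.
End Coefficients.

(** * Dimensions of the bubble spaces *)

Section FaceCoefficients.
Context {R : realType}.
Notation point3 := 'cV[R]_3.
Variable v : 'I_4 -> point3.
Hypothesis iv : indep v.
Variable k : nat.
Implicit Types (l m : 'I_4) (b : expo k) (C : 'I_4 -> expo k -> 'M[R]_3).

(** The decoupling: on the face between the pieces [l] and [m] only exponents that are nodes of both
    survive, and [b] then gives the same polynomial (4 lambda_l)^(k - |b|) prod_j (lambda_j -
    lambda_l)^(b_j) from both sides. On a boundary face the exponents of total degree [k]
    survive. *)
Definition compatible C : Prop :=
  (forall l m b, m != l -> nodes l b -> nodes m b ->
     (C l b - C m b) *m (grad v m - grad v l) = 0) /\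
  (forall l b, nodes l b -> (\sum_j b j)%N = k -> C l b *m grad v l = 0).

Lemma dot_mrow C i l (g x : point3) :
  dot g (mrow (patchwork v C) i l x) =
  \sum_(b | nodes l b) bern l b (bar (alf v l) ^~ x) * (C l b *m g) i 0.
Proof.
rewrite /dot; transitivity (\sum_j \sum_(b | nodes l b) bern l b (bar (alf v l) ^~ x) * (C l b i j * g j 0)).
  apply: eq_bigr => j _; rewrite mxE /patchwork summxE mulr_sumr; apply: eq_bigr => b _.
  by rewrite mxE; ring.
rewrite exchange_big /=; apply: eq_bigr => b _; by rewrite mxE mulr_sumr.
Qed.

Lemma bern_dead l m b x : m != l -> nodes l b -> ~~ nodes m b -> bar v m x = bar v l x ->
  bern l b (bar (alf v l) ^~ x) = 0.
Proof.
move=> ml /andP[_ bk]; rewrite /nodes bk andbT => bm E.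
have z : bar (alf v l) m x = 0 by rewrite bar_alf// (negbTE ml) E subrr.
rewrite /bern /mono [X in _ * X](bigD1 m)//= z expr0n (negbTE bm).
by rewrite mul0r mulr0.
Qed.

Lemma bern_swap l m b x : nodes l b -> nodes m b -> bar v m x = bar v l x ->
  bern l b (bar (alf v l) ^~ x) = bern m b (bar (alf v m) ^~ x).
Proof.
move=> /andP[/eqP bl _] /andP[/eqP bm _] E.
have P p : b p = 0%N :> nat -> \prod_(j | j != p) bar (alf v p) j x ^+ b j =
    \prod_j (bar v j x - bar v p x) ^+ b j.
  move=> bp; rewrite [RHS](bigD1 p)//= bp expr0 mul1r; apply: eq_bigr => j jp.
  by rewrite bar_alf// (negbTE jp).
by rewrite /bern /mono !P// !bar_alf// !eqxx E.
Qed.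

Lemma jump_mrow C i l m (g x : point3) : m != l -> bar v m x = bar v l x ->
  dot g (mrow (patchwork v C) i l x - mrow (patchwork v C) i m x) =
  \sum_(b | nodes l b) bern l b (bar (alf v l) ^~ x) *
     (if nodes m b then (C l b - C m b) *m g else 0) i 0.
Proof.
move=> ml E; rewrite dotBr !dot_mrow.
have -> : \sum_(b | nodes m b) bern m b (bar (alf v m) ^~ x) * (C m b *m g) i 0 =
    \sum_(b | nodes l b) bern l b (bar (alf v l) ^~ x) * (if nodes m b then (C m b *m g) i 0 else 0).
  rewrite big_mkcond [RHS]big_mkcond /=; apply: eq_bigr => b _.
  case bl : (nodes l b); case bm : (nodes m b); rewrite ?mulr0//.
    by rewrite (bern_swap bl bm E).
  by rewrite (@bern_dead m l) ?bl ?bm ?mul0r// eq_sym.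
rewrite -sumrB; apply: eq_bigr => b bl; case bm : (nodes m b).
  by rewrite mulmxBl; move: (C l b *m g) (C m b *m g) => A B; rewrite !mxE mulrBr.
by rewrite (bern_dead ml bl) ?bm// !mul0r subr0.
Qed.

Lemma compatible_faces C : compatible C -> forall i, face_conditions v (mrow (patchwork v C) i).
Proof.
move=> [Ci Cb] i; split=> [l x Tx xl|l m x ml Tl Tm].
  rewrite dot_mrow big1// => b bl; have [bk|bk] := eqVneq (\sum_j b j)%N k.
    by rewrite Cb// mxE mulr0.
  rewrite /bern /mono bar_alf// eqxx xl mulr0 expr0n subn_eq0 leqNgt.
  by case/andP: bl => _ bl; rewrite ltn_neqAle bk bl !mul0r.
have E : bar v m x = bar v l x.
  have [_ Hl] := (alfeldP iv _ _).1 Tl; have [_ Hm] := (alfeldP iv _ _).1 Tm.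
  by apply/le_anti; rewrite Hl Hm.
rewrite jump_mrow// big1// => b bl; case: ifP => bm; last by rewrite mxE mulr0.
by rewrite Ci// mxE mulr0.
Qed.

Lemma faces_compatible C : (forall i,
  (forall l x, bar v l x = 0 -> (forall j, j != l -> 0 < bar v j x) ->
     dot (grad v l) (mrow (patchwork v C) i l x) = 0) /\
  (forall l m x, m != l -> bar v m x = bar v l x -> 0 < bar v l x ->
     (forall j, j != l -> j != m -> bar v l x < bar v j x) ->
     dot (grad v m - grad v l) (mrow (patchwork v C) i l x - mrow (patchwork v C) i m x) = 0)) ->
  compatible C.
Proof.
move=> H; split=> [l m b ml bl bm|l b bl bk]; apply/colP => i; rewrite [RHS]mxE.
- have F := @bern_free _ (alf v l) k (Some m) l
    (fun b => (if nodes m b then (C l b - C m b) *m (grad v m - grad v l) else 0) i 0)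
    (indep_alf iv l).
  rewrite -[LHS]/((if true then (C l b - C m b) *m (grad v m - grad v l) else 0) i 0) -bm.
  apply: F => //; last by rewrite /= (negbTE ml); case/andP: bm.
  move=> x xm; have Em : bar v m x = bar v l x.
    by have := xm m; rewrite eqxx bar_alf// (negbTE ml) => /subr0_eq.
  under eq_bigr do rewrite mulrC.
  rewrite -jump_mrow//; apply: (H i).2 => //.
    by have := xm l; rewrite (_ : (Some l == _) = false) ?bar_alf// ?eqxx ?pmulr_rgt0// eq_sym; exact/negbTE.
  move=> j jl jm; have := xm j; rewrite (_ : (Some j == _) = false); last exact/negbTE.
  by rewrite bar_alf// (negbTE jl) subr_gt0.
- apply: (@bern_free _ (alf v l) k (Some l) l (fun b => (C l b *m grad v l) i 0) (indep_alf iv l)) => //; last by rewrite /= eqxx bk.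
  move=> x xl; under eq_bigr do rewrite mulrC.
  rewrite -dot_mrow; have l0 : bar v l x = 0.
    by have := xl l; rewrite eqxx bar_alf// eqxx => /eqP; rewrite mulf_eq0 pnatr_eq0 /= => /eqP.
  apply: (H i).1 => // j jl; have := xl j; rewrite (_ : (Some j == _) = false); last exact/negbTE.
  by rewrite bar_alf// (negbTE jl) l0 subr0.
Qed.
End FaceCoefficients.

(** * Independence of the face conditions at one exponent *)

Section NodalInjectivity.
Context {R : realType}.
Notation point3 := 'cV[R]_3.
Variable v : 'I_4 -> point3.
Hypothesis iv : indep v.
Variables (Y : 'I_4 -> 'I_4 -> point3) (B : 'I_4 -> point3).

(* Each [Q l] is the symmetric matrix paired with the symmetric coefficient of
   the tetrahedron [l], for Lagrange multipliers [Y] (interior faces) and [B]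
   (boundary faces). *)
Let Q l x y := \sum_(m | m != l) (dot (Y l m) x * dot (grad v m - grad v l) y
   + dot (Y l m) y * dot (grad v m - grad v l) x)
   + (dot (B l) x * dot (grad v l) y + dot (B l) y * dot (grad v l) x).

Lemma dot_gradB l x y : dot (grad v l) (x - y) = bar v l x - bar v l y.
Proof. by rewrite dotBr [bar v l x]barE [bar v l y]barE; ring. Qed.

(** Put e_q = v_q - z and a(l,p,q) = Y_lp . e_q. As grad_l . e_q = delta_lq - kappa, the constant
    cancels in differences of gradients, and Q_l(e_p, e_q) = 0 says that a is antisymmetric in
    (p,q). Being also symmetric in (l,p), it changes sign after three exchanges that restore the
    order, so it is 0. *)
Lemma nodal_step (z : point3) (kappa : R) (D : pred 'I_4) :
  (forall l m, Y l m = Y m l) -> (forall l x y, Q l x y = 0) ->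
  (forall l, D l -> bar v l z = kappa) ->
  (forall l m, ~~ D m -> Y l m = 0) ->
  kappa = 0 \/ (forall l, B l = 0) ->
  (forall u, (forall q, D q -> dot u (v q - z) = 0) -> u = 0) ->
  forall l m, m != l -> Y l m = 0.
Proof.
move=> Ysym Q0 Dz YD kB span; pose e q := v q - z.
have Ge l q : D l -> dot (grad v l) (e q) = (l == q)%:R - kappa.
  by move=> Dl; rewrite dot_gradB bar_vertex// Dz.
pose a l p q := dot (Y l p) (e q).
have N l q (F : 'I_4 -> R) : D l -> q != l -> (forall m, ~~ D m -> F m = 0) ->
    \sum_(m | m != l) F m * dot (grad v m - grad v l) (e q) = F q.
  move=> Dl ql F0; have [Dq|/F0 Fq] := boolP (D q).
    rewrite (bigD1 q)//= dotBl !Ge// eqxx [l == q]eq_sym (negbTE ql) big1 ?addr0; first by rewrite /=; ring.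
    move=> m /andP[ml mq]; have [Dm|/F0 ->] := boolP (D m); last by rewrite mul0r.
    by rewrite dotBl !Ge// (negbTE mq) eq_sym (negbTE ql) subrr mulr0.
  rewrite Fq big1// => m ml; have [Dm|/F0 ->] := boolP (D m); last by rewrite mul0r.
  rewrite dotBl !Ge// [l == q]eq_sym (negbTE ql); case: eqP => [E|_]; last by rewrite subrr mulr0.
  by rewrite E Fq mul0r.
have anti l p q : D l -> p != l -> q != l -> a l p q = - a l q p.
  move=> Dl pl ql; have := Q0 l (e p) (e q); rewrite /Q big_split /=.
  rewrite !N//; last 2 first.
  - by move=> m Dm; rewrite YD// dot0l.
  - by move=> m Dm; rewrite YD// dot0l.
  have -> : dot (B l) (e p) * dot (grad v l) (e q) + dot (B l) (e q) * dot (grad v l) (e p) = 0.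
    case: kB => [k0|->]; last by rewrite !dot0l !mul0r addr0.
    by rewrite !Ge// k0 eq_sym (negbTE ql) [l == p]eq_sym (negbTE pl) subrr !mulr0 addr0.
  by rewrite addr0 /a => /eqP; rewrite addrC addr_eq0 => /eqP.
have sym l p q : a l p q = a p l q by rewrite /a Ysym.
have self l p : D l -> p != l -> a l p p = 0.
  by move=> Dl pl; have := anti l p p Dl pl pl; lra.
move=> l p pl; have [Dl|Dl] := boolP (D l); last by rewrite Ysym YD.
have [Dp|Dp] := boolP (D p); last by rewrite YD.
apply: span => q Dq; rewrite -/(e q) -/(a l p q).
have [->|qp] := eqVneq q p; first exact: self.
have [->|ql] := eqVneq q l; first by rewrite sym self// eq_sym.
have : a l p q = - a l p q; last by lra.
rewrite {1}(anti l p q)// (sym l q p) (anti q l p)// 1?eq_sym// 1?eq_sym// opprK (sym q p l).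
by rewrite (anti p q l)// 1?eq_sym// (sym p l q).
Qed.

Lemma span_edges (p : 'I_4) u : (forall q, q != p -> dot u (v q - v p) = 0) -> u = 0.
Proof.
move=> H; apply: dot_eq0; rewrite {2}(grad_sum p u iv) dot_sumr big1// => q _.
rewrite dotZr; have [->|qp] := eqVneq q p; last by rewrite H ?mulr0.
by rewrite subrr dot0r mulr0.
Qed.

Lemma bar_barycenter l : bar v l (barycenter v) = 4^-1.
Proof.
apply: (bar_unique (c := fun _ => 4^-1)) => //; last by rewrite -scaler_sumr.
by rewrite sumr_const card_ord -[LHS]mulr_natl mulfV// pnatr_eq0.
Qed.

(** Without boundary multipliers, z is the barycenter and kappa = 1/4. Otherwise z = v_p and kappa =
    0: then grad_l . e_q = 0 for q different from l, which removes the boundary terms, and once [Y]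
    is 0 the test vector v_l - v_p recovers [B l]. *)
Lemma nodal_injective : (forall l m, Y l m = Y m l) -> (forall l x y, Q l x y = 0) ->
  (forall l, B l = 0) \/ (exists p, (forall l, Y l p = 0) /\ B p = 0) ->
  (forall l m, m != l -> Y l m = 0) /\ forall l, B l = 0.
Proof.
move=> Ysym Q0 [B0|[p [Yp Bp]]].
- split => //; apply: (@nodal_step (barycenter v) 4^-1 predT) => //.
  + by move=> l _; exact: bar_barycenter.
  + by right.
  + move=> u H; apply: (span_edges (p := 0)) => q _.
    by rewrite -[v q - v 0](subrKA (barycenter v)) dotDr H// -opprB dotNr H// oppr0 addr0.
- have Y0 : forall l m, m != l -> Y l m = 0.
    apply: (@nodal_step (v p) 0 (fun l => l != p)) => //.
    + by move=> l lp; rewrite bar_vertex// (negbTE lp).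
    + by move=> l m /negPn/eqP ->.
    + by left.
    + exact: span_edges.
  split=> // l; have [->//|lp] := eqVneq l p.
  have E x y : dot (B l) x * dot (grad v l) y + dot (B l) y * dot (grad v l) x = 0.
    rewrite -[RHS](Q0 l x y) /Q big1 ?add0r// => m ml.
    by rewrite Y0// !dot0l !mul0r addr0.
  have Gl q : dot (grad v l) (v q - v p) = (l == q)%:R.
    by rewrite dot_gradB !bar_vertex// (negbTE lp) subr0.
  have Bl : dot (B l) (v l - v p) = 0.
    by have := E (v l - v p) (v l - v p); rewrite Gl eqxx mulr1; lra.
  apply: (span_edges (p := p)) => q _; have := E (v q - v p) (v l - v p).
  by rewrite !Gl eqxx Bl mul0r addr0 mulr1.
Qed.
End NodalInjectivity.

(** * Counting the exponents of pieces and faces *)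

Section NodeCount.
Variable k : nat.

(** Exponents supported on the range of [s] correspond to tuples, whose number with prescribed or
    bounded sum is a binomial coefficient. Three, or two, free entries describe a piece, or one of
    its faces. *)
Lemma card_expo q (s : 'I_q -> 'I_4) (P : pred nat) : injective s ->
  #|[set b : expo k | [forall j, (j \notin codom s) ==> ((b j : nat) == 0)%N] && P (\sum_j b j)%N]%SET|
  = #|[set t : q.-tuple 'I_k.+1 | P (\sum_(i <- t) i)%N]%SET|.
Proof.
move=> s_inj; pose f (t : q.-tuple 'I_k.+1) : expo k :=
  [ffun j => if [pick i | s i == j] is Some i then tnth t i else ord0].
have fs t i : f t (s i) = tnth t i.
  rewrite ffunE; case: pickP => [i' /eqP/s_inj ->//|/(_ i)]; by rewrite eqxx.
have f0 t j : j \notin codom s -> f t j = ord0.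
  move=> js; rewrite ffunE; case: pickP => // i /eqP E.
  by rewrite -E codom_f in js.
have S (b : expo k) : (forall j, j \notin codom s -> b j = ord0) ->
    (\sum_j b j = \sum_i b (s i))%N.
  move=> b0; rewrite (bigID (fun j => j \in codom s)) /= [X in (_ + X)%N]big1 ?addn0; last first.
    by move=> j /b0 ->.
  rewrite -[RHS](big_map s predT (fun j => b j : nat)) -big_filter.
  apply: perm_big; apply: uniq_perm; first by rewrite filter_uniq// index_enum_uniq.
    by rewrite map_inj_uniq// index_enum_uniq.
  by move=> j; rewrite mem_filter mem_index_enum andbT codomE enumT.
rewrite -[RHS](card_imset _ (f := f)); last first.
  by move=> t t' E; apply: eq_from_tnth => i; rewrite -!fs E.
apply: eq_card => b; rewrite inE; apply/andP/imsetP.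
- case=> /forallP b0 Pb; have {}b0 j : j \notin codom s -> b j = ord0.
    by move=> js; apply/val_inj/eqP; have := b0 j; rewrite js.
  exists [tuple b (s i) | i < q].
    rewrite inE; move: Pb; rewrite S// big_tuple; congr (P _).
    by apply: eq_bigr => i _; rewrite tnth_mktuple.
  apply/ffunP => j; have [/codomP[i ->]|js] := boolP (j \in codom s).
    by rewrite fs tnth_mktuple.
  by rewrite b0// f0.
- case=> t; rewrite inE => Pt ->; split; first by apply/forallP => j; apply/implyP => /f0 ->.
  rewrite S; last by move=> j; exact: f0.
  by move: Pt; rewrite big_tuple; congr (P _); apply: eq_bigr => i _; rewrite fs.
Qed.

Lemma card_nodes l : #|[set b : expo k | nodes l b]%SET| = 'C(k + 3, 3).
Proof.
rewrite [in RHS]addnC -(card_partial_ord_partitions 3 k).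
rewrite -(card_expo (fun n => n <= k)%N (@lift_inj _ l)); apply: eq_card => b; rewrite !inE /nodes.
congr (_ && _); apply/idP/forallP => [bl j|/(_ l)].
  apply/implyP => jl; rewrite (_ : j = l)//; apply/eqP; apply: contraNT jl => jl.
  by case: (unliftP l j) jl => [i ->|->]; rewrite ?codom_f// eqxx.
by move=> /implyP; apply; apply/codomP => -[i /eqP]; rewrite (negbTE (neq_lift _ _)).
Qed.

Lemma card_top_nodes l : #|[set b : expo k | nodes l b && ((\sum_j b j)%N == k)]%SET| = 'C(k + 2, 2).
Proof.
rewrite [in RHS]addnC -(card_ord_partitions 2 k).
rewrite -(card_expo (fun n => n == k)%N (@lift_inj _ l)); apply: eq_card => b; rewrite !inE /nodes.
rewrite -andbA [(_ <= k)%N && _](_ : _ = ((\sum_j b j)%N == k)); last by case: eqP => [->|]; rewrite ?leqnn ?andbF.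
congr (_ && _); apply/idP/forallP => [bl j|/(_ l)].
  apply/implyP => jl; rewrite (_ : j = l)//; apply/eqP; apply: contraNT jl => jl.
  by case: (unliftP l j) jl => [i ->|->]; rewrite ?codom_f// eqxx.
by move=> /implyP; apply; apply/codomP => -[i /eqP]; rewrite (negbTE (neq_lift _ _)).
Qed.

Lemma card_common_nodes l m : m != l ->
  #|[set b : expo k | nodes l b && nodes m b]%SET| = 'C(k + 2, 2).
Proof.
move=> ml; rewrite [in RHS]addnC -(card_partial_ord_partitions 2 k).
have [m' mE] : exists m', m = lift l m'.
  by case: (unliftP l m) ml => [m' ->|->]; [exists m'|rewrite eqxx].
pose s (i : 'I_2) := lift l (lift m' i).
have s_inj : injective s by move=> i j /lift_inj/lift_inj.
rewrite -(card_expo (fun n => n <= k)%N s_inj); apply: eq_card => b; rewrite !inE /nodes.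
rewrite andbACA andbb; congr (_ && _); apply/andP/forallP => [[bl bm] j|H].
  apply/implyP => jl; have [->//|jl'] := eqVneq j l.
  case: (unliftP l j) jl' jl => [j' ->|->]; last by rewrite eqxx.
  move=> _; case: (unliftP m' j') => [i ->|->]; last by rewrite -mE.
  by rewrite -/(s i) codom_f.
split; [have := H l|have := H m] => /implyP; apply; apply/codomP => -[i /eqP].
  by rewrite (negbTE (neq_lift _ _)).
by rewrite mE (inj_eq (@lift_inj _ l)) (negbTE (neq_lift _ _)).
Qed.
End NodeCount.

(** * Spaces cut out by independent linear conditions *)

Section Constraints.
Context {R : realType}.

(** A proper image would be annihilated by a nonzero linear form, which is found in the kernel of
    the matrix of a basis of the image. *)
Lemma limg_full (V : vectType R) (J : finType) (f : 'Hom(V, {ffun J -> R^o})) :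
  (forall y : J -> R, (forall c, \sum_j y j * f c j = 0) -> forall j, y j = 0) ->
  \dim (limg f) = #|J|.
Proof.
move=> H; apply/eqP; rewrite eqn_leq; apply/andP; split.
  by apply: leq_trans (dimvS (subvf _)) _; rewrite dimvf /dim /= muln1.
rewrite leqNgt; apply/negP => lt.
pose M : 'M[R]_(\dim (limg f), #|J|) :=
  \matrix_(i, j) ((vbasis (limg f))`_i : {ffun J -> R^o}) (enum_val j).
have : kermx M^T != 0.
  rewrite -mxrank_eq0 mxrank_ker mxrank_tr subn_eq0 -ltnNge.
  exact: leq_ltn_trans (rank_leq_row M) lt.
move=> /rowV0Pn[u /sub_kermxP uM /eqP]; apply; apply/rowP => j; rewrite mxE -[j]enum_valK.
apply: (H (fun j => u 0 (enum_rank j)) _ (enum_val j)) => c.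
have /coord_vbasis -> : f c \in limg f by rewrite memv_img// memvf.
under eq_bigr do rewrite sum_ffunE mulr_sumr.
rewrite exchange_big big1 => //= i _; have /matrixP/(_ 0 i) := uM; rewrite mxE [RHS]mxE => E.
rewrite (eq_bigr (fun j => coord (vbasis (limg f)) i (f c) *
    (u 0 (enum_rank j) * ((vbasis (limg f))`_i : {ffun J -> R^o}) j))); last first.
  by move=> j' _; rewrite ffunE /GRing.scale /=; ring.
rewrite -mulr_sumr [X in _ * X](_ : _ = 0) ?mulr0// -[RHS]E.
rewrite (reindex (@enum_val J predT)) /=; last exact/onW_bij/enum_val_bij.
by apply: eq_bigr => j' _; rewrite !mxE enum_valK.
Qed.

Lemma constraints_dim (K J : finType) (F : {ffun K -> R^o} -> J -> R) :
  (forall a c d j, F (a *: c + d) j = a * F c j + F d j) ->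
  (forall y : J -> R, (forall c, \sum_j y j * F c j = 0) -> forall j, y j = 0) ->
  exists S : {vspace {ffun K -> R^o}},
    (forall c, c \in S <-> forall j, F c j = 0) /\ (\dim S + #|J| = #|K|)%N.
Proof.
move=> FL H; pose G (c : {ffun K -> R^o}) : {ffun J -> R^o} := [ffun j => F c j].
have GL : linear G by move=> a c d; apply/ffunP => j; rewrite !ffunE FL.
pose L : {linear {ffun K -> R^o} -> {ffun J -> R^o}} :=
  HB.pack G (GRing.isLinear.Build _ _ _ _ G GL).
have LE c j : linfun L c j = F c j by rewrite lfunE /= ffunE.
exists (lker (linfun L)); split=> [c|].
  rewrite memv_ker; split=> [/eqP E j|E]; first by rewrite -LE E ffunE.
  by apply/eqP; apply/ffunP => j; rewrite LE E ffunE.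
rewrite -(@limg_full _ _ (linfun L)); last first.
  by move=> y Hy; apply: H => c; rewrite -[RHS](Hy c); apply: eq_bigr => j _; rewrite LE.
rewrite -[X in (\dim X + _)%N]capfv limg_ker_dim dimvf /dim /= muln1//.
Qed.
End Constraints.

(** The conditions list each interior face once, with [l < m], whereas a single piece [l0] sees its
    faces from its own side; this passes between the two sums. *)
Lemma sum_ordered_pairs (R : realType) (l0 : 'I_4) (g : 'I_4 -> R) :
  \sum_(m | m != l0) g m =
  \sum_(l : 'I_4) \sum_(m : 'I_4 | (l < m)%N) ((l == l0)%:R * g m + (m == l0)%:R * g l).
Proof.
rewrite big_mkcond; under [RHS]eq_bigr do rewrite big_mkcond.
by elim/ord4P: l0; rewrite !big4 /=; ring.
Qed.

Section BubbleDim.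
Context {R : realType}.
Notation point3 := 'cV[R]_3.
Variable v : 'I_4 -> point3.
Hypothesis iv : indep v.
Variable k : nat.
Hypothesis k1 : (1 <= k)%N.
Implicit Types (l m : 'I_4) (b : expo k).

(** Indices of the conditions: an interior face, taken once thanks to the strict inequality, or a
    boundary face, together with an exponent alive on it. Each index stands for three scalar
    equations. *)
Let JA : finType := {t : 'I_4 * 'I_4 * expo k | [&& (t.1.1 < t.1.2)%N, nodes t.1.1 t.2 & nodes t.1.2 t.2]}.
Let JB : finType := {p : 'I_4 * expo k | nodes p.1 p.2 && ((\sum_j p.2 j)%N == k)}.

Lemma card_node : #|node k| = (4 * 'C(k + 3, 3))%N.
Proof.
rewrite card_sig -sum1_card -(pair_big_dep predT (fun l b => nodes l b) (fun _ _ => 1%N)) /=.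
under eq_bigr do rewrite sum1dep_card card_nodes.
by rewrite sum_nat_const card_ord.
Qed.

Let card_JA : #|JA| = (6 * 'C(k + 2, 2))%N.
Proof.
rewrite card_sig -sum1_card.
rewrite -(pair_big_dep predT (fun (p : 'I_4 * 'I_4) b => [&& (p.1 < p.2)%N, nodes p.1 b & nodes p.2 b]) (fun _ _ => 1%N)) /=.
rewrite (eq_bigr (fun p : 'I_4 * 'I_4 => ((p.1 < p.2) * 'C(k + 2, 2))%N)); last first.
  move=> [l m] _ /=; case: ltnP => lm /=; last by rewrite big_pred0.
  by rewrite sum1dep_card card_common_nodes ?mul1n// gt_eqF.
rewrite -big_distrl /=; congr (_ * _)%N.
rewrite -(pair_bigA _ (fun l m : 'I_4 => (l < m)%N : nat)) /=.
by rewrite !big_ord_recl !big_ord0.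
Qed.

Let card_JB : #|JB| = (4 * 'C(k + 2, 2))%N.
Proof.
rewrite card_sig -sum1_card.
rewrite -(pair_big_dep predT (fun l b => nodes l b && ((\sum_j b j)%N == k)) (fun _ _ => 1%N)) /=.
under eq_bigr do rewrite sum1dep_card card_top_nodes.
by rewrite sum_nat_const card_ord.
Qed.

(** [E] may span all matrices or only the symmetric ones. The extra conditions [psi], absent or the
    mean of [vskw], vanish on symmetric coefficients, so the multipliers of the faces can be shown
    to be 0 first, with symmetric tests, before those of [psi]. *)
Variables (I : finType) (E : I -> 'M[R]_3).
Notation coef := {ffun node k * I -> R^o}.
Hypothesis E_sym : forall S : 'M[R]_3, S^T = S -> exists a : I -> R, S = \sum_e a e *: E e.
Variables (e : nat) (psi : coef -> 'I_e -> R).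
Hypothesis psiL : forall a c d j, psi (a *: c + d) j = a * psi c j + psi d j.
Hypothesis psi_sym : forall c, (forall l b, nodes l b -> (cf E c l b)^T = cf E c l b) ->
  forall j, psi c j = 0.
Hypothesis psi_free : forall y : 'I_e -> R, (forall c, \sum_j y j * psi c j = 0) -> forall j, y j = 0.

Let gA (C : 'I_4 -> expo k -> 'M[R]_3) l m b := (C l b - C m b) *m (grad v m - grad v l).

Let F (c : coef) (j : (JA + JB) * 'I_3 + 'I_e) : R :=
  match j with
  | inl (inl t, i) => gA (cf E c) (val t).1.1 (val t).1.2 (val t).2 i 0
  | inl (inr p, i) => (cf E c (val p).1 (val p).2 *m grad v (val p).1) i 0
  | inr j => psi c j
  end.

Let FL a c d j : F (a *: c + d) j = a * F c j + F d j.
Proof.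
case: j => [[[t|p] i]|j] /=; last exact: psiL.
- rewrite /gA !cfP.
  have -> (A B A' B' : 'M[R]_3) : a *: A + B - (a *: A' + B') = a *: (A - A') + (B - B').
    by rewrite scalerBr opprD addrACA.
  by rewrite mulmxDl -scalemxAl; move: (_ *m _) (_ *m _) => X X'; rewrite !mxE.
- by rewrite cfP mulmxDl -scalemxAl; move: (_ *m _) (_ *m _) => X X'; rewrite !mxE.
Qed.

(* Evaluated on a single node, the relation says that the multipliers of that
   node satisfy the hypotheses of [nodal_injective]. *)
Let F_free (y : (JA + JB) * 'I_3 + 'I_e -> R) : (forall c, \sum_j y j * F c j = 0) -> forall j, y j = 0.
Proof.
move=> H; pose Yt (t : JA) : point3 := \col_i y (inl (inl t, i)).
pose Yb (p : JB) : point3 := \col_i y (inl (inr p, i)).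
have HE c : \sum_t dot (Yt t) (gA (cf E c) (val t).1.1 (val t).1.2 (val t).2)
    + \sum_p dot (Yb p) (cf E c (val p).1 (val p).2 *m grad v (val p).1)
    + \sum_j y (inr j) * psi c j = 0.
  rewrite -[RHS](H c) big_sumType; congr (_ + _).
  transitivity (\sum_s \sum_i y (inl (s, i)) * F c (inl (s, i))); last first.
    by rewrite pair_bigA; apply: eq_bigr => -[].
  rewrite big_sumType /=.
  by congr (_ + _); apply: eq_bigr => t _; rewrite /dot; apply: eq_bigr => i _; rewrite mxE.
pose YA l m b : point3 := if insub (l, m, b) is Some t then Yt t else
  if insub (m, l, b) is Some t then Yt t else 0.
have YAt (t : JA) : YA (val t).1.1 (val t).1.2 (val t).2 = Yt t.
  by rewrite /YA -!surjective_pairing valK.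
have YAs l m b : YA l m b = YA m l b.
  rewrite /YA; case: insubP => [t /and3P[/= lm _ _] _|_]; last by case: insubP.
  by rewrite insubN// negb_and -leqNgt ltnW.
have YA0 l m b : ~~ (nodes l b && nodes m b) -> YA l m b = 0.
  move=> N; rewrite /YA; case: insubP => [t /and3P[/= _ bl bm] _|_]; first by rewrite bl bm in N.
  by case: insubP => [t /and3P[/= _ bm bl] _|//]; rewrite bl bm in N.
pose YB l b : point3 := if insub (l, b) is Some p then Yb p else 0.
have YBp (p : JB) : YB (val p).1 (val p).2 = Yb p by rewrite /YB -surjective_pairing valK.
have YB0 l b : ~~ (nodes l b && ((\sum_j b j)%N == k)) -> YB l b = 0.
  by move=> N; rewrite /YB insubN.
have key l0 b0 (S : 'M[R]_3) : nodes l0 b0 -> S^T = S ->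
    \sum_(m | m != l0) dot (YA l0 m b0) (S *m (grad v m - grad v l0))
      + dot (YB l0 b0) (S *m grad v l0) = 0.
  move=> n0 /[dup] sS /E_sym[a SE].
  pose C l b : 'M[R]_3 := if (l == l0) && (b == b0) then S else 0.
  have [|c {}cE] := @coef_of R k 3 3 I E C.
    move=> l b _; rewrite /C; case: ifP => _; first by exists a.
    by exists (fun _ => 0); rewrite big1// => i _; rewrite scale0r.
  have {cE}cE l b : nodes l b -> cf E c l b = if (l == l0) && (b == b0) then S else 0 by exact: cE.
  have := HE c; rewrite [X in _ + X]big1 ?addr0; last first.
    move=> j _; rewrite psi_sym ?mulr0// => l b lb; rewrite cE//.
    by case: ifP => // _; rewrite trmx0.
  move=> E0; rewrite -[RHS]E0 {E0}; congr (_ + _).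
  - pose g m := dot (YA l0 m b0) (S *m (grad v m - grad v l0)).
    transitivity (\sum_(l : 'I_4) \sum_(m : 'I_4 | (l < m)%N) ((l == l0)%:R * g m + (m == l0)%:R * g l)).
      exact: sum_ordered_pairs.
    transitivity (\sum_(t : 'I_4 * 'I_4 * expo k | (t.1.1 < t.1.2)%N)
        dot (YA t.1.1 t.1.2 t.2) (gA (cf E c) t.1.1 t.1.2 t.2)).
      rewrite -(pair_big_dep predT (fun (p : 'I_4 * 'I_4) _ => (p.1 < p.2)%N)
        (fun p b => dot (YA p.1 p.2 b) (gA (cf E c) p.1 p.2 b))) /=.
      rewrite -(pair_bigA _ (fun l m : 'I_4 => \sum_(b | (l < m)%N) dot (YA l m b) (gA (cf E c) l m b))) /=.
      apply: eq_bigr => l _; rewrite big_mkcond; apply: eq_bigr => m _.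
      case: ifP => lm; last by rewrite big_pred0.
      rewrite (bigD1 b0)//= [X in _ = _ + X]big1 ?addr0; last first.
        move=> b /negbTE bb; have [/andP[bl bm]|N] := boolP (nodes l b && nodes m b); last by rewrite YA0// dot0l.
        by rewrite /gA !cE// bb !andbF subrr mul0mx dot0r.
      have [/andP[bl bm]|N] := boolP (nodes l b0 && nodes m b0).
        rewrite /gA !cE// eqxx !andbT; case: (eqVneq l l0) => [ll|ll].
          rewrite (_ : (m == l0) = false); last by rewrite -ll gt_eqF.
          by rewrite subr0 /g ll mul1r mul0r addr0.
        case: (eqVneq m l0) => [mm|mm]; last by rewrite !mul0r addr0 subrr mul0mx dot0r.
        rewrite mul0r add0r mul1r sub0r /g mm YAs -[grad v l - _]opprB mulmxN mulNmx//.
      rewrite YA0// dot0l; case: (eqVneq l l0) => [ll|ll].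
        rewrite (_ : (m == l0) = false); last by rewrite -ll gt_eqF.
        by rewrite /g -ll YA0// dot0l mulr0 mul0r addr0.
      case: (eqVneq m l0) => [mm|mm]; last by rewrite !mul0r addr0.
      by rewrite mul0r add0r mul1r /g -mm YAs YA0// dot0l.
    rewrite (bigID [pred t : 'I_4 * 'I_4 * expo k | nodes t.1.1 t.2 && nodes t.1.2 t.2]) /=.
    rewrite [X in _ + X]big1 ?addr0; last by move=> t /andP[_ N]; rewrite YA0// dot0l.
    pose G (t : 'I_4 * 'I_4 * expo k) := dot (YA t.1.1 t.1.2 t.2) (gA (cf E c) t.1.1 t.1.2 t.2).
    by rewrite (big_sub _ G) /=; apply: eq_bigr => t _; rewrite /G YAt.
  - pose G (p : 'I_4 * expo k) := dot (YB p.1 p.2) (cf E c p.1 p.2 *m grad v p.1).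
    transitivity (\sum_(p : 'I_4 * expo k) G p).
      rewrite (bigD1 (l0, b0))//= [X in _ + X]big1 ?addr0; first by rewrite /G cE// !eqxx.
      move=> [l b]; rewrite xpair_eqE => /negbTE N; rewrite /G /=.
      have [bl|bl] := boolP (nodes l b); last by rewrite YB0 ?(negbTE bl)// dot0l.
      by rewrite cE// N mul0mx dot0r.
    rewrite (bigID [pred p : 'I_4 * expo k | nodes p.1 p.2 && ((\sum_j p.2 j)%N == k)]) /=.
    rewrite [X in _ + X]big1 ?addr0; last by move=> p N; rewrite /G YB0// dot0l.
    by rewrite (big_sub _ G) /=; apply: eq_bigr => p _; rewrite /G YBp.
have zero b : (forall l m, m != l -> YA l m b = 0) /\ forall l, YB l b = 0.
  apply: (nodal_injective iv) => [l m|l x x'|]; first exact: YAs.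
  - have [n0|n0] := boolP (nodes l b); last first.
      rewrite YB0 ?(negbTE n0)// !dot0l !mul0r addr0 big1 ?addr0// => m _.
      by rewrite YA0 ?(negbTE n0)// !dot0l !mul0r addr0.
    have sS : (x *m x'^T + x' *m x^T)^T = x *m x'^T + x' *m x^T.
      by rewrite linearD /= !trmx_mul !trmxK addrC.
    have SE (u w : point3) : dot u ((x *m x'^T + x' *m x^T) *m w) = dot u x * dot w x' + dot u x' * dot w x.
      have P (s t : point3) : s *m t^T *m w = dot w t *: s.
        rewrite -mulmxA [t^T *m w]mx11_scalar mul_mx_scalar; congr (_ *: _).
        by rewrite mxE; apply: eq_bigr => i _; rewrite mxE mulrC.
      by rewrite mulmxDl !P dotDr !dotZr; ring.
    have := key l b _ n0 sS; rewrite SE; under eq_bigr do rewrite SE; exact.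
  (* If b_p > 0, then [b] is not a node of the piece [p], whose multipliers are therefore 0. If b =
     0, its degree differs from k >= 1 and there is no boundary condition. *)
  - have [/existsP[p bp]|/existsPn Z] := boolP [exists p, (b p : nat) != 0%N].
      right; exists p; split=> [l|]; first by apply: YA0; rewrite /nodes (negbTE bp) andbF.
      by apply: YB0; rewrite /nodes (negbTE bp).
    left=> l; apply: YB0; rewrite big1 ?(ltn_eqF k1) ?andbF//.
    by move=> j _; apply/eqP; have := Z j; rewrite negbK.
have y1 t i : y (inl (inl t, i)) = 0.
  have := congr1 (fun u : point3 => u i 0) (YAt t); rewrite (zero (val t).2).1 ?mxE//.
  by have /and3P[lm _ _] := valP t; rewrite gt_eqF.
have y2 p i : y (inl (inr p, i)) = 0.
  by have := congr1 (fun u : point3 => u i 0) (YBp p); rewrite (zero (val p).2).2 !mxE.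
move=> [[[t|p] i]|j]; [exact: y1|exact: y2|].
have Y1 t : Yt t = 0 by apply/colP => i; rewrite mxE y1 mxE.
have Y2 p : Yb p = 0 by apply/colP => i; rewrite mxE y2 mxE.
apply: (psi_free (y := fun j => y (inr j))) => c; rewrite -[RHS](HE c).
rewrite [X in _ = X + _ + _]big1 => [|t _]; last by rewrite Y1 dot0l.
by rewrite [X in _ = _ + X + _]big1 ?add0r// => p _; rewrite Y2 dot0l.
Qed.

(** Here 30 is 3 times the 6 + 4 interior and boundary faces, each with one condition for every
    monomial of degree [k] in three variables. *)
Lemma compatible_dim : exists S : {vspace coef},
  (forall c, c \in S <-> compatible v (cf E c) /\ forall j, psi c j = 0) /\
  (\dim S + (30 * 'C(k + 2, 2) + e) = 4 * 'C(k + 3, 3) * #|I|)%N.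
Proof.
have [S [SP dS]] := constraints_dim FL F_free.
exists S; split; last first.
  move: dS; rewrite card_prod card_node => <-.
  by rewrite card_sum card_prod card_sum !card_ord card_JA card_JB; congr (_ + (_ + _))%N; ring.
move=> c; split=> [/SP H|[[Ci Cb] Hp]].
  split; last by move=> j; exact: (H (inr j)).
  have lt l m b : (l < m)%N -> nodes l b -> nodes m b -> gA (cf E c) l m b = 0.
    move=> lm bl bm; have P : [&& (l < m)%N, nodes l b & nodes m b] by rewrite lm bl.
    by apply/colP => i; have := H (inl (inl (exist _ (l, m, b) P), i)); rewrite /= => ->; rewrite mxE.
  split=> [l m b ml bl bm|l b bl bk].
    have [lm|lm|/val_inj E0] := ltngtP l m; first exact: lt.
      have := lt m l b lm bm bl; rewrite /gA => Z.
      by rewrite -[grad v m - _]opprB -[cf E c l b - _]opprB mulmxN mulNmx opprK.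
    by rewrite E0 eqxx in ml.
  have P : nodes l b && ((\sum_j b j)%N == k) by rewrite bl bk eqxx.
  by apply/colP => i; have := H (inl (inr (exist _ (l, b) P), i)); rewrite /= => ->; rewrite mxE.
apply/SP => -[[[t|p] i]|j] //=.
- have /and3P[lm bl bm] := valP t; rewrite /gA Ci ?mxE//.
  by rewrite gt_eqF.
- by have /andP[bl /eqP bk] := valP p; rewrite Cb ?mxE.
Qed.
End BubbleDim.

(** * Dimensions of the three spaces *)

Section Spaces.
Context {R : realType}.
Notation point3 := 'cV[R]_3.
Variable v : 'I_4 -> point3.
Hypothesis iv : indep v.
Notation T := (tetra v).

Lemma Pdisc_patchwork m n r (X : set 'M[R]_(m, n)) u : Pdisc v r X u ->
  exists C : 'I_4 -> expo r -> 'M[R]_(m, n), rep v u (patchwork v C).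
Proof.
move=> [_ /choice[p pP]].
have [C CE] := @pf_patchworkP _ v iv r m n (fun l x => \matrix_(i, j) mpoly.meval (fun s => x s 0) (p l i j))
  (fun l i j => pf_ext (fun x => esym (mxE _ _ _ _)) (mpoly_pf ((pP l).1 i j))).
by exists C => l; apply: ae_onW (pP l).2 => x _ ->; rewrite -CE.
Qed.

Lemma patchwork_Pdisc m n r (X : set 'M[R]_(m, n)) u (Z : 'I_4 -> point3 -> 'M[R]_(m, n)) :
  L2 T X u -> (forall l i j, pf r (fun x => Z l x i j)) -> rep v u Z -> Pdisc v r X u.
Proof.
move=> u2 pZ uZ; split => // l.
have /choice[p pP] : forall q : 'I_m * 'I_n, exists p : mpoly.mpoly 3 R,
    poly_deg_le r p /\ (fun x => Z l x q.1 q.2) = fun x => mpoly.meval (fun s => x s 0) p.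
  by move=> q; exact: pf_mpoly.
exists (fun i j => p (i, j)); split=> [i j|]; first exact: (pP (i, j)).1.
apply: ae_onW (uZ l) => x _ ->; apply/matrixP => i j; rewrite mxE.
by have /(congr1 (fun f : point3 -> R => f x)) := (pP (i, j)).2.
Qed.

Lemma sym_patchwork r u (C : 'I_4 -> expo r -> 'M[R]_3) : L2 T (@sym_mx R) u ->
  rep v u (patchwork v C) -> forall l b, nodes l b -> (C l b)^T = C l b.
Proof.
move=> [symu _] uC l b bl; apply/esym/subr0_eq.
apply: (@patchwork_free R v iv r 3 3 (fun l b => C l b - (C l b)^T) l) => // x x0.
have PE y : patchwork v (fun l b => C l b - (C l b)^T) l y = patchwork v C l y - (patchwork v C l y)^T.
  rewrite /patchwork linear_sum /= -sumrB; apply: eq_bigr => b' _.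
  by rewrite linearZ /= scalerBr.
apply/matrixP => i j; rewrite [RHS]mxE.
apply: (ae_tetra_eq0 (f := fun y => patchwork v (fun l b => C l b - (C l b)^T) l y i j) (indep_alf iv l)) => //.
  exact/smooth_continuous/patchwork_smooth.
apply: ae_onW (uC l) => y Ty E; rewrite PE -E.
by rewrite (symu y) ?subrr ?mxE//; exact: alfeld_sub Ty.
Qed.

Lemma field_rep m n k (I : finType) (E : I -> 'M[R]_(m, n)) (c : {ffun node k * I -> R^o}) :
  rep v (field v E c) (patchwork v (cf E c)).
Proof. exact: rep_glue. Qed.

Lemma field_Pdisc m n k (I : finType) (E : I -> 'M[R]_(m, n)) (X : set 'M[R]_(m, n))
    (c : {ffun node k * I -> R^o}) : (forall l x, X (patchwork v (cf E c) l x)) ->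
  Pdisc v k X (field v E c).
Proof.
move=> XZ; apply: patchwork_Pdisc (field_rep E c).
  by apply: L2_glue => // l i j; exact/smooth_continuous/patchwork_smooth.
by move=> l i j; exact: pf_patchwork.
Qed.

Section Bubbles.
Variables (k : nat) (X : set 'M[R]_3).

Lemma compatible_bubble (C : 'I_4 -> expo k -> 'M[R]_3) tau : L2 T X tau ->
  rep v tau (patchwork v C) -> compatible v C -> Hdiv0 T X tau.
Proof.
move=> t2 tC cC; have sC l i j := @patchwork_smooth R v k 3 3 C l i j.
by have [_] := bubble_intro iv t2 tC sC (L2_pdiv iv sC) (rep_glue iv _) (compatible_faces iv cC).
Qed.

Lemma bubble_compatible (C : 'I_4 -> expo k -> 'M[R]_3) tau :
  rep v tau (patchwork v C) -> Hdiv0 T X tau -> compatible v C.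
Proof.
move=> tC t0; have [[t2 [g dg]] _] := t0; have sC l i j := @patchwork_smooth R v k 3 3 C l i j.
have [_ G] := bubble_elim iv t2 tC sC t0 dg.
apply: (faces_compatible iv) => i; apply: (green_face_conditions iv); last exact: G.
by move=> l j; rewrite /mrow; under eq_fun do rewrite mxE; exact: sC.
Qed.
End Bubbles.

Let delta_E (i : 'I_3) : point3 := delta_mx i 0.

Lemma dim_vec k : L2dim T (@Pdisc R 3 1 v k setT) (4 * 'C(k + 3, 3) * 3).
Proof.
have spanE (A : point3) : A = \sum_i A i 0 *: delta_E i.
  by rewrite {1}[A]matrix_sum_delta; apply: eq_bigr => i _; rewrite big_ord1.
have freeE (a : 'I_3 -> R) : \sum_i a i *: delta_E i = 0 -> forall i, a i = 0.
  move=> /colP H i; have := H i; rewrite mxE summxE (bigD1 i)//= !mxE !eqxx mulr1 big1 ?addr0//.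
  by move=> j ji; rewrite !mxE eq_sym (negbTE ji) mulr0.
have := @L2dim_coef R v iv k 3 1 'I_3 delta_E freeE (@Pdisc R 3 1 v k setT) fullv.
rewrite dimvf /dim /= muln1 card_prod card_node card_ord; apply.
  by move=> c _; exact: field_Pdisc.
move=> u uP; have [C uC] := Pdisc_patchwork uP.
have [l b _|c cC] := @coef_of R k 3 1 'I_3 delta_E C; first by exists (fun i => C l b i 0).
exists c; first exact: memvf.
by move=> l; apply: ae_onW (uC l) => x _ ->; apply: eq_patchwork => b bl; rewrite cC.
Qed.

Section Dimension.
Variable k : nat.
Hypothesis k1 : (1 <= k)%N.

Definition sym_E (q : 'I_3 + 'I_3) : 'M[R]_3 :=
  match q with
  | inl i => delta_mx i i
  | inr i => delta_mx (i + 1) (i + 2) + delta_mx (i + 2) (i + 1)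
  end.

(** The three indices add up to 0 modulo 3, so [- (i + j)] is the index different from [i] and
    [j]. *)
Let sum_sym_E (a : 'I_3 + 'I_3 -> R) : \sum_q a q *: sym_E q = \matrix_(i, j)
   if i == j then a (inl i) else a (inr (- (i + j))).
Proof.
rewrite big_sumType /=; apply/matrixP => i j; rewrite !big3 !mxE /=.
by elim/ord3P: i; elim/ord3P: j; rewrite /=; (have E := erefl true);
  rewrite ?(mulr1, mulr0, addr0, add0r); congr (a (_ _)); apply/val_inj.
Qed.

Lemma sym_E_span (S : 'M[R]_3) : S^T = S -> exists a, S = \sum_q a q *: sym_E q.
Proof.
move=> sS; exists (fun q => match q with inl i => S i i | inr i => S (i + 1) (i + 2) end).
have ss i j : S i j = S j i by rewrite -{1}sS mxE.
rewrite sum_sym_E; apply/matrixP => i j; rewrite mxE.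
have P (a b c d : 'I_3) : ((a == c) && (b == d)) || ((a == d) && (b == c)) -> S a b = S c d.
  by case/orP => /andP[/eqP-> /eqP->].
by case: eqP => [->//|]; elim/ord3P: i; elim/ord3P: j => // _; apply: P.
Qed.

Lemma sym_E_free a : \sum_q a q *: sym_E q = 0 -> forall q, a q = 0.
Proof.
rewrite sum_sym_E => /matrixP H [i|i]; first by have := H i i; rewrite !mxE eqxx.
have := H (i + 1) (i + 2); rewrite !mxE; elim/ord3P: i => /= <-; congr (a (inr _)); exact/val_inj.
Qed.

Lemma sym_E_sym a : (\sum_q a q *: sym_E q)^T = \sum_q a q *: sym_E q.
Proof. rewrite sum_sym_E; apply/matrixP => i j; rewrite !mxE [j + i]addrC [j == i]eq_sym.
by case: eqP => // ->.
Qed.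

Lemma dim_sym : exists2 d, L2dim T (Bdiv_S v k) d &
  (d + 30 * 'C(k + 2, 2) = 4 * 'C(k + 3, 3) * 6)%N.
Proof.
have [||y _ []//|S [SP]] := @compatible_dim R v iv k k1 _ sym_E sym_E_span 0 (fun _ _ => 0) => //.
  by move=> a _ _ _; rewrite mulr0 addr0.
rewrite addn0 card_sum !card_ord => dS; exists (\dim S) => //.
have cs c l b : (cf sym_E c l b)^T = cf sym_E c l b by exact: sym_E_sym.
apply: (L2dim_coef iv sym_E_free) => [c /SP[cC _]|u [uP u0]].
  have P : Pdisc v k (@sym_mx R) (field v sym_E c).
    apply: field_Pdisc => l x; rewrite /sym_mx /patchwork /= linear_sum /=.
    by apply: eq_bigr => b _; rewrite linearZ /= cs.
  by split=> //; apply: compatible_bubble (field_rep _ _) cC; have [] := P.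
have [C uC] := Pdisc_patchwork uP.
have sC := sym_patchwork uP.1 uC.
have [l b bl|c cC] := @coef_of R k 3 3 _ sym_E C; first by apply: sym_E_span; exact: sC.
have uc : rep v u (patchwork v (cf sym_E c)).
  by move=> l; apply: ae_onW (uC l) => x _ ->; apply: eq_patchwork => b bl; rewrite cC.
exists c => //; apply/SP; split => //; exact: bubble_compatible uc u0.
Qed.

Let all_E (p : 'I_3 * 'I_3) : 'M[R]_3 := delta_mx p.1 p.2.

Let all_E_sum (a : 'I_3 * 'I_3 -> R) : \sum_p a p *: all_E p = \matrix_(i, j) a (i, j).
Proof.
rewrite [RHS]matrix_sum_delta pair_bigA; apply: eq_bigr => -[i j] _ /=.
by rewrite mxE.
Qed.

Let all_E_span (A : 'M[R]_3) : exists a, A = \sum_p a p *: all_E p.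
Proof.
by exists (fun p => A p.1 p.2); rewrite all_E_sum; apply/matrixP => i j; rewrite mxE.
Qed.

Let vskwL a (A B : 'M[R]_3) i : vskw (a *: A + B) i 0 = a * vskw A i 0 + vskw B i 0.
Proof. by rewrite !mxE; ring. Qed.

Let smooth_vskw (C : 'I_4 -> expo k -> 'M[R]_3) l i :
  smooth (fun x => vskw (patchwork v C l x) i 0).
Proof.
rewrite (_ : (fun x => _) = fun x => 2^-1 * (patchwork v C l x (i + 2) (i + 1)
    + -1 * patchwork v C l x (i + 1) (i + 2))).
  apply: smoothM; first exact: smooth_cst.
  apply: smoothD; first exact: patchwork_smooth.
  by apply: smoothM; [exact: smooth_cst|exact: patchwork_smooth].
by apply/funext => x; rewrite mxE; ring.
Qed.

Let mean_vskw (C : 'I_4 -> expo k -> 'M[R]_3) i : R :=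
  \sum_l integral3 (alfeld v l) (fun x => vskw (patchwork v C l x) i 0).

Let mean_vskwE tau (C : 'I_4 -> expo k -> 'M[R]_3) (X : set 'M[R]_3) i : L2 T X tau ->
  rep v tau (patchwork v C) -> integral3 T (fun x => vskw (tau x) i 0) = mean_vskw C i.
Proof.
move=> t2 tC; apply: (integral_rep iv (f := fun x => vskw (tau x) i 0)).
- have I1 a b : leb3.-integrable ((@pt3 R) @^-1` T) (EFin \o (fun z => tau (pt3 z) a b)).
    have := integrable_L2_cont iv a b t2 (@contC R _ 1).
    by apply: eq_integrable => [|z _ /=]; [exact: measurable_tetra|rewrite mulr1].
  have := integrableZl (measurable_tetra iv) 2^-1
    (integrableB (measurable_tetra iv) (I1 (i + 2) (i + 1)) (I1 (i + 1) (i + 2))).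
  by apply: eq_integrable => [|z _ /=]; [exact: measurable_tetra|rewrite mxE].
- by move=> l; exact/smooth_continuous/smooth_vskw.
- by move=> l; apply: ae_onW (tC l) => x _ ->.
Qed.

Let mean_vskwL a (c d : {ffun node k * ('I_3 * 'I_3) -> R^o}) i :
  mean_vskw (cf all_E (a *: c + d)) i = a * mean_vskw (cf all_E c) i + mean_vskw (cf all_E d) i.
Proof.
rewrite /mean_vskw mulr_sumr -big_split /=; apply: eq_bigr => l _.
have cv (c' : {ffun node k * ('I_3 * 'I_3) -> R^o}) : continuous (fun x => vskw (patchwork v (cf all_E c') l x) i 0).
  exact/smooth_continuous/smooth_vskw.
have il := indep_alf iv l.
rewrite -int3Z// -int3D//; last by apply: contM; [exact: contC|exact: cv].
congr integral3; apply/funext => x; rewrite -vskwL; congr (vskw _ i 0).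
rewrite /patchwork scaler_sumr -big_split /=; apply: eq_bigr => b _.
by rewrite cfP scalerDr !scalerA mulrC.
Qed.

(** Give the matrix [A], chosen so that its [vskw] is [y], to the k-th power of the barycenter's
    coordinate on the piece 0. The relation becomes |y|^2 times the nonzero integral of that
    power. *)
Let mean_vskw_free (y : 'I_3 -> R) :
  (forall c, \sum_j y j * mean_vskw (cf all_E c) j = 0) -> forall j, y j = 0.
Proof.
move=> H; pose A : 'M[R]_3 := \matrix_(a, b) if a == b + 1 then 2 * y (a + 1) else 0.
have vA i : vskw A i 0 = y i.
  rewrite !mxE; elim/ord3P: i => /=; rewrite subr0 mulrA mulVf ?mul1r ?pnatr_eq0//;
    congr y; exact/val_inj.
pose b0 : expo k := [ffun _ => ord0].
have b0l l : nodes l b0 by rewrite /nodes ffunE big1// => j _; rewrite ffunE.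
pose C (l : 'I_4) (b : expo k) : 'M[R]_3 := if (l == 0) && (b == b0) then A else 0.
have [l b _|c cC] := @coef_of R k 3 3 _ all_E C; first exact: all_E_span.
pose f x := bern 0 b0 (bar (alf v 0) ^~ x) : R.
have i0 := indep_alf iv 0.
have fE x : f x = bar (alf v 0) 0 x ^+ k.
  rewrite /f /bern /mono big1 ?subn0 => [|j _]; last by rewrite ffunE.
  by rewrite big1 ?mulr1// => j _; rewrite ffunE expr0.
have cf0 : continuous f.
  rewrite (_ : f = fun x => bar (alf v 0) 0 x ^+ k); last exact/funext.
  apply: smooth_continuous; have := pf_smooth (pf_exp k (pf_affine (grad (alf v 0) 0) (bar (alf v 0) 0 0))).
  by congr smooth; apply/funext => x; rewrite [in RHS]barE.
have E i : mean_vskw (cf all_E c) i = integral3 (alfeld v 0) f * y i.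
  rewrite /mean_vskw (bigD1 0)//= [X in _ + X]big1 ?addr0 => [|l l0]; last first.
    rewrite -[RHS](int3_0 (alfeld v l)); congr integral3; apply/funext => x.
    rewrite (_ : patchwork _ _ _ _ = 0); first by rewrite !mxE; ring.
    by rewrite /patchwork big1// => b bl; rewrite cC// /C (negbTE l0) scaler0.
  rewrite mulrC -int3Z//; congr integral3; apply/funext => x.
  rewrite (_ : patchwork _ _ _ _ = f x *: A).
    by rewrite -[f x *: A]addr0 vskwL vA mulrC !mxE; ring.
  rewrite /patchwork (bigD1 b0) ?b0l//= cC// /C !eqxx big1 ?addr0// => b /andP[bl /negbTE bb].
  by rewrite cC// /C bb andbF scaler0.
have f0 : integral3 (alfeld v 0) f != 0.
  apply/eqP => If; pose x := barycenter (alf v 0).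
  have x4 j : bar (alf v 0) j x = 4^-1 by exact: bar_barycenter.
  have := integral_tetra_eq0 i0 cf0 _ If (x := x).
  rewrite fE x4 => F; have /eqP : (4^-1 : R) ^+ k = 0.
    apply: F => [z /(tetraP _ i0) z0|j]; first by rewrite fE exprn_ge0.
    by rewrite x4 invr_gt0 ltr0n.
  by rewrite expf_eq0 invr_eq0 pnatr_eq0 andbF.
have /eqP : \sum_j y j * y j = 0.
  have := H c; under eq_bigr do rewrite E mulrCA.
  by rewrite -mulr_sumr => /eqP; rewrite mulf_eq0 (negbTE f0) => /eqP.
rewrite psumr_eq0 => [/allP Z j|j _]; last by rewrite -expr2 sqr_ge0.
by have := Z j (mem_index_enum j); rewrite mulf_eq0 orbb => /eqP.
Qed.

Let mean_vskw_sym c : (forall l b, nodes l b -> (cf all_E c l b)^T = cf all_E c l b) ->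
  forall i, mean_vskw (cf all_E c) i = 0.
Proof.
move=> S i; rewrite /mean_vskw big1// => l _; rewrite -[RHS](int3_0 (alfeld v l)).
congr integral3; apply/funext => x; rewrite mxE.
have /matrixP/(_ (i + 1) (i + 2)) : (patchwork v (cf all_E c) l x)^T = patchwork v (cf all_E c) l x.
  rewrite /patchwork linear_sum /=; apply: eq_bigr => b bl; by rewrite linearZ /= S.
by rewrite mxE => ->; rewrite subrr mulr0.
Qed.

Lemma dim_all : exists2 d, L2dim T (Bdiv_M v k) d &
  (d + (30 * 'C(k + 2, 2) + 3) = 4 * 'C(k + 3, 3) * 9)%N.
Proof.
have [S [SP]] := @compatible_dim R v iv k k1 _ all_E (fun A _ => all_E_span A) 3
  (fun c i => mean_vskw (cf all_E c) i) mean_vskwL mean_vskw_sym mean_vskw_free.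
rewrite card_prod !card_ord => dS; exists (\dim S) => //.
apply: (L2dim_coef (E := all_E) iv) => [a|c /SP[cC c0]|u [[uP u0] um]].
- by rewrite all_E_sum => /matrixP H [i j]; have := H i j; rewrite !mxE.
- have P : Pdisc v k setT (field v all_E c) by exact: field_Pdisc.
  split; first by split=> //; apply: compatible_bubble (field_rep _ _) cC; have [] := P.
  by move=> i; rewrite (mean_vskwE i P.1 (field_rep _ _)).
- have [C uC] := Pdisc_patchwork uP.
  have [l b _|c cC] := @coef_of R k 3 3 _ all_E C; first exact: all_E_span.
  have uc : rep v u (patchwork v (cf all_E c)).
    by move=> l; apply: ae_onW (uC l) => x _ ->; apply: eq_patchwork => b bl; rewrite cC.
  exists c => //; apply/SP; split; first exact: bubble_compatible uc u0.
  by move=> i; rewrite -(mean_vskwE i uP.1 uc).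
Qed.
End Dimension.
End Spaces.

Lemma dimension_formula (k dS dM dP : nat) :
  (dS + 30 * 'C(k + 2, 2) = 4 * 'C(k + 3, 3) * 6)%N ->
  (dM + (30 * 'C(k + 2, 2) + 3) = 4 * 'C(k + 3, 3) * 9)%N ->
  dP = (4 * 'C(k + 3, 3) * 3)%N ->
  dS%:Z = dM%:Z - dP%:Z + 3 /\
  dM%:Z - dP%:Z + 3 = (k%:Z + 1) * (k%:Z + 2) * (4 * k%:Z - 3).
Proof.
have := bin_ffact (k + 2) 2; have := bin_ffact (k + 3) 3.
move: 'C(k + 2, 2) 'C(k + 3, 3) => b a.
rewrite addn3 addn2 !ffactnS !ffactn0 !muln1 !factS fact0 => /= E3 E2 hS hM hP.
have {}E3 : (a * 6 = (k + 3) * ((k + 2) * (k + 1)))%N by rewrite addn3 addn2 addn1 -E3.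
have {}E2 : (b * 2 = (k + 2) * (k + 1))%N by rewrite addn2 addn1 -E2.
move: (congr1 Posz E3) (congr1 Posz E2) (congr1 Posz hS) (congr1 Posz hM) (congr1 Posz hP).
rewrite !(PoszD, PoszM) => Z3 Z2 HS HM HP; split; lra.
Qed.

(** * Piecewise polynomials orthogonal to the divergences of bubbles *)

Section Rigid.
Context {R : realType}.
Notation point3 := 'cV[R]_3.
Implicit Types (a b c x y : point3) (w : 'I_4 -> point3).

Lemma crossE a b : ((cross a b 0 0 = a 1 0 * b 2 0 - a 2 0 * b 1 0) *
  (cross a b 1 0 = a 2 0 * b 0 0 - a 0 0 * b 2 0) *
  (cross a b 2 0 = a 0 0 * b 1 0 - a 1 0 * b 0 0))%type.
Proof.
by split; [split|]; rewrite mxE; congr (a _ _ * b _ _ - a _ _ * b _ _); exact/val_inj.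
Qed.

Lemma dotE a b : dot a b = a 0 0 * b 0 0 + a 1 0 * b 1 0 + a 2 0 * b 2 0.
Proof. by rewrite /dot big3. Qed.

Lemma colvec_eq a b : a 0 0 = b 0 0 -> a 1 0 = b 1 0 -> a 2 0 = b 2 0 -> a = b.
Proof. by move=> ? ? ?; apply/colP; elim/ord3P. Qed.

Lemma crossDl a b c : cross (a + b) c = cross a c + cross b c.
Proof. by apply: colvec_eq; rewrite [RHS]mxE !crossE !mxE; ring. Qed.

Lemma crossDr a b c : cross c (a + b) = cross c a + cross c b.
Proof. by apply: colvec_eq; rewrite [RHS]mxE !crossE !mxE; ring. Qed.

Lemma crossZl k a b : cross (k *: a) b = k *: cross a b.
Proof. by apply: colvec_eq; rewrite [RHS]mxE !crossE !mxE; ring. Qed.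

Lemma crossZr k a b : cross a (k *: b) = k *: cross a b.
Proof. by apply: colvec_eq; rewrite [RHS]mxE !crossE !mxE; ring. Qed.

Lemma crossNl a b : cross (- a) b = - cross a b.
Proof. by rewrite -scaleN1r crossZl scaleN1r. Qed.

Lemma crossNr a b : cross a (- b) = - cross a b.
Proof. by rewrite -scaleN1r crossZr scaleN1r. Qed.

Lemma cross0l a : cross 0 a = 0.
Proof. by apply: colvec_eq; rewrite [RHS]mxE !crossE !mxE; ring. Qed.

Lemma cross0r a : cross a 0 = 0.
Proof. by apply: colvec_eq; rewrite [RHS]mxE !crossE !mxE; ring. Qed.

Lemma cross_sumr (I : Type) (s : seq I) (P : pred I) a (F : I -> point3) :
  cross a (\sum_(i <- s | P i) F i) = \sum_(i <- s | P i) cross a (F i).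
Proof.
elim: s => [|i s IH]; last by rewrite !big_cons; case: (P i); rewrite ?crossDr IH.
by rewrite !big_nil cross0r.
Qed.

Lemma dot_crossC a b c : dot (cross a b) c = dot (cross b c) a.
Proof. by rewrite !dotE !crossE; ring. Qed.

Lemma dot_crossr a b : dot (cross a b) b = 0.
Proof. by rewrite !dotE !crossE; ring. Qed.

Lemma dot_crossl a b : dot (cross a b) a = 0.
Proof. by rewrite !dotE !crossE; ring. Qed.

Lemma cross_eq0 a b : b != 0 -> cross a b = 0 -> a = (dot a b / dot b b) *: b.
Proof.
move=> b0 ab; have bb : dot b b != 0 by apply: contra_neq b0; exact: dot_eq0.
have E : cross b (cross a b) = dot b b *: a - dot a b *: b.
  by apply: colvec_eq; rewrite !crossE !mxE !dotE; ring.
have /esym/subr0_eq : 0 = dot b b *: a - dot a b *: b.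
  by rewrite -E ab cross0r.
by move=> /(congr1 (fun u => (dot b b)^-1 *: u)); rewrite !scalerA mulVf// scale1r mulrC.
Qed.

Lemma skew_cross (A : 'M[R]_3) : (forall y, dot y (A *m y) = 0) ->
  exists b, forall y, A *m y = cross b y.
Proof.
move=> H; have AT : A^T = - A.
  have B x y : dot x (A *m y) + dot y (A *m x) = 0.
    have := H (x + y); rewrite mulmxDr !dotDl !dotDr !H add0r addr0 => E.
    by rewrite -[RHS]E.
  have dlt i (u : point3) : dot (delta_mx i 0) u = u i 0.
    rewrite /dot (bigD1 i)//= mxE !eqxx mul1r big1 ?addr0// => j ji.
    by rewrite mxE (negbTE ji) mul0r.
  apply/matrixP => i j; rewrite !mxE; have := B (delta_mx i 0) (delta_mx j 0).
  rewrite !dlt -!colE !mxE => /eqP; rewrite addr_eq0 => /eqP ->.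
  by rewrite opprK.
exists (vskw A) => y; have /(_ y) -> := (vskwP A (vskw A)).2 erefl.
by rewrite AT opprK mulmxDl scalerDr -scalerDl -{1 2}[2^-1]mul1r -splitr scale1r.
Qed.

(** For weights of sum 0, a quadratic form in vertex values is a combination of its values on edges:
    the diagonal terms carry a factor [\sum_i d i]. *)
Lemma quad_edges (M : 'I_4 -> 'I_4 -> R) (d : 'I_4 -> R) : \sum_i d i = 0 ->
  (forall i j, M i i + M j j - M i j - M j i = 0) -> \sum_i \sum_j d i * d j * M i j = 0.
Proof.
move=> d0 H; have S : \sum_i \sum_j d i * d j * (M i j + M j i) = 0.
  rewrite (eq_bigr (fun i => d i * M i i * (\sum_j d j) + d i * \sum_j d j * M j j)).
    rewrite big_split /= -!mulr_suml d0 mulr0 mul0r addr0//.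
  move=> i _; rewrite !mulr_sumr -big_split /=; apply: eq_bigr => j _.
  have -> : M i j + M j i = M i i + M j j by have := H i j; lra.
  ring.
move: S; under eq_bigr do under eq_bigr do rewrite mulrDr.
under eq_bigr do rewrite big_split /=.
rewrite big_split /= [X in _ + X]exchange_big /=.
have -> : \sum_j \sum_i d i * d j * M j i = \sum_i \sum_j d i * d j * M i j.
  by apply: eq_bigr => i _; apply: eq_bigr => j _; ring.
by lra.
Qed.

(** [A] is the gradient of the affine interpolant of [F]. The hypothesis says that its quadratic
    form vanishes on edges, so by [quad_edges] it vanishes everywhere, and a skew matrix in
    dimension 3 is a cross product. *)
Lemma rigid4 w (F : 'I_4 -> point3) : indep w ->
  (forall i j, dot (F i - F j) (w i - w j) = 0) ->
  exists a b, forall j, F j = a + cross b (w j).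
Proof.
move=> iw H; pose A : 'M[R]_3 := \sum_j F j *m (grad w j)^T.
have AE y : A *m y = \sum_j dot (grad w j) y *: F j.
  rewrite mulmx_suml; apply: eq_bigr => j _; rewrite -mulmxA [_^T *m y]mx11_scalar mul_mx_scalar.
  by congr (_ *: _); rewrite mxE; apply: eq_bigr => i _; rewrite mxE.
have [|b bE] := @skew_cross A.
  move=> y; pose d j := dot (grad w j) y.
  have d0 : \sum_j d j = 0 by rewrite /d -dot_suml sum_grad// dot0l.
  have yE : y = \sum_k d k *: w k.
    rewrite {1}(grad_sum 0 y iw); under eq_bigr do rewrite scalerBr.
    by rewrite sumrB -scaler_suml -/d d0 scale0r subr0.
  rewrite AE {1}yE dot_suml -[RHS](@quad_edges (fun i j => dot (w i) (F j)) d d0).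
    by apply: eq_bigr => i _; rewrite dotZl dot_sumr mulr_sumr; apply: eq_bigr => j _; rewrite dotZr mulrA.
  by move=> i j; rewrite -[RHS](H i j) dotBl !dotBr ![dot (F _) _]dotC; ring.
exists (F 0 - cross b (w 0)), b => j.
have : cross b (w j - w 0) = F j - F 0.
  rewrite -bE AE (eq_bigr (fun i => (i == j)%:R *: F i - (i == 0)%:R *: F i)); last first.
    by move=> i _; rewrite grad_dot// scalerBl.
  by rewrite sumrB (bigD1 j)//= eqxx scale1r big1 ?addr0 => [|i /negbTE ->];
    rewrite ?scale0r// (bigD1 0)//= scale1r big1 ?addr0 => [|i /negbTE ->]; rewrite ?scale0r.
by rewrite crossDr crossNr => E; rewrite -addrA [- _ + _]addrC E addrC subrK.
Qed.

(** Take the rigid motion that interpolates [f] at the vertices. The difference at x is orthogonal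
    to every x - w_j, hence to all edges, hence 0. *)
Lemma rigid_fun w (f : point3 -> point3) : indep w ->
  (forall x y, tetra w x -> tetra w y -> dot (f x - f y) (x - y) = 0) ->
  exists a b, forall x, tetra w x -> f x = a + cross b x.
Proof.
move=> iw H; have Tw j : tetra w (w j).
  by apply/tetraP => // i; rewrite bar_vertex// ler0n.
have [a [b E]] := rigid4 iw (F := fun j => f (w j)) (fun i j => H _ _ (Tw i) (Tw j)).
exists a, b => x Tx; apply/subr0_eq; apply: (span_edges iw (p := 0)) => q _.
have Z j : dot (f x - (a + cross b x)) (x - w j) = 0.
  have := H x (w j) Tx (Tw j); have := dot_crossr b (x - w j); rewrite E => H2 H1.
  have -> : f x - (a + cross b x) = (f x - (a + cross b (w j))) - cross b (x - w j).
    rewrite crossDr crossNr !opprD opprK !addrA; apply: colvec_eq; rewrite !mxE; ring.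
  by rewrite dotBl H1 H2 subrr.
by have := Z 0; have := Z q; rewrite !dotBr; lra.
Qed.
End Rigid.

(** * Projection on divergences and explicit test bubbles *)

Section TestFields.
Context {R : realType}.
Notation point3 := 'cV[R]_3.
Variable v : 'I_4 -> point3.
Hypothesis iv : indep v.
Notation family := ('I_4 -> point3 -> point3).
Implicit Types (Z : family) (l m : 'I_4).

Definition smooth_family Z : Prop := forall l i, smooth (fun x => Z l x i 0).

Definition ip Z Z' : R := \sum_l integral3 (alfeld v l) (fun x => dot (Z l x) (Z' l x)).

Lemma smooth_dot2 (f g : point3 -> point3) : (forall i, smooth (fun x => f x i 0)) ->
  (forall i, smooth (fun x => g x i 0)) -> smooth (fun x => dot (f x) (g x)).
Proof. by move=> sf sg; apply: smooth_sum => i _; apply: smoothM. Qed.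

Lemma ipC Z Z' : ip Z Z' = ip Z' Z.
Proof. by apply: eq_bigr => l _; congr integral3; apply/funext => x; rewrite dotC. Qed.

Lemma ipP (a : R) Z Z' Y : smooth_family Z -> smooth_family Z' -> smooth_family Y ->
  ip (fun l x => a *: Z l x + Z' l x) Y = a * ip Z Y + ip Z' Y.
Proof.
move=> sZ sZ' sY; rewrite /ip mulr_sumr -big_split /=; apply: eq_bigr => l _.
have cd (U : family) : smooth_family U -> continuous (fun x => dot (U l x) (Y l x)).
  by move=> sU; apply: smooth_continuous; apply: smooth_dot2.
have il := indep_alf iv l; rewrite -[alfeld v l]/(tetra (alf v l)).
rewrite -int3Z; [|exact: il|exact: cd].
rewrite -int3D; [|exact: il| |exact: cd]; last by apply: contM; [exact: contC|exact: cd].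
by congr integral3; apply/funext => x; rewrite dotDl dotZl.
Qed.

Lemma smooth_familyP (a : R) Z Z' : smooth_family Z -> smooth_family Z' ->
  smooth_family (fun l x => a *: Z l x + Z' l x).
Proof.
move=> sZ sZ' l i; under eq_fun do rewrite !mxE.
by apply: smoothD => //; apply: smoothM => //; exact: smooth_cst.
Qed.

Lemma smooth_family_sum (n : nat) (a : 'I_n -> R) (Y : 'I_n -> family) :
  (forall i, smooth_family (Y i)) -> smooth_family (fun l x => \sum_i a i *: Y i l x).
Proof.
move=> sY l i; under eq_fun do rewrite summxE; apply: smooth_sum => j _.
by under eq_fun do rewrite mxE; apply: smoothM; [exact: smooth_cst|exact: sY].
Qed.

Lemma ip_suml (n : nat) (a : 'I_n -> R) (Y : 'I_n -> family) Z : smooth_family Z ->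
  (forall i, smooth_family (Y i)) ->
  ip (fun l x => \sum_i a i *: Y i l x) Z = \sum_i a i * ip (Y i) Z.
Proof.
move=> sZ; elim: n a Y => [|n IH] a Y sY.
  rewrite big_ord0 /ip big1// => l _; rewrite -[RHS](int3_0 (alfeld v l)); congr integral3.
  by apply/funext => x; rewrite big_ord0 dot0l.
rewrite [RHS]big_ord_recl -IH; last by move=> i; exact: sY.
rewrite -ipP//; last by apply: smooth_family_sum => i; exact: sY.
by congr ip; apply/funext => l; apply/funext => x; rewrite big_ord_recl.
Qed.

Lemma ip_ge0 Z : 0 <= ip Z Z.
Proof.
by apply: sumr_ge0 => l _; apply: fine_ge0; apply: integral_ge0 => z _; rewrite lee_fin dot_ge0.
Qed.

(** The degenerate case of the Cauchy-Schwarz inequality, for a form that is only semidefinite on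
    families of functions. *)
Lemma ip_null Z Y : smooth_family Z -> smooth_family Y -> ip Y Y = 0 -> ip Z Y = 0.
Proof.
move=> sZ sY Y0; apply/eqP; apply: contraT => ZY.
(* The value at which the squared norm of t Y + Z, namely 2 t (Y, Z) + (Z, Z), equals -1. *)
pose t := - (ip Z Z + 1) / (2 * ip Z Y).
have := ip_ge0 (fun l x => t *: Y l x + Z l x).
rewrite ipP//; last exact: smooth_familyP.
rewrite [ip Y _]ipC [ip Z (fun _ _ => _)]ipC !ipP// Y0 [ip Y Z]ipC.
have -> : t * (t * 0 + ip Z Y) + (t * ip Z Y + ip Z Z) = - 1.
  by rewrite /t; field; rewrite ZY.
by rewrite oppr_ge0 ler10.
Qed.

Lemma gram_solve n (G : 'M[R]_n) (d : 'rV[R]_n) :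
  (forall y : 'cV[R]_n, G *m y = 0 -> d *m y = 0) -> exists c, c *m G = d.
Proof.
move=> H; have /submxP[c ->] : (d <= G)%MS.
  rewrite submxE; apply/eqP/matrixP => i j.
  have Z : G *m col j (cokermx G) = 0 by rewrite colE mulmxA mulmx_coker mul0mx.
  have := H _ Z; rewrite colE mulmxA -colE => /matrixP/(_ i 0).
  by rewrite [LHS]mxE [X in _ = X -> _]mxE => ->; rewrite mxE.
by exists c.
Qed.

(** The family [Y] may be dependent and its Gram matrix singular, since different bubbles can have
    the same divergence. The normal equations are solvable all the same: a kernel vector gives a
    combination of norm 0, which [ip_null] makes orthogonal to [Z]. *)
Lemma ip_projection n (Y : 'I_n -> family) Z : smooth_family Z -> (forall i, smooth_family (Y i)) ->
  exists c : 'I_n -> R, forall i, ip (fun l x => Z l x - \sum_j c j *: Y j l x) (Y i) = 0.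
Proof.
move=> sZ sY; pose G : 'M[R]_n := \matrix_(i, j) ip (Y i) (Y j).
pose d : 'rV[R]_n := \row_i ip Z (Y i).
have [y Gy|c cG] := @gram_solve n G d.
  pose F l x := \sum_i y i 0 *: Y i l x.
  have sF : smooth_family F by exact: smooth_family_sum.
  have YF i : ip (Y i) F = 0.
    have /matrixP/(_ i 0) := Gy; rewrite !mxE => E; rewrite -[RHS]E ipC ip_suml//.
    by apply: eq_bigr => j _; rewrite mxE mulrC ipC.
  have FF : ip F F = 0 by rewrite {1}/F ip_suml// big1// => i _; rewrite YF mulr0.
  apply/matrixP => a b; rewrite !ord1 mxE [RHS]mxE -[RHS](ip_null sZ sF FF) ipC ip_suml//.
  by apply: eq_bigr => i _; rewrite mxE mulrC ipC.
exists (fun j => c 0 j) => i.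
have -> : (fun l x => Z l x - \sum_j c 0 j *: Y j l x) =
    fun l x => (-1) *: (\sum_j c 0 j *: Y j l x) + Z l x.
  by apply/funext => l; apply/funext => x; rewrite scaleN1r addrC.
rewrite ipP//; last exact: smooth_family_sum.
rewrite ip_suml//; have /matrixP/(_ 0 i) := cG; rewrite !mxE => <-.
by rewrite mulN1r addrC; apply/eqP; rewrite subr_eq0; apply/eqP/eq_bigr => j _; rewrite mxE.
Qed.

(** Symmetric bubbles given by everywhere defined polynomial pieces with pointwise face conditions,
    the form in which explicit examples can be checked without measure theory. *)
Record test_family k (W : 'I_4 -> point3 -> 'M[R]_3) : Prop := TestFamily {
  test_pf : forall l i j, pf k (fun x => W l x i j);
  test_sym : forall l x, (W l x)^T = W l x;
  test_faces : forall i, face_conditions v (mrow W i)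
}.

(** This places every test bubble in the finite-dimensional space of compatible coefficients, so
    that orthogonality to the divergences of a basis is orthogonality to all of them. *)
Lemma test_coef k W : test_family k W -> exists c : {ffun node k * ('I_3 + 'I_3) -> R^o},
  compatible v (cf (@sym_E R) c) /\ forall l x, W l x = patchwork v (cf (@sym_E R) c) l x.
Proof.
case=> pW sW fW; have [C CE] := pf_patchworkP iv pW.
have sC l b : nodes l b -> (C l b)^T = C l b.
  move=> bl; apply/esym/subr0_eq.
  apply: (@patchwork_free R v iv k 3 3 (fun l b => C l b - (C l b)^T) l) => // x _.
  transitivity (W l x - (W l x)^T); last by rewrite sW subrr.
  rewrite CE /patchwork linear_sum /= -sumrB; apply: eq_bigr => b' _.
  by rewrite linearZ /= scalerBr.
have [l b bl|c cC] := @coef_of R k 3 3 _ (@sym_E R) C; first by apply: sym_E_span; exact: sC.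
have WE l x : W l x = patchwork v (cf (@sym_E R) c) l x.
  by rewrite CE; apply: eq_patchwork => b bl; rewrite cC.
exists c; split => //; apply: (faces_compatible iv) => i.
have -> : patchwork v (cf (@sym_E R) c) = W.
  by apply/funext => l; apply/funext => x; rewrite WE.
have [Fb Fi] := fW i; split=> [l x xl xj|l m x ml xm xl xj].
  apply: Fb => //; apply/(alfeldP iv); rewrite xl lexx; split => // j.
  by have [->|/xj/ltW//] := eqVneq j l; rewrite xl.
have [A B] : alfeld v l x /\ alfeld v m x.
  split; apply/(alfeldP iv); rewrite ?xm; split; try exact: ltW.
    move=> j; have [->//|jl] := eqVneq j l; have [->|jm] := eqVneq j m; first by rewrite xm.
    by apply: ltW; apply: xj.
  move=> j; have [->//|jl] := eqVneq j l; have [->|jm] := eqVneq j m; first by rewrite xm.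
  by apply: ltW; apply: xj.
exact: Fi.
Qed.

Definition grad_fun (h : point3 -> R) (x : point3) : point3 := \col_j partial j h x.

Lemma dot_grad_fun h t x : dot t (grad_fun h x) = ddir t h x.
Proof. by apply: eq_bigr => j _; rewrite mxE. Qed.

Lemma pdiv_scale (h : point3 -> R) (S : 'M[R]_3) x : smooth h ->
  pdiv (fun x => h x *: S) x = S *m grad_fun h x.
Proof.
move=> sh; apply/colP => i; rewrite !mxE; apply: eq_bigr => j _; rewrite mxE.
under eq_fun do rewrite mxE.
rewrite partialM => [|y|y]; last 2 first.
- exact: smooth_derivable.
- exact/smooth_derivable/smooth_cst.
by rewrite partial_cst mulr0 add0r mulrC.
Qed.

Lemma scaled_test k (h : 'I_4 -> point3 -> R) (S : 'I_4 -> 'M[R]_3) :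
  (forall l, pf k (h l)) -> (forall l, (S l)^T = S l) ->
  (forall l x, alfeld v l x -> bar v l x = 0 -> h l x *: (S l *m grad v l) = 0) ->
  (forall l m x, m != l -> alfeld v l x -> alfeld v m x ->
     h l x *: (S l *m (grad v m - grad v l)) = h m x *: (S m *m (grad v m - grad v l))) ->
  test_family k (fun l x => h l x *: S l).
Proof.
move=> ph sS Fb Fi.
have E i l (g x : point3) : dot g (mrow (fun l x => h l x *: S l) i l x) = (h l x *: (S l *m g)) i 0.
  by rewrite !mxE mulr_sumr; apply: eq_bigr => j _; rewrite !mxE; ring.
split=> [l i j|l x|i].
- by under eq_fun do rewrite mxE mulrC; exact: pfZ.
- by rewrite linearZ /= sS.
split=> [l x Tx xl|l m x ml Tl Tm]; first by rewrite E Fb// mxE.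
by rewrite dotBr !E Fi// subrr.
Qed.

Lemma ip_scaled Z (h : 'I_4 -> point3 -> R) (S : 'I_4 -> 'M[R]_3) : (forall l, smooth (h l)) ->
  ip Z (fun l => pdiv (fun x => h l x *: S l)) =
  \sum_l integral3 (alfeld v l) (fun x => dot (Z l x) (S l *m grad_fun (h l) x)).
Proof.
move=> sh; apply: eq_bigr => l _; congr integral3; apply/funext => x.
by rewrite pdiv_scale.
Qed.
End TestFields.

(** * Moments of barycentric coordinates and fields without strain *)

Section Moments.
Context {R : realType}.
Notation point3 := 'cV[R]_3.
Implicit Types (w : 'I_4 -> point3).

Lemma eq_int3 (D : set point3) (f g : point3 -> R) : (forall x, D x -> f x = g x) ->
  integral3 D f = integral3 D g.
Proof. by move=> H; apply: eq_Rintegral => z; rewrite inE => Dz; exact: H. Qed.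

Lemma smooth_bar w i : smooth (bar w i).
Proof.
rewrite (_ : bar w i = aff (grad w i) (bar w i 0)); first exact: smooth_aff.
by apply/funext => x; rewrite barE.
Qed.

Lemma ddir_bar w i (t x : point3) : ddir t (bar w i) x = dot (grad w i) t.
Proof.
rewrite (_ : bar w i = aff (grad w i) (bar w i 0)); last by apply/funext => y; rewrite barE.
by rewrite ddir_aff.
Qed.

Lemma int_edge0 w (a b : 'I_4) (f : point3 -> R) : indep w -> a != b -> smooth f ->
  (forall x, tetra w x -> bar w a x = 0 -> f x = 0) ->
  (forall x, tetra w x -> bar w b x = 0 -> f x = 0) ->
  integral3 (tetra w) (ddir (w a - w b) f) = 0.
Proof.
move=> iw ab sf fa fb; rewrite green_tetra// (opp_face0 iw fa) (opp_face0 iw fb).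
by rewrite subrr mulr0.
Qed.

Lemma moments w : indep w -> exists A : R,
  (forall i j, integral3 (tetra w) (fun x => bar w i x * bar w j x) = (1 + (i == j)%:R) * A) /\
  integral3 (tetra w) (fun _ => 1) = 20 * A.
Proof.
move=> iw; pose m i j := integral3 (tetra w) (fun x => bar w i x * bar w j x).
have cm i j : continuous (fun x => bar w i x * bar w j x).
  by apply: contM; exact: continuous_bar.
have mC i j : m i j = m j i by congr integral3; apply/funext => x; rewrite mulrC.
have sq a b : a != b -> m a a = 2 * m a b.
  move=> ab; have sf : smooth (fun x => bar w a x * (bar w a x * bar w b x)).
    by do !apply: smoothM; exact: smooth_bar.
  have fa x : tetra w x -> bar w a x = 0 -> bar w a x * (bar w a x * bar w b x) = 0.
    by move=> _ ->; rewrite mul0r.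
  have fb x : tetra w x -> bar w b x = 0 -> bar w a x * (bar w a x * bar w b x) = 0.
    by move=> _ ->; rewrite !mulr0.
  have := int_edge0 iw ab sf fa fb.
  rewrite (_ : ddir _ _ = fun x => 2 * (bar w a x * bar w b x) + -1 * (bar w a x * bar w a x)).
    rewrite int3D//; last 2 first.
    - by apply: contM; [exact: contC|exact: cm].
    - by apply: contM; [exact: contC|exact: cm].
    by rewrite !int3Z// -!/(m _ _); lra.
  apply/funext => x; rewrite !ddirM; try by do ?apply: smoothM; exact: smooth_bar.
  by rewrite !ddir_bar !grad_dot// !eqxx [b == a]eq_sym (negbTE ab) /=; ring.
pose A := 2^-1 * m 0 0.
have ma a : m a a = 2 * A.
  rewrite /A mulrA mulfV ?pnatr_eq0// mul1r; have [->//|a0] := eqVneq a 0.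
  by rewrite (sq a 0)// mC -sq// eq_sym.
have mab a b : a != b -> m a b = A.
  by move=> ab; have := sq a b ab; rewrite ma; lra.
exists A; split=> [i j|].
  rewrite -[LHS]/(m i j); have [->|ij] := eqVneq i j; first by rewrite ma /=; ring.
  by rewrite mab//= addr0 mul1r.
transitivity (\sum_i \sum_j m i j).
  rewrite /m; under eq_bigr do rewrite -int3_sum//.
  rewrite -int3_sum//; last by move=> i _; apply: cont_sum => j _; exact: cm.
  congr integral3; apply/funext => x.
  by under eq_bigr do rewrite -mulr_sumr; rewrite -mulr_suml sum_bar// mulr1.
rewrite (eq_bigr (fun _ => 5 * A)); first by rewrite sumr_const card_ord -mulr_natl; ring.
move=> i _; rewrite (bigD1 i)//= ma (eq_bigr (fun _ => A)); last by move=> j ji; rewrite mab// eq_sym.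
rewrite sumr_const (_ : #|_| = 3%N); first by rewrite -mulr_natl; ring.
by rewrite cardC1 card_ord.
Qed.

(** Each point of the tetrahedron is a limit of interior points, moving towards the barycenter. *)
Lemma tetra_closure w (f : point3 -> R) : indep w -> continuous f ->
  (forall x, (forall j, 0 < bar w j x) -> f x = 0) -> forall x, tetra w x -> f x = 0.
Proof.
move=> iw cf H x /(tetraP _ iw) Tx; apply/eqP; apply: contraT => fx.
pose g (s : R) := f (x + s *: (barycenter w - x)).
have cg : continuous g.
  apply: (cont_comp _ cf) => s; apply: cvgD; first exact: cvg_cst.
  by apply: cvgZr_tmp; exact: cvg_id.
have g0 : g 0 != 0 by rewrite /g scale0r addr0.
have /nbhs_ballP[e /= e0 eH] := near_neq0 cg g0.
pose s := Num.min (e / 2) (1 / 2).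
have s0 : 0 < s by rewrite /s lt_min !divr_gt0.
have s1 : s < 1 by rewrite /s gt_min; apply/orP; right; lra.
have : g s != 0.
  apply: eH; rewrite -ball_normE /= sub0r normrN gtr0_norm//.
  by rewrite /s gt_min; apply/orP; left; lra.
rewrite /g H ?eqxx// => j; rewrite bar_line dot_gradB// (bar_barycenter iw).
have -> : bar w j x + s * (4^-1 - bar w j x) = (1 - s) * bar w j x + s * 4^-1 by ring.
by rewrite ltr_wpDl// ?mulr_gt0// mulr_ge0 ?Tx// subr_ge0 ltW.
Qed.

(** The edge strains determine the quadratic form of the gradient, by [quad_edges], so it is 0. The
    mean value theorem on the segment from y to x turns this into (f x - f y) . (x - y) = 0. *)
Lemma strain_rigid w (f : point3 -> point3) : indep w -> (forall i, smooth (fun x => f x i 0)) ->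
  (forall a b x, a != b -> tetra w x ->
     ddir (w a - w b) (fun y => dot (w a - w b) (f y)) x = 0) ->
  exists a b, forall x, tetra w x -> f x = a + cross b x.
Proof.
move=> iw sf H; apply: (rigid_fun iw) => x y Tx Ty.
pose J z : 'M[R]_3 := \matrix_(i, j) partial j (fun y => f y i 0) z.
have ddirJ s t z : ddir t (fun y => dot s (f y)) z = dot s (J z *m t).
  rewrite ddir_dot//; apply: eq_bigr => i _; congr (_ * _); rewrite mxE.
  by apply: eq_bigr => j _; rewrite mxE mulrC.
have quad z d : tetra w z -> dot d (J z *m d) = 0.
  move=> Tz; pose c j := dot (grad w j) d.
  have c0 : \sum_j c j = 0 by rewrite /c -dot_suml sum_grad// dot0l.
  have dE : d = \sum_k c k *: w k.
    rewrite {1}(grad_sum 0 d iw); under eq_bigr do rewrite scalerBr.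
    by rewrite sumrB -scaler_suml -/c c0 scale0r subr0.
  rewrite {1}dE dot_suml -[RHS](@quad_edges R (fun i j => dot (w i) (J z *m w j)) c c0).
    apply: eq_bigr => i _; rewrite dotZl {1}dE linear_sum /= dot_sumr mulr_sumr.
    by apply: eq_bigr => j _; rewrite linearZ /= dotZr mulrA.
  move=> i j; have [->|ij] := eqVneq i j; first by ring.
  by rewrite -[RHS](H i j z ij Tz) ddirJ mulmxBr dotBl !dotBr; ring.
pose d := x - y; pose g (t : R) := dot d (f (y + t *: d)).
have sg : smooth (fun z => dot d (f z)) by exact: smooth_dot.
have dg t : is_derive t (1 : R) g (ddir d (fun z => dot d (f z)) (y + t *: d)).
  exact: is_derive_smooth.
have [c] := @MVT R g (fun t => ddir d (fun z => dot d (f z)) (y + t *: d)) 0 1 ltr01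
   (fun t _ => dg t) (continuous_subspaceT (fun t => ltac:(apply: differentiable_continuous; apply/derivable1_diffP; by have [] := dg t))).
rewrite in_itv /= => /andP[c0 c1]; rewrite ddirJ quad ?mul0r.
  rewrite /g (_ : y + 1 *: d = x); last by rewrite /d scale1r addrC subrK.
  by rewrite scale0r addr0 => E; rewrite dotC dotBr.
apply/tetraP => // j; rewrite bar_line dot_gradB//.
have -> : bar w j y + c * (bar w j x - bar w j y) = (1 - c) * bar w j y + c * bar w j x by ring.
have := (iffLR (tetraP _ iw) Tx) j; have := (iffLR (tetraP _ iw) Ty) j => y0 x0.
by rewrite addr_ge0// mulr_ge0// ?subr_ge0 ltW.
Qed.
End Moments.

Section AlfeldMoments.
Context {R : realType}.
Notation point3 := 'cV[R]_3.
Variable v : 'I_4 -> point3.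
Hypothesis iv : indep v.
Notation c0 := (barycenter v).
Notation u := (fun j => v j - barycenter v).

Lemma alf_moments : exists2 A : R, A != 0 & forall l,
  (forall i j, integral3 (alfeld v l) (fun x => bar (alf v l) i x * bar (alf v l) j x)
     = (1 + (i == j)%:R) * A) /\
  integral3 (alfeld v l) (fun _ => 1) = 20 * A.
Proof.
have [A [_ A20]] := moments (indep_alf iv 0).
have E l : integral3 (tetra (alf v l)) (fun _ : point3 => (1 : R)) = 20 * A.
  have c1 : continuous (fun _ : point3 => (1 : R)) by exact: contC.
  have i0 := indep_alf iv 0; have il := indep_alf iv l.
  by rewrite -A20 !integral_tetra// (vol_alf iv l).2 (vol_alf iv 0).2.
exists A => [|l].
  apply/eqP => A0.
  have i0 := indep_alf iv 0; have := E 0; rewrite A0 mulr0 => E0.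
  have c1 : continuous (fun _ : point3 => (1 : R)) by exact: contC.
  have := @integral_tetra_eq0 R _ _ i0 c1 (fun _ _ => ler01) E0 (barycenter (alf v 0)).
  move=> H; suff /eqP : (1 : R) = 0 by rewrite oner_eq0.
  by apply: H => j; rewrite bar_barycenter// invr_gt0.
have [A' [AA A20']] := moments (indep_alf iv l); split=> [i j|]; last exact: E.
have -> : A = A' by apply: (@mulfI _ 20); rewrite ?pnatr_eq0// -(E l) -A20'.
exact: AA.
Qed.

(** With the second moments (1 + delta_aj) A, the constant part has total weight 5, and the linear
    part involves sum_j (1 + delta_aj) (w_j - c), which equals w_a - v_l because the vertices of the
    piece sum to 5 c - v_l. *)
Lemma alf_first_moment A l : (forall i j,
    integral3 (alfeld v l) (fun x => bar (alf v l) i x * bar (alf v l) j x) = (1 + (i == j)%:R) * A) ->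
  forall (a : 'I_4) (p b s : point3),
  integral3 (alfeld v l) (fun x => bar (alf v l) a x * dot (p + cross b (x - c0)) s) =
  A * dot (5 *: p + cross b (alf v l a - v l)) s.
Proof.
move=> mA a p b s; have il := indep_alf iv l; pose w := alf v l.
have cb i j : continuous (fun x => bar w i x * bar w j x) by apply: contM; exact: continuous_bar.
transitivity (\sum_j dot (p + cross b (w j - c0)) s * ((1 + (a == j)%:R) * A)).
  under [RHS]eq_bigr do rewrite -mA -[alfeld v l]/(tetra w) -int3Z//.
  rewrite -[alfeld v l]/(tetra w) -int3_sum//; last by move=> j _; apply: contM; [exact: contC|exact: cb].
  congr integral3; apply/funext => x; have [xE s1] := bar_hom x il.
  have -> : p + cross b (x - c0) = \sum_j bar w j x *: (p + cross b (w j - c0)).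
    under eq_bigr do rewrite scalerDr -crossZr scalerBr.
    by rewrite big_split /= -scaler_suml -cross_sumr sumrB -scaler_suml s1 !scale1r -xE.
  rewrite dot_suml mulr_sumr; apply: eq_bigr => j _; rewrite dotZl; ring.
have -> : 5 *: p + cross b (w a - v l) = \sum_j (p + cross b (w j - c0)) + (p + cross b (w a - c0)).
  rewrite big_split /= -cross_sumr sumr_const card_ord sumrB sumr_const card_ord.
  have -> : \sum_j w j = 5 *: c0 - v l.
    rewrite (bigD1 l)//= /w /alf eqxx.
    under eq_bigr => j /negbTE jl do rewrite jl.
    have : \sum_j v j = 4 *: c0 by rewrite /barycenter scalerA mulfV ?pnatr_eq0// scale1r.
    rewrite (bigD1 l)//= => /(canRL (addKr _)) ->.
    by apply/colP => i; rewrite !mxE; ring.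
  rewrite addrACA -crossDr; congr (_ + cross b _); last by apply/colP => i; rewrite !mxE; ring.
  by apply/colP => i; rewrite !mxE; ring.
rewrite dotDl dot_suml mulrDr mulr_sumr [X in _ + X](_ : _ =
  \sum_j (a == j)%:R * (A * dot (p + cross b (w j - c0)) s)).
  by rewrite -big_split; apply: eq_bigr => j _ /=; ring.
rewrite (bigD1 a)//= eqxx mul1r big1 ?addr0// => j ja.
by rewrite eq_sym (negbTE ja) mul0r.
Qed.

Lemma grad_fun_barM l a b x : grad_fun (fun x => bar (alf v l) a x * bar (alf v l) b x) x =
  bar (alf v l) a x *: grad (alf v l) b + bar (alf v l) b x *: grad (alf v l) a.
Proof.
apply: dot_ext => y; rewrite dotC dot_grad_fun ddirM; [|exact: smooth_bar|exact: smooth_bar].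
by rewrite !ddir_bar dotDl !dotZl; ring.
Qed.

Lemma grad_fun_bar (w : 'I_4 -> point3) a (x : point3) : grad_fun (bar w a) x = grad w a.
Proof. by apply: dot_ext => y; rewrite dotC dot_grad_fun ddir_bar. Qed.

Lemma pf_bar (w : 'I_4 -> point3) a : pf 1 (bar w a).
Proof.
rewrite (_ : bar w a = aff (grad w a) (bar w a 0)); first exact: pf_affine.
by apply/funext => x; rewrite barE.
Qed.

Definition rigid_pieces (p b : 'I_4 -> point3) : 'I_4 -> point3 -> point3 :=
  fun l x => p l + cross (b l) (x - c0).

(* Up to a factor independent of l and a, the integral over the tetrahedron l
   of its a-th barycentric coordinate times the rigid motion. *)
Definition moment (p b : 'I_4 -> point3) l a : point3 := 5 *: p l + cross (b l) (alf v l a - v l).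

(** Orthogonality to the divergence of lambda_i lambda_j S, with the integrals evaluated by
    [alf_first_moment] and the common factor [A] cancelled. Both indices and S may depend on the
    piece. *)
Lemma quadratic_test k p b (i j : 'I_4 -> 'I_4) (S : 'I_4 -> 'M[R]_3) : (2 <= k)%N ->
  (forall W, test_family v k W -> ip v (rigid_pieces p b) (fun l => pdiv (W l)) = 0) ->
  (forall l, (S l)^T = S l) ->
  (forall l x, alfeld v l x -> bar v l x = 0 ->
     (bar (alf v l) (i l) x * bar (alf v l) (j l) x) *: (S l *m grad v l) = 0) ->
  (forall l m x, m != l -> alfeld v l x -> alfeld v m x ->
     (bar (alf v l) (i l) x * bar (alf v l) (j l) x) *: (S l *m (grad v m - grad v l)) =
     (bar (alf v m) (i m) x * bar (alf v m) (j m) x) *: (S m *m (grad v m - grad v l))) ->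
  \sum_l (dot (moment p b l (i l)) (S l *m grad (alf v l) (j l)) +
          dot (moment p b l (j l)) (S l *m grad (alf v l) (i l))) = 0.
Proof.
move=> k2 H sS Fb Fi; have [A A0 HA] := alf_moments.
pose h l x := bar (alf v l) (i l) x * bar (alf v l) (j l) x.
have ph l : pf k (h l) by apply: (pfW k2); apply: (@pfM _ 1 1); exact: pf_bar.
have sh l : smooth (h l) by exact: pf_smooth (ph l).
have := H _ (scaled_test ph sS Fb Fi); rewrite ip_scaled// => E.
apply: (mulfI A0); rewrite mulr0 -[RHS]E mulr_sumr; apply: eq_bigr => l _.
have [mA _] := HA l; have il := indep_alf iv l.
rewrite mulrDr /moment -!(alf_first_moment mA).
have cb (a : 'I_4) (s : point3) :
    continuous (fun x => bar (alf v l) a x * dot (p l + cross (b l) (x - c0)) s).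
  apply: smooth_continuous; apply: smoothM; first exact: smooth_bar.
  rewrite (_ : (fun x => _) = aff (cross s (b l)) (dot (p l - cross (b l) c0) s)).
    exact: smooth_aff.
  apply/funext => x; rewrite /aff dot_crossC crossDr crossNr dotBl !dotDl dotNl; ring.
rewrite -[alfeld v l]/(tetra (alf v l)) -int3D//; apply: eq_int3 => x _.
rewrite grad_fun_barM mulmxDr -!scalemxAr dotDr !dotZr /rigid_pieces; ring.
Qed.
End AlfeldMoments.

(** * Gluing four rigid motions *)

Section RigidPieces.
Context {R : realType}.
Notation point3 := 'cV[R]_3.
Variable v : 'I_4 -> point3.
Hypothesis iv : indep v.
Notation c0 := (barycenter v).
Notation u := (fun j => v j - barycenter v).

Lemma sym_rank1 (t : point3) : (t *m t^T)^T = t *m t^T.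
Proof. by rewrite trmx_mul trmxK. Qed.

Lemma rank1_mul (t g : point3) : t *m t^T *m g = dot t g *: t.
Proof.
apply/colP => i; rewrite -mulmxA !mxE big_ord1 !mxE mulrC; congr (_ * _).
by apply: eq_bigr => j _; rewrite !mxE.
Qed.

Lemma bar_alf_self l x : bar (alf v l) l x = 4 * bar v l x.
Proof. by rewrite bar_alf// eqxx. Qed.

Lemma bar_common l m x : alfeld v l x -> alfeld v m x -> bar v l x = bar v m x.
Proof.
by move=> /(alfeldP iv)[_ lx] /(alfeldP iv)[_ mx]; apply/eqP; rewrite eq_le lx mx.
Qed.

Lemma sum_centered : \sum_j (v j - c0) = 0.
Proof.
rewrite sumrB sumr_const card_ord /barycenter -scaler_nat scalerA mulfV ?pnatr_eq0//.
by rewrite scale1r subrr.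
Qed.

Lemma centeredB i j : v i - v j = (v i - c0) - (v j - c0).
Proof. by rewrite opprB addrA subrK. Qed.

Lemma grad_centered l j : dot (grad v l) (u j) = (l == j)%:R - 4^-1.
Proof. by rewrite dot_gradB// bar_vertex// bar_barycenter. Qed.

Lemma centered_neq0 j : v j - c0 != 0.
Proof.
apply/eqP => E; have := grad_centered j j; rewrite /= E dot0r eqxx => /eqP.
by rewrite eq_sym subr_eq0 eq_sym invr_eq1 (eqr_nat _ 4 1).
Qed.

(** If the triple product were 0, the normal u_i x u_p would be orthogonal to all four centered
    vertices, as these sum to 0, hence would vanish. Then u_i = t u_p; the gradient of coordinate j
    forces t = 1, that of coordinate i forbids it. *)
Lemma centered_free (i p j : 'I_4) : i != p -> j != i -> j != p ->
  dot (cross (u i) (u p)) (u j) != 0.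
Proof.
move=> ip ji jp; apply/eqP => D0; pose n := cross (u i) (u p).
have ni : dot n (u i) = 0 by exact: dot_crossl.
have np : dot n (u p) = 0 by exact: dot_crossr.
have n0 : n = 0.
  have nq q : dot n (u q) = 0.
    have [->//|qi] := eqVneq q i; have [->//|qp] := eqVneq q p; have [->//|qj] := eqVneq q j.
    have := congr1 (dot n) sum_centered; rewrite dot0r dot_sumr.
    rewrite (bigD1 i)//= ni (bigD1 p)/= 1?eq_sym// np (bigD1 j)/= ?ji ?jp// D0.
    rewrite (bigD1 q)/= ?qi ?qp ?qj// big1 ?addr0 ?add0r//.
    move=> r /andP[/andP[/andP[ri rp] rj] rq]; exfalso.
    have U : uniq [:: i; p; j; q; r].
      rewrite /= !inE !negb_or ip ![_ == r]eq_sym ![_ == q]eq_sym ![_ == j]eq_sym.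
      by rewrite [j == q]eq_sym [j == r]eq_sym [q == r]eq_sym ji jp qi qp qj ri rp rj rq.
    by have := max_card (mem [:: i; p; j; q; r]); rewrite (card_uniqP U) card_ord.
  apply: (@span_edges R v iv i) => q _; rewrite centeredB dotBr [dot n _]nq.
  by rewrite [dot n _]ni subrr.
have pE := cross_eq0 (centered_neq0 p) n0; move: (_ / _) pE => t pE.
have := congr1 (dot (grad v i)) pE; have := congr1 (dot (grad v j)) pE.
rewrite !dotZr !grad_centered eqxx (negbTE ji) (negbTE jp) (negbTE ip) !sub0r /= => E1 E2.
lra.
Qed.

Section Balanced.
Variables (k : nat) (p b : 'I_4 -> point3).
Hypothesis k2 : (2 <= k)%N.
Hypothesis orth : forall W, test_family v k W ->
  ip v (rigid_pieces v p b) (fun l => pdiv (W l)) = 0.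

Lemma sum_delta2 (i j : 'I_4) (F : 'I_4 -> R) :
  \sum_l ((l == i)%:R - (l == j)%:R) * F l = F i - F j.
Proof.
have D (m : 'I_4) : \sum_l (l == m)%:R * F l = F m.
  by rewrite (bigD1 m)//= eqxx mul1r big1 ?addr0// => l /negbTE->; rewrite mul0r.
by rewrite -!D -sumrB; apply: eq_bigr => l _; rewrite mulrBl.
Qed.

(* The bubbles (lambda_c)^2 S, with lambda_c the barycentric coordinate of the barycenter. *)
Lemma center_test : exists a th, forall l, 5 *: p l - cross (b l) (u l) = a + cross th (v l).
Proof.
pose B l := 5 *: p l - cross (b l) (u l); apply: (@rigid4 R v B iv) => i j.
pose t := v i - v j; pose S := t *m t^T.
have Fb (l : 'I_4) (x : point3) : alfeld v l x -> bar v l x = 0 ->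
    (bar (alf v l) l x * bar (alf v l) l x) *: (S *m grad v l) = 0.
  by move=> _ xl; rewrite bar_alf_self xl mulr0 mul0r scale0r.
have Fi (l m : 'I_4) (x : point3) : m != l -> alfeld v l x -> alfeld v m x ->
    (bar (alf v l) l x * bar (alf v l) l x) *: (S *m (grad v m - grad v l)) =
    (bar (alf v m) m x * bar (alf v m) m x) *: (S *m (grad v m - grad v l)).
  by move=> _ Tl Tm; rewrite !bar_alf_self (bar_common Tl Tm).
have := quadratic_test iv (i := id) (j := id) (S := fun _ => S) k2 orth (fun _ => sym_rank1 t) Fb Fi.
(* The 8 is 2 equal terms times the 4 in the gradient of the barycenter's coordinate; the indicators
   come from pairing [grad v l] with the edge. *)
rewrite (eq_bigr (fun l => ((l == i)%:R - (l == j)%:R) * (8 * dot (B l) t))).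
  by rewrite sum_delta2 -mulrBr -dotBl => /eqP; rewrite mulf_eq0 pnatr_eq0 /= => /eqP.
move=> l _; have -> : moment v p b l l = B l.
  by rewrite /moment /alf eqxx -opprB crossNr.
rewrite rank1_mul grad_alf// eqxx dotZr dotZr [dot t _]dotC /t grad_dot//; ring.
Qed.

Section Moments.
Hypothesis bal : forall l, 5 *: p l = cross (b l) (u l).

Lemma moment_self l : moment v p b l l = 0.
Proof. by rewrite /moment /alf eqxx bal -crossDr addrC subrKA subrr cross0r. Qed.

Lemma moment_vertex l q : q != l -> moment v p b l q = cross (b l) (u q).
Proof.
by move=> /negbTE ql; rewrite /moment /alf ql bal -crossDr addrC subrKA.
Qed.

(* The bubbles lambda_c lambda_q S, supported in the three tetrahedra that contain v_q. *)
Lemma edge_test (q i j : 'I_4) : i != q -> i != j ->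
  dot (cross (b i) (u q)) (v i - v j) =
  if j == q then 0 else dot (cross (b j) (u q)) (v i - v j).
Proof.
move=> iq ij; pose t := v i - v j; pose S l := if l == q then 0 else t *m t^T.
have sS l : (S l)^T = S l by rewrite /S; case: eqP => _; rewrite ?trmx0// sym_rank1.
have Fb (l : 'I_4) (x : point3) : alfeld v l x -> bar v l x = 0 ->
    (bar (alf v l) l x * bar (alf v l) q x) *: (S l *m grad v l) = 0.
  by move=> _ xl; rewrite bar_alf_self xl mulr0 mul0r scale0r.
have Fi (l m : 'I_4) (x : point3) : m != l -> alfeld v l x -> alfeld v m x ->
    (bar (alf v l) l x * bar (alf v l) q x) *: (S l *m (grad v m - grad v l)) =
    (bar (alf v m) m x * bar (alf v m) q x) *: (S m *m (grad v m - grad v l)).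
  move=> ml Tl Tm; rewrite !bar_alf_self; have E := bar_common Tl Tm.
  rewrite !bar_alf// /S [q == l]eq_sym [q == m]eq_sym.
  have [lq|lq] := eqVneq l q; have [mq|mq] := eqVneq m q.
  - by rewrite !mul0mx !scaler0.
  - by rewrite mul0mx scaler0 -E lq subrr mulr0 scale0r.
  - by rewrite mul0mx scaler0 -mq E subrr mulr0 scale0r.
  - by rewrite E.
have := quadratic_test iv (i := id) (j := fun _ => q) (S := S) k2 orth sS Fb Fi.
pose F l := if l == q then 0 else dot (cross (b l) (u q)) t.
rewrite (eq_bigr (fun l => ((l == i)%:R - (l == j)%:R) * (4 * F l))).
  rewrite sum_delta2 -mulrBr => /eqP; rewrite mulf_eq0 pnatr_eq0 /= subr_eq0 => /eqP.
  by rewrite /F (negbTE iq).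
move=> l _; rewrite moment_self dot0l add0r /F /S; have [->|lq] := eqVneq l q.
  by rewrite mul0mx dot0r !mulr0.
have ql : q != l by rewrite eq_sym.
rewrite (moment_vertex ql) rank1_mul grad_alf// eqxx dotZr dotZr [dot t _]dotC /t grad_dot//; ring.
Qed.

(** In [edge_test] with [j = q] the right-hand side is 0, which says that b_i x u_i is orthogonal to
    every edge at v_i. *)
Lemma spin_radial i : exists s : R, b i = s *: u i.
Proof.
suff n0 : cross (b i) (u i) = 0 by exists (dot (b i) (u i) / dot (u i) (u i)); exact: cross_eq0 (centered_neq0 i) n0.
apply: (@span_edges R v iv i) => q qi.
have iq : i != q by rewrite eq_sym.
have := edge_test iq iq; rewrite eqxx centeredB dotBr dot_crossr subr0 => E.
rewrite centeredB dotBr dot_crossr subr0.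
by rewrite -oppr0 -E !dotE !crossE; ring.
Qed.

(** Apply [edge_test] to the pieces 0 and j with a third vertex q: both sides become multiples of
    the same nonzero triple product. *)
Lemma spin_common : exists s : R, forall i, b i = s *: u i.
Proof.
have [s0 E0] := spin_radial 0; exists s0 => j; have [s sE] := spin_radial j.
have [->//|j0] := eqVneq j 0; rewrite sE; congr (_ *: _).
have [q q0 qj] : exists2 q : 'I_4, q != 0 & q != j.
  by have [->|j1] := eqVneq j 1; [exists 2|exists 1; rewrite // eq_sym].
have := @edge_test q 0 j; rewrite ![0 == _]eq_sym q0 j0 eq_sym (negbTE qj) => /(_ isT isT).
rewrite E0 sE !crossZl !dotZl centeredB.
rewrite [X in _ * X = _]dotBr [X in _ = _ * X -> _]dotBr.
rewrite !dot_crossl sub0r subr0.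
have -> : dot (cross (u j) (u q)) (u 0) = - dot (cross (u 0) (u q)) (u j).
  by rewrite !dotE !crossE; ring.
have D : dot (cross (u 0) (u q)) (u j) != 0 by apply: centered_free; rewrite // eq_sym.
by rewrite !mulrN => /oppr_inj/(mulIf D).
Qed.

(* A bubble lambda_2 lambda_3 S supported in the tetrahedra 0 and 1, with S piecewise constant. *)
Lemma balanced_eq0 : (forall l, p l = 0) /\ (forall l, b l = 0).
Proof.
have [s bE] := spin_common.
suff s0 : s = 0.
  have b0 l : b l = 0 by rewrite bE s0 scale0r.
  split=> // l; apply: (@scalerI _ _ (5 : R)); first by rewrite pnatr_eq0.
  by rewrite bal b0 cross0l scaler0.
(* The product lambda_2 lambda_3 vanishes on the faces opposite to v_2 and v_3. On the two others,
   S_0 and S_1 are built from edges of the respective boundary face, so they annihilate its normal,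
   and on the common face both send [grad v 1 - grad v 0] to v_2 - v_3. *)
pose e i j : 'M[R]_3 := (v i - v j) *m (v i - v j)^T.
pose S (l : 'I_4) : 'M[R]_3 :=
  if l == 0 then e 3 1 - e 2 1 else if l == 1 then - (e 3 0 - e 2 0) else 0.
have sS l : (S l)^T = S l.
  by rewrite /S; do 2?case: eqP => _; rewrite ?trmx0// ?linearN ?linearB /= !sym_rank1.
have eE i j l : e i j *m grad v l = ((l == i)%:R - (l == j)%:R) *: (v i - v j).
  by rewrite /e rank1_mul dotC grad_dot.
have Fb (l : 'I_4) (x : point3) : alfeld v l x -> bar v l x = 0 ->
    (bar (alf v l) 2 x * bar (alf v l) 3 x) *: (S l *m grad v l) = 0.
  move=> _ _; suff -> : S l *m grad v l = 0 by rewrite scaler0.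
  rewrite /S; elim/ord4P: l => //=; rewrite ?mul0mx ?mulNmx ?mulmxBl ?eE //=;
  by rewrite !subrr ?sub0r ?scale0r ?subrr ?oppr0.
have Fi (l m : 'I_4) (x : point3) : m != l -> alfeld v l x -> alfeld v m x ->
    (bar (alf v l) 2 x * bar (alf v l) 3 x) *: (S l *m (grad v m - grad v l)) =
    (bar (alf v m) 2 x * bar (alf v m) 3 x) *: (S m *m (grad v m - grad v l)).
  move=> ml Tl Tm; have E := bar_common Tl Tm.
  have S2 : S 2 = 0 by [].
  have S3 : S 3 = 0 by [].
  move: ml Tl Tm E; elim/ord4P: l; elim/ord4P: m => //= _ _ _ E;
  rewrite ?S2 ?S3 ?mul0mx ?scaler0// !bar_alf//= -?E ?E ?subrr ?mul0r ?mulr0 ?scale0r//.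
  - by congr (_ *: _); rewrite /S /= mulNmx !mulmxBl !mulmxBr !eE /=; apply/colP => i; rewrite !mxE; ring.
  - by congr (_ *: _); rewrite /S /= mulNmx !mulmxBl !mulmxBr !eE /=; apply/colP => i; rewrite !mxE; ring.
have := quadratic_test iv (i := fun _ => 2) (j := fun _ => 3) (S := S) k2 orth sS Fb Fi.
rewrite big4 [S 2]/S [S 3]/S /= !mul0mx !dot0r !addr0.
rewrite !moment_vertex// !bE /S /= !grad_alf//= !mulNmx !mulmxBl !mulmxBr !eE /=.
have u1 : v 1 - c0 = - ((v 0 - c0) + (v 2 - c0) + (v 3 - c0)).
  have := sum_centered; rewrite big4 => E; apply/eqP; rewrite -subr_eq0 opprK -E.
  by apply/eqP/colP => i; rewrite !mxE; ring.
have D : dot (cross (u 0) (u 2)) (u 3) != 0 by exact: centered_free.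
rewrite ![v 3 - v _]centeredB ![v 2 - v _]centeredB u1; move: D => /=.
move: (v 0 - c0) (v 2 - c0) (v 3 - c0) => x y z D E.
suff /eqP : 8 * (s * dot (cross x y) z) = 0.
  by rewrite !mulf_eq0 pnatr_eq0 (negbTE D) orbF /= => /eqP.
rewrite -[RHS]E !dotE !crossE !mxE; ring.
Qed.
End Moments.
End Balanced.

Lemma dot_delta (y : point3) i : dot y (delta_mx i 0) = y i 0.
Proof.
rewrite /dot (bigD1 i)//= mxE !eqxx mulr1 big1 ?addr0// => j /negbTE ji.
by rewrite mxE ji mulr0.
Qed.

Lemma pf_rigid (a th : point3) i : pf 1 (fun x => (a + cross th x) i 0).
Proof.
apply: pf_ext (pf_affine (cross (delta_mx i 0) th) (a i 0)) => x.
by rewrite /aff mxE dot_crossC dot_delta addrC.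
Qed.

Lemma partial_rigid (a th : point3) i j x :
  partial j (fun x => (a + cross th x) i 0) x = cross (delta_mx i 0) th j 0.
Proof.
rewrite (_ : (fun x => _) = aff (cross (delta_mx i 0) th) (a i 0)) ?partial_aff//.
by apply/funext => y; rewrite /aff mxE dot_crossC dot_delta addrC.
Qed.

(** Green's formula row by row: the face terms vanish, and the gradient of a rigid motion is skew
    while [W] is symmetric. *)
Lemma rm_orth k W a th : test_family v k W ->
  ip v (fun _ x => a + cross th x) (fun l => pdiv (W l)) = 0.
Proof.
case=> pW sW fW; pose r i (x : point3) := (a + cross th x) i 0.
have sr i : smooth (r i) by exact: pf_smooth (pf_rigid a th i).
have smW i l j : smooth (fun y => mrow W i l y j 0).
  by rewrite /mrow; under eq_fun do rewrite mxE; exact: pf_smooth (pW l i j).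
have smp l i : smooth (fun x => pdiv (W l) x i 0).
  by apply: (@smooth_pdiv R W) => ? ? ?; exact: pf_smooth (pW _ _ _).
transitivity (\sum_i \sum_l green_term v (mrow W i) (r i) l); last first.
  by rewrite big1// => i _; apply: face_conditions_green.
rewrite exchange_big /=; apply: eq_bigr => l _; have il := indep_alf iv l.
rewrite /green_term -[alfeld v l]/(tetra (alf v l)) -int3_sum//; last first.
  move=> i _; apply: smooth_continuous; apply: smoothD.
    apply: smoothM => //.
    by have -> : vdiv (mrow W i l) = fun y => pdiv (W l) y i 0; [apply/funext => y; exact: vdiv_mrow|].
  by apply: smooth_sum => j _; apply: smoothM => //; exact: smooth_partial.
apply: eq_int3 => x _; rewrite big_split /= [X in _ = _ + X](_ : _ = 0) ?addr0.
  by apply: eq_bigr => i _; rewrite vdiv_mrow mulrC.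
under eq_bigr => i _ do under eq_bigr => j _ do rewrite partial_rigid mxE.
have symW i j : W l x i j = W l x j i by rewrite -{1}(sW l x) mxE.
rewrite !big3 !(symW 1 0) !(symW 2 0) !(symW 2 1) !crossE !mxE /=; ring.
Qed.

Lemma rigid_piecesE (p b : 'I_4 -> point3) l x :
  rigid_pieces v p b l x = (p l - cross (b l) c0) + cross (b l) x.
Proof. by rewrite /rigid_pieces crossDr crossNr addrAC addrA. Qed.

Lemma smooth_rigid p b : smooth_family (rigid_pieces v p b).
Proof.
move=> l i; under eq_fun do rewrite rigid_piecesE; exact: pf_smooth (pf_rigid _ _ i).
Qed.

Lemma smooth_family_pdiv k W : test_family v k W -> smooth_family (fun l => pdiv (W l)).
Proof.
by case=> pW _ _ l i; apply: (@smooth_pdiv R W) => ? ? ?; exact: pf_smooth (pW _ _ _).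
Qed.

(** Rigid motions are orthogonal to the tests, so one may be subtracted from all pieces. The factor
    1/5 in [q] and the shift of the spins by [th] are chosen to turn [center_test] into the balance
    [5 *: p' l = cross (b' l) (u l)], after which [balanced_eq0] applies. *)
Lemma rigid_pieces_rigid k p b : (2 <= k)%N ->
  (forall W, test_family v k W -> ip v (rigid_pieces v p b) (fun l => pdiv (W l)) = 0) ->
  exists a th, forall l x, rigid_pieces v p b l x = a + cross th x.
Proof.
move=> k2 orth; have [a [th E]] := center_test k2 orth.
pose q : point3 := 5^-1 *: (a + cross th c0).
pose p' l := p l - q; pose b' l := b l + th.
have orth' W : test_family v k W -> ip v (rigid_pieces v p' b') (fun l => pdiv (W l)) = 0.
  move=> tW; pose Y (l : 'I_4) x := (- q - cross th c0) + cross th x : point3.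
  have sY : smooth_family Y by move=> l i; exact: pf_smooth (pf_rigid _ _ i).
  have -> : rigid_pieces v p' b' = fun l x => 1 *: Y l x + rigid_pieces v p b l x.
    apply/funext => l; apply/funext => x.
    by rewrite scale1r !rigid_piecesE /p' /b' /Y !crossDl; apply/colP => i; rewrite !mxE; ring.
  rewrite ipP//; last 2 first.
  - exact: smooth_rigid.
  - exact: smooth_family_pdiv tW.
  by rewrite orth// (rm_orth _ _ tW) mulr0 addr0.
have bal l : 5 *: p' l = cross (b' l) (u l).
  rewrite /p' /q scalerBr scalerA mulfV ?pnatr_eq0// scale1r /b' crossDl.
  have /eqP := E l; rewrite subr_eq => /eqP ->.
  by rewrite [cross th (v l - _)]crossDr crossNr; apply/colP => i; rewrite !mxE; ring.
have [p0 b0] := balanced_eq0 k2 orth' bal.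
exists (q + cross th c0), (- th) => l x; rewrite rigid_piecesE.
have -> : p l = q by apply/subr0_eq; exact: p0.
have -> : b l = - th by apply/eqP; rewrite -addr_eq0; apply/eqP; exact: b0.
by rewrite crossNl opprK.
Qed.
End RigidPieces.

(** * Fields orthogonal to all divergences of bubbles and to rigid motions *)

Section Orthogonal.
Context {R : realType}.
Notation point3 := 'cV[R]_3.
Variable v : 'I_4 -> point3.
Hypothesis iv : indep v.
Variables (k : nat) (z : 'I_4 -> point3 -> point3).
Hypothesis z_pf : forall l i, pf k.-1 (fun x => z l x i 0).
Hypothesis z_div : forall W, test_family v k W -> ip v z (fun l => pdiv (W l)) = 0.
Hypothesis z_rm : forall a th, ip v z (fun _ x => a + cross th x) = 0.

Let z_smooth l i : smooth (fun x => z l x i 0).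
Proof. exact: pf_smooth (z_pf l i). Qed.

Lemma pf_dot n (t : point3) (f : point3 -> point3) : (forall i, pf n (fun x => f x i 0)) ->
  pf n (fun x => dot t (f x)).
Proof. by move=> pff; apply: pf_sum => i _; apply: pfZ. Qed.

Lemma pf_ddir n (t : point3) f : pf n f -> pf n.-1 (ddir t f).
Proof. by move=> pff; apply: pf_sum => j _; apply: pfZ; exact: pf_partial. Qed.

(* Integrating by parts along the edge t turns the orthogonality of z to the
   divergence of (lambda_a lambda_b q) t t^T into
   int lambda_a lambda_b q^2 = 0, where q is the derivative of z.t along t. *)
Lemma strain_test l (a b : 'I_4) x : (2 <= k)%N -> a != b -> tetra (alf v l) x ->
  ddir (alf v l a - alf v l b) (fun y => dot (alf v l a - alf v l b) (z l y)) x = 0.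
Proof.
move=> k2 ab; pose w := alf v l; rewrite -/w; pose t := w a - w b.
have iw : indep w := indep_alf iv l.
pose f y := dot t (z l y); pose q := ddir t f.
have pf_f : pf k.-1 f by exact: pf_dot.
have pf_q : pf k.-2 q by exact: pf_ddir.
pose h y := bar w a y * (bar w b y * q y).
have ph : pf k h.
  have -> : k = (1 + (1 + k.-2))%N by case: k k2 => [|[|]].
  by apply: pfM; [exact: pf_bar|apply: pfM => //; exact: pf_bar].
have sh := pf_smooth ph; have sf := pf_smooth pf_f; have sq := pf_smooth pf_q.
pose S (m : 'I_4) : 'M[R]_3 := if m == l then t *m t^T else 0.
have hc c y : bar w c y = 0 -> h y *: (t *m t^T *m grad w c) = 0.
  move=> yc; rewrite rank1_mul dotC /t grad_dot// /h.
  have [ca|ca] := eqVneq c a; first by rewrite -ca yc mul0r scale0r.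
  have [cb|cb] := eqVneq c b; first by rewrite -cb yc mul0r mulr0 scale0r.
  by rewrite subrr scale0r scaler0.
have sS m : (S m)^T = S m by rewrite /S; case: eqP => _; rewrite ?trmx0// sym_rank1.
have Fb (m : 'I_4) (y : point3) : alfeld v m y -> bar v m y = 0 -> h y *: (S m *m grad v m) = 0.
  move=> _ ym; rewrite /S; case: eqP => [ml|_]; last by rewrite mul0mx scaler0.
  have -> : grad v m = 4^-1 *: grad w l.
    by rewrite /w grad_alf// eqxx scalerA mulVf ?pnatr_eq0// scale1r ml.
  rewrite -scalemxAr scalerA mulrC -scalerA hc ?scaler0//.
  by rewrite /w bar_alf_self// -ml ym mulr0.
have Fi (m n : 'I_4) (y : point3) : n != m -> alfeld v m y -> alfeld v n y ->
    h y *: (S m *m (grad v n - grad v m)) = h y *: (S n *m (grad v n - grad v m)).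
  move=> nm Tm Tn; have E := bar_common iv Tm Tn; rewrite /S.
  have [ml|ml] := eqVneq m l; have [nl|nl] := eqVneq n l.
  - by rewrite nl ml eqxx in nm.
  - have -> : grad v n - grad v m = grad w n by rewrite /w grad_alf// (negbTE nl) ml.
    by rewrite mul0mx scaler0 hc// /w bar_alf// (negbTE nl) -E ml subrr.
  - have -> : grad v n - grad v m = - grad w m by rewrite /w grad_alf// (negbTE ml) nl opprB.
    by rewrite mul0mx scaler0 mulmxN scalerN hc ?oppr0// /w bar_alf// (negbTE ml) E nl subrr.
  - by rewrite !mul0mx !scaler0.
have := z_div (scaled_test (fun _ => ph) sS Fb Fi); rewrite ip_scaled// (bigD1 l)//= big1; last first.
  move=> m ml; rewrite -[RHS](int3_0 (alfeld v m)); apply: eq_int3 => y _.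
  by rewrite /S (negbTE ml) mul0mx dot0r.
rewrite addr0 => E1.
have sfh : smooth (fun y => h y * f y) by exact: smoothM.
have fa y : tetra w y -> bar w a y = 0 -> h y * f y = 0 by move=> _ E; rewrite /h E !mul0r.
have fb y : tetra w y -> bar w b y = 0 -> h y * f y = 0.
  by move=> _ E; rewrite /h E mul0r mulr0 mul0r.
have := int_edge0 iw ab sfh fa fb; rewrite -/t ddirM//.
rewrite int3D//; last 2 first.
- by apply/smooth_continuous/smoothM => //; exact: smooth_ddir.
- by apply/smooth_continuous/smoothM => //; exact: smooth_ddir.
rewrite [X in _ + X = 0 -> _](_ : _ = 0) ?addr0 => [E2|]; last first.
  rewrite -[RHS]E1; apply: eq_int3 => y _.
  by rewrite /S eqxx rank1_mul dotZr dot_grad_fun [dot (z l y) t]dotC.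
have q0 : forall y, (forall j, 0 < bar w j y) -> q y = 0.
  move=> y y0; have chq : continuous (fun y => h y * ddir t f y).
    by apply/smooth_continuous/smoothM => //; exact: smooth_ddir.
  have pos (y' : point3) : tetra w y' -> 0 <= h y' * ddir t f y'.
    move=> /(tetraP _ iw) Ty; rewrite /h -/(q y').
    by rewrite -!mulrA mulr_ge0// mulr_ge0// -expr2 sqr_ge0.
  have := integral_tetra_eq0 iw chq pos E2 y0; rewrite /h -/(q y) => /eqP.
  by rewrite !mulf_eq0 (gt_eqF (y0 a)) (gt_eqF (y0 b)) /= orbb => /eqP.
exact: (tetra_closure iw (smooth_continuous sq) q0).
Qed.

Lemma orth_zero_deg2 : (2 <= k)%N -> ip v z z = 0.
Proof.
move=> k2.
have [ab abP] : {ab : 'I_4 -> point3 * point3 & forall l x, tetra (alf v l) x ->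
    z l x = (ab l).1 + cross (ab l).2 x}.
  apply: (@choice _ _ (fun l (ab : point3 * point3) => forall x, tetra (alf v l) x ->
    z l x = ab.1 + cross ab.2 x)) => l.
  have [a [b H]] := strain_rigid (indep_alf iv l) (z_smooth l) (fun a b x ab => strain_test k2 ab).
  by exists (a, b).
pose p l := (ab l).1 + cross (ab l).2 (barycenter v); pose b l := (ab l).2.
have zE l x : alfeld v l x -> z l x = rigid_pieces v p b l x.
  by move=> Tx; rewrite rigid_piecesE /p addrK; exact: abP.
have orth W : test_family v k W -> ip v (rigid_pieces v p b) (fun l => pdiv (W l)) = 0.
  move=> tW; rewrite -[RHS](z_div tW); apply: eq_bigr => l _.
  by apply: eq_int3 => x Tx; rewrite zE.
have [a [th E]] := rigid_pieces_rigid iv k2 orth.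
rewrite -[RHS](z_rm a th); apply: eq_bigr => l _.
by apply: eq_int3 => x Tx; rewrite [in X in dot _ X]zE// E.
Qed.

Lemma pf0_cst n (f : point3 -> R) : pf n f -> n = 0%N -> exists c, f = fun _ => c.
Proof.
elim=> {n f} [n c|//|n f g _ IHf _ IHg] n0; first by exists c.
by have [c ->] := IHf n0; have [d ->] := IHg n0; exists (c + d).
Qed.

Lemma orth_zero_deg1 : k = 1%N -> ip v z z = 0.
Proof.
move=> k1; pose P l := z l 0.
have zE l x : z l x = P l.
  apply/colP => i; have k0 : k.-1 = 0%N by rewrite k1.
  have [c E] := pf0_cst (z_pf l i) k0.
  have e y : z l y i 0 = c by exact: (congr1 (fun g : point3 -> R => g y) E).
  by rewrite /P !e.
have [A A0 HA] := alf_moments iv.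
have [a [th PE]] : exists a th, forall l, P l = a + cross th (v l).
  apply: (rigid4 iv) => i j; pose t := v i - v j.
  pose h l := bar (alf v l) l.
  have ph l : pf k (h l) by rewrite k1; exact: pf_bar.
  have sh l : smooth (h l) by exact: pf_smooth (ph l).
  have Fb (l : 'I_4) (x : point3) : alfeld v l x -> bar v l x = 0 ->
      h l x *: (t *m t^T *m grad v l) = 0.
    by move=> _ xl; rewrite /h bar_alf_self// xl mulr0 scale0r.
  have Fi (l m : 'I_4) (x : point3) : m != l -> alfeld v l x -> alfeld v m x ->
      h l x *: (t *m t^T *m (grad v m - grad v l)) = h m x *: (t *m t^T *m (grad v m - grad v l)).
    by move=> _ Tl Tm; rewrite /h !bar_alf_self// (bar_common iv Tl Tm).
  have := z_div (scaled_test ph (fun _ => sym_rank1 t) Fb Fi); rewrite ip_scaled//.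
  (* Here 80 is 4 * 20: the gradient of the barycenter's coordinate is [4 *: grad v l], and 1 has
     integral [20 * A] on each piece. *)
  rewrite (eq_bigr (fun l => ((l == i)%:R - (l == j)%:R) * (80 * A * dot (P l) t))).
    rewrite sum_delta2 -mulrBr -dotBl => /eqP.
    by rewrite !mulf_eq0 pnatr_eq0 (negbTE A0) /= => /eqP.
  move=> l _; transitivity (integral3 (alfeld v l) (fun _ => 4 * dot (grad v l) t * dot (P l) t * 1)).
    apply: eq_int3 => x _; rewrite zE grad_fun_bar rank1_mul dotZr grad_alf// eqxx dotZr dotC; ring.
  have il := indep_alf iv l; have c1 : continuous (fun _ : point3 => (1 : R)) by exact: contC.
  rewrite -[alfeld v l]/(tetra (alf v l)) int3Z// (HA l).2 /t grad_dot//; ring.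
(* The rigid motion [Z] is chosen so that its mean over each piece is a quarter of the constant P_l.
   The pieces having equal volumes, its inner product with z is a positive multiple of the sum of
   the |P_l|^2, and it is 0 as z is orthogonal to RM. *)
pose p : point3 := 4^-1 *: (a + cross th (barycenter v)).
pose Z := rigid_pieces v (fun _ => p) (fun _ => - th).
have E1 : ip v Z z = \sum_l 5 * A * dot (P l) (P l).
  apply: eq_bigr => l _; have il := indep_alf iv l.
  transitivity (\sum_i integral3 (alfeld v l) (fun x => bar (alf v l) i x *
      dot (p + cross (- th) (x - barycenter v)) (P l))).
    rewrite -[alfeld v l]/(tetra (alf v l)) -int3_sum//.
      by apply: eq_int3 => x _; rewrite zE -mulr_suml sum_bar// mul1r.
    move=> i _; apply: smooth_continuous; apply: smoothM; first exact: smooth_bar.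
    apply: smooth_dot2 => j; last exact: smooth_cst.
    exact: (smooth_rigid v (fun _ => p) (fun _ => - th) l).
  under eq_bigr do rewrite (alf_first_moment iv (HA l).1).
  rewrite -mulr_sumr -dot_suml [5 * A]mulrC -[RHS]mulrA -[5 * dot _ _]dotZl; congr (_ * dot _ _).
  have -> : \sum_i (5 *: p + cross (- th) (alf v l i - v l)) =
      20 *: p + cross (- th) (\sum_i alf v l i - 4 *: v l).
    rewrite big_split /= -cross_sumr sumrB !sumr_const card_ord; congr (_ + cross _ (_ - _)).
      by apply/colP => i; rewrite !mxE; ring.
    by rewrite scaler_nat.
  have -> : \sum_i alf v l i = 5 *: barycenter v - v l.
    have /(congr1 (fun y => y + 4 *: barycenter v)) := sum_centered v.
    rewrite sumrB sumr_const card_ord -scaler_nat subrK add0r (bigD1 l)//= => E.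
    rewrite (bigD1 l)//= {1}/alf eqxx.
    rewrite (eq_bigr v); last by move=> j /negbTE jl; rewrite /alf jl.
    by move/(canRL (addKr _)): E => ->; apply/colP => i; rewrite !mxE; ring.
  rewrite PE /p crossNl !crossDr !crossNr !crossZr.
  by move: (cross th _) (cross th _) => X Y; apply/colP => i; rewrite !mxE; field.
have : ip v Z z = 0.
  rewrite ipC -[RHS](z_rm (p - cross (- th) (barycenter v)) (- th)).
  by congr ip; apply/funext => l; apply/funext => x; rewrite /Z rigid_piecesE.
rewrite E1 => E2; transitivity (4 * \sum_l 5 * A * dot (P l) (P l)); last by rewrite E2 mulr0.
rewrite mulr_sumr; apply: eq_bigr => l _.
have il := indep_alf iv l; have c1 : continuous (fun _ : point3 => (1 : R)) by exact: contC.
transitivity (integral3 (alfeld v l) (fun _ => dot (P l) (P l) * 1)).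
  by apply: eq_int3 => x _; rewrite zE mulr1.
rewrite -[alfeld v l]/(tetra (alf v l)) int3Z// (HA l).2; ring.
Qed.

Lemma orth_zero : (1 <= k)%N -> ip v z z = 0.
Proof.
by rewrite leq_eqVlt => /orP[/eqP/esym/orth_zero_deg1|/orth_zero_deg2].
Qed.

Lemma ip_eq0 : ip v z z = 0 -> forall l x, alfeld v l x -> z l x = 0.
Proof.
have c l : continuous (fun x => dot (z l x) (z l x)) by apply/smooth_continuous/smooth_dot2.
move=> /eqP; rewrite psumr_eq0 => [/allP E l|l _]; last first.
  by apply: fine_ge0; apply: integral_ge0 => y _; rewrite lee_fin dot_ge0.
have il := indep_alf iv l; have /implyP/(_ isT)/eqP El := E l (mem_index_enum l).
have H x : (forall j, 0 < bar (alf v l) j x) -> dot (z l x) (z l x) = 0.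
  by move=> Hx; apply: (integral_tetra_eq0 il (c l) _ El) => // y _; exact: dot_ge0.
by move=> x Tx; apply: dot_eq0; exact: (tetra_closure il (c l) H).
Qed.
End Orthogonal.

(** * The image of the divergence *)

Section DivergenceImage.
Context {R : realType}.
Notation point3 := 'cV[R]_3.
Variable v : 'I_4 -> point3.
Hypothesis iv : indep v.
Variable k : nat.
Hypothesis k1 : (1 <= k)%N.
Notation T := (tetra v).
Notation sE := (@sym_E R).

Lemma pdivP (a : R) (W W' : point3 -> 'M[R]_3) x : (forall i j, smooth (fun x => W x i j)) ->
  (forall i j, smooth (fun x => W' x i j)) ->
  pdiv (fun x => a *: W x + W' x) x = a *: pdiv W x + pdiv W' x.
Proof.
move=> sW sW'; apply/colP => i; rewrite !mxE mulr_sumr -big_split /=; apply: eq_bigr => j _.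
rewrite -!ddir_delta; under eq_fun do rewrite !mxE.
by rewrite ddirD//; [rewrite ddirZ|exact/smoothM/sW/smooth_cst].
Qed.

Lemma pdiv_sum (n : nat) (a : 'I_n -> R) (W : 'I_n -> point3 -> 'M[R]_3) x :
  (forall m i j, smooth (fun x => W m x i j)) ->
  pdiv (fun x => \sum_m a m *: W m x) x = \sum_m a m *: pdiv (W m) x.
Proof.
move=> sW; elim: n a W sW => [|n IH] a W sW.
  rewrite big_ord0; apply/colP => i; rewrite !mxE big1// => j _.
  by under eq_fun do rewrite big_ord0 mxE; rewrite partial_cst.
rewrite big_ord_recl -IH//.
rewrite -pdivP//; last first.
  move=> i j; under eq_fun do rewrite summxE; apply: smooth_sum => m _.
  by under eq_fun do rewrite mxE; apply: smoothM => //; exact: smooth_cst.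
by congr (pdiv _ x); apply/funext => y; rewrite big_ord_recl.
Qed.

Lemma L2inner_ip (u w : point3 -> point3) Z : L2_vec T u -> rep v u Z -> smooth_family Z ->
  (forall i, smooth (fun x => w x i 0)) -> L2inner T u w = ip v Z (fun _ => w).
Proof.
move=> u2 uZ sZ sw; rewrite /L2inner /ip.
have dE (y y' : point3) : \sum_i \sum_j y i j * y' i j = dot y y'.
  by apply: eq_bigr => i _; rewrite big_ord1.
under eq_fun do rewrite dE.
apply: (integral_rep iv) => [|l|l].
- rewrite (_ : _ \o _ = fun p => (\sum_i (u (pt3 p) i 0 * w (pt3 p) i 0)%:E)%E); last first.
    by apply/funext => p; rewrite /= sumEFin.
  apply: integrable_sum => [|i _]; first exact: measurable_tetra.
  exact: (integrable_L2_cont iv i 0 u2 (smooth_continuous (sw i))).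
- exact/smooth_continuous/smooth_dot2.
- by apply: ae_onW (uZ l) => x _ ->.
Qed.

Lemma compatible_test (C : 'I_4 -> expo k -> 'M[R]_3) : (forall l b, nodes l b -> (C l b)^T = C l b) ->
  compatible v C -> test_family v k (patchwork v C).
Proof.
move=> sC cC; split=> [l i j|l x|i]; first exact: pf_patchwork.
  by rewrite /patchwork linear_sum /=; apply: eq_bigr => b bl; rewrite linearZ /= sC.
exact: (compatible_faces iv cC).
Qed.

Lemma div_bubble u : div_image T (Bdiv_S v k) u -> L2orth T (@Pdisc R 3 1 v k.-1 setT) RM u.
Proof.
move=> [tau [tauP tau0] du]; have [C tC] := Pdisc_patchwork iv tauP.
have sC := sym_patchwork iv tauP.1 tC.
have cC := bubble_compatible iv tC tau0.
have [uD _] := bubble_elim iv tauP.1 tC (@patchwork_smooth R v k 3 3 C) tau0 du.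
have tW := compatible_test sC cC.
split.
  apply: (patchwork_Pdisc du.1 _ uD) => l i j; rewrite ord1 /pdiv.
  by under eq_fun do rewrite mxE; apply: pf_sum => m _; exact/pf_partial/pf_patchwork.
move=> _ [a [th ->]]; rewrite (L2inner_ip du.1 uD)//.
- by rewrite ipC (rm_orth iv _ _ tW).
- exact: smooth_family_pdiv tW.
- by move=> i; exact: pf_smooth (pf_rigid _ _ i).
Qed.

Lemma bubble_div u : L2orth T (@Pdisc R 3 1 v k.-1 setT) RM u -> div_image T (Bdiv_S v k) u.
Proof.
move=> [uP urm]; have [D uD] := Pdisc_patchwork iv uP.
pose Z := patchwork v D.
have sZ : smooth_family Z by move=> l i; exact: patchwork_smooth.
have [||y _ []//|S [SP _]] := @compatible_dim R v iv k k1 _ sE (@sym_E_span R) 0 (fun _ _ => 0) => //.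
  by move=> a _ _ _; rewrite mulr0 addr0.
have tc c : c \in S -> test_family v k (patchwork v (cf sE c)).
  by move=> /SP[cC _]; apply: compatible_test => // l b _; exact: sym_E_sym.
pose e (i : 'I_(\dim S)) := (vbasis S)`_i.
have eS i : e i \in S by apply: vbasis_mem; rewrite mem_nth// size_tuple.
pose Y i l := pdiv (patchwork v (cf sE (e i)) l).
have sY i : smooth_family (Y i) by exact: smooth_family_pdiv (tc _ (eS i)).
have YE (a : 'I_(\dim S) -> R) l x :
    pdiv (patchwork v (cf sE (\sum_i a i *: e i)) l) x = \sum_i a i *: Y i l x.
  rewrite -pdiv_sum; last by move=> m i j; exact: patchwork_smooth.
  by congr (pdiv _ x); apply/funext => y; rewrite patchwork_sum.
(* The divergences of a basis of the compatible symmetric coefficients span all divergences of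
   bubbles; [d] gathers the coefficients of the projection, and the remainder [z] has to be shown to
   be 0. *)
have [c cP] := ip_projection iv sZ sY.
pose d := \sum_j c j *: e j.
pose z l x := Z l x - \sum_j c j *: Y j l x.
have tdS : d \in S by apply: memv_suml => i _; exact/memvZ/eS.
have td := tc _ tdS.
have zE : z = fun l x => (-1) *: (\sum_j c j *: Y j l x) + Z l x.
  by apply/funext => l; apply/funext => x; rewrite scaleN1r addrC.
have sz : smooth_family z.
  by rewrite zE; apply: smooth_familyP => //; exact: smooth_family_sum.
have z_pf l i : pf k.-1 (fun x => z l x i 0).
  rewrite /z; under eq_fun do rewrite -YE; rewrite -/d.
  have p1 : pf k.-1 (fun x => pdiv (patchwork v (cf sE d) l) x i 0).
    rewrite /pdiv; under eq_fun do rewrite mxE.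
    by apply: pf_sum => m _; exact/pf_partial/pf_patchwork.
  have pZ : pf k.-1 (fun x => Z l x i 0) by exact: pf_patchwork.
  apply: pf_ext (pf_add pZ (pfZ (-1) p1)) => x.
  by rewrite mulN1r [RHS]mxE; congr (_ + _); rewrite [RHS]mxE.
have z_div W : test_family v k W -> ip v z (fun l => pdiv (W l)) = 0.
  move=> tW; have [b [bC Wb]] := test_coef iv tW.
  have bS : b \in S by apply/SP.
  have WE : (fun l => pdiv (W l)) = fun l x => \sum_i coord (vbasis S) i b *: Y i l x.
    apply/funext => l; apply/funext => x; rewrite -YE -(coord_vbasis bS).
    by congr (pdiv _ x); apply/funext => y.
  by rewrite WE ipC ip_suml// big1// => i _; rewrite ipC cP mulr0.
have z_rm a th : ip v z (fun _ x => a + cross th x) = 0.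
  have sr : smooth_family (fun (_ : 'I_4) x => a + cross th x).
    by move=> l i; exact: pf_smooth (pf_rigid _ _ i).
  rewrite zE ipP//; last exact: smooth_family_sum.
  rewrite ip_suml// big1 ?mulr0 ?add0r => [|i _]; last first.
    by rewrite ipC (rm_orth iv _ _ (tc _ (eS i))) mulr0.
  rewrite -(L2inner_ip uP.1 uD)//; first by apply: urm; exists a, th.
  by move=> i; exact: (sr 0).
(* A zero remainder means that [u] agrees on every piece with the divergence of the bubble with
   coefficients [d], which is the required preimage. *)
have z0 := ip_eq0 iv z_pf (orth_zero iv z_pf z_div z_rm k1).
have ud : rep v u (fun l => pdiv (patchwork v (cf sE d) l)).
  move=> l; apply: ae_onW (uD l) => x Tx ->; rewrite YE.
  by apply: subr0_eq; exact: z0.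
have P : Pdisc v k (@sym_mx R) (field v sE d).
  by apply: (field_Pdisc iv) => l x; exact: (test_sym td).
have [du F0] := bubble_intro iv P.1 (field_rep iv sE d) (@patchwork_smooth R v k 3 3 _) uP.1 ud
  (test_faces td).
by exists (field v sE d).
Qed.
End DivergenceImage.

Theorem lemma3p8 (R : realType) (v : 'I_4 -> 'cV[R]_3)
    (hv : affinely_independent v) (k : nat) (hk : (1 <= k)%N) :
  div_image (tetra v) (Bdiv_S v k)
    = L2orth (tetra v) (@Pdisc R 3 1 v k.-1 setT) RM
  /\
  exists dS dM dP : nat,
    [/\ L2dim (tetra v) (Bdiv_S v k) dS,
        L2dim (tetra v) (Bdiv_M v k) dM,
        L2dim (tetra v) (@Pdisc R 3 1 v k setT) dP,
        dS%:Z = dM%:Z - dP%:Z + 3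
      & dM%:Z - dP%:Z + 3 = (k%:Z + 1) * (k%:Z + 2) * (4 * k%:Z - 3)].
Proof.
have iv := affinely_independent_indep hv; split.
  by apply/seteqP; split=> u; [exact: div_bubble|exact: bubble_div].
have [dS HS ES] := dim_sym iv hk; have [dM HM EM] := dim_all iv hk.
have HP := dim_vec iv k; have [E1 E2] := dimension_formula ES EM (erefl _).
by exists dS, dM, (4 * 'C(k + 3, 3) * 3)%N.
Qed.
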